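(* Let $v$ be a (real) analytic vector field on the circle $S^1=\mathbb R/2\pi\mathbb Z$ which is not of the form $v(x)=a\sin(mx)+b\cos(mx)+c$ for any $a,b,c\in\mathbb R$, $m\in\mathbb Z$. Then there exists an analytic function $f:S^1\to\mathbb R$ such that the family of differential equations $$\dot x=v(x)+A+Bf(t),\qquad A,B\in\mathbb R,$$ on the torus $\mathbb T^2=\mathbb R^2/2\pi\mathbb Z^2$ with coordinates $(x,t)$ has phase-lock areas for all the rational values of the rotation number; that is, for every $r\in\mathbb Q$ the level set $\{(A,B)\in\mathbb R^2 \mid \rho(A,B)=r\}$ of the rotation number function $\rho$ of the family has non-empty interior in $\mathbb R^2$.
   Context: A vector field $v(x)\frac{d}{dx}$ on $S^1=\mathbb R/2\pi\mathbb Z$ is identified with the $2\pi$-periodic function $v(x)$. Rotation number of an equation. For an equation $\dot x=\phi(x,t)$ with smooth right-hand side on $\mathbb T^2=\mathbb R^2/2\pi\mathbb Z^2$, lift it to the universal cover $\mathbb R$ of the $x$-circle and let $H_{r,t}:\mathbb R\to\mathbb R$ be the lifted flow map from time $r$ to time $r+t$, with $H_{r,0}=\mathrm{Id}$. The limit $\rho=\lim_{n\to+\infty}\frac{1}{2\pi n}H_{r,2\pi n}(x)\in\mathbb R$ exists and depends neither on $x$ nor on $r$; it is called the rotation number of the equation. For the family $\dot x=v(x)+A+Bf(t)$, $\rho(A,B)\in\mathbb R$ denotes the rotation number of the equation with parameters $(A,B)$. Phase-lock area. For $r\in\mathbb R$, the $r$-th phase-lock area is the level set $\{(A,B)\in\mathbb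 R^2\mid \rho(A,B)=r\}$, provided it has non-empty interior. *)

(* Defs.v *)
From Stdlib Require Import Reals ZArith QArith Qreals.
From Coquelicot Require Import Coquelicot.
Open Scope R_scope.

(* Functions (and vector fields v(x) d/dx) on the circle R/2piZ are represented
   by their 2pi-periodic lifts R -> R. *)
Definition periodic_2PI (g : R -> R) : Prop :=
  forall x : R, g (x + 2 * PI) = g x.

Definition real_analytic (g : R -> R) : Prop :=
  forall x0 : R, exists a : nat -> R,
    locally x0 (fun x : R => is_pseries a (x - x0) (g x)).

Definition analytic_on_circle (g : R -> R) : Prop :=
  periodic_2PI g /\ real_analytic g.

(* [H r t] is the flow map of dx/dt = phi x t, lifted to the universal cover of
   the x-circle, from time [r] to time [r + t] (the second argument is the
   duration). *)
Definition is_lifted_flow (phi : R -> R -> R) (H : R -> R -> R -> R) : Prop :=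
  forall r x : R,
    H r 0 x = x /\
    forall t : R, is_derive (fun s : R => H r s x) t (phi (H r t x) (r + t)).

(* For a smooth phi, 2pi-periodic in both variables, the flow H is unique and
   the limit exists and does not depend on (r, x); hence the relation below is
   then the graph of the rotation number. *)
Definition is_rotation_number (phi : R -> R -> R) (rho : R) : Prop :=
  exists H : R -> R -> R -> R,
    is_lifted_flow phi H /\
    forall r x : R,
      is_lim_seq (fun n : nat => / (2 * PI * INR n) * H r (2 * PI * INR n) x)
        (Finite rho).

Definition family (v f : R -> R) (A B : R) : R -> R -> R :=
  fun x t : R => v x + A + B * f t.

Definition rotation_level_set (v f : R -> R) (r : R) : R * R -> Prop :=
  fun p : R * R => is_rotation_number (family v f (fst p) (snd p)) r.

Definition nonempty_interior (E : R * R -> Prop) : Prop :=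
  exists p : R * R, locally p E.

Definition has_phase_lock_area (v f : R -> R) (r : R) : Prop :=
  nonempty_interior (rotation_level_set v f r).

(* Main.v *)
(** Write [X(t, s)] for the solution of [x' = v(x) + F(t)] starting at [s], and let [T = 2 PI q].
    If [X(T, s) - s - 2 PI p] takes both signs, it does so for every forcing close to [F]; then
    the intermediate value theorem gives a periodic orbit, so the rotation number is [p/q] on
    a neighbourhood.  Otherwise, after adding a constant to [F], every orbit is periodic:
    [X(T, s) = s + 2 PI p] for all [s].

    Suppose the latter happens for an open set of forcings.  Call a function [w] balanced if, for
    all these forcings and all times [t], the mean of [w] over the [q] points [X(t + 2 PI j, s)],
    with weights [1 / (dX/ds)(t + 2 PI j, s)], does not depend on the orbit [s].  The first
    variation of the identity [X(T, s) = s + 2 PI p] shows that [v'] is balanced.  Perturbing [F] by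
    the derivative of a spike at time [t] moves all the points at time [t] by the same amount, so
    balanced functions are stable under derivation; differentiating in [t], they are also stable
    under the Lie bracket with [v].  If [v] has two harmonics of distinct degrees, the resulting
    Lie algebra contains all the harmonics of degree divisible by some [n], hence bumps
    concentrated at the points congruent to [x0] modulo [2 PI / n].  The mean of such a bump tells
    the orbit through [x0] from an orbit avoiding these points: a contradiction.

    So, for each [p/q], arbitrarily small analytic corrections of any forcing make [p/q] robust,
    and [f] is the sum of a rapidly decreasing series of corrections, one for each
    rational number. *)

Require Import Defs.
From Stdlib Require Import Reals ZArith QArith Qreals.
From Coquelicot Require Import Coquelicot.
From Stdlib Require Import Lra Lia Psatz Classical FunctionalExtensionality ClassicalEpsilon.
From Stdlib Require Import List Cantor.
Open Scope R_scope.

Lemma choice (A B : Type) (P : A -> B -> Prop) :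
  (forall x, exists y, P x y) -> exists f, forall x, P x (f x).
Proof.
intros H; exists (fun x => proj1_sig (constructive_indefinite_description _ (H x))).
intros x; apply proj2_sig.
Qed.

(** * Calculus on the line *)

Definition cont (f : R -> R) : Prop := forall x : R, continuous f x.

Lemma derive_cont (f df : R -> R) :
  (forall x, is_derive f x (df x)) -> cont f.
Proof.
intros H x; apply (@ex_derive_continuous R_AbsRing R_NormedModule); eexists; apply H.
Qed.

Lemma mean_value (f df : R -> R) (a b : R) :
  (forall x, Rmin a b <= x <= Rmax a b -> is_derive f x (df x)) ->
  exists c, Rmin a b <= c <= Rmax a b /\ f b - f a = df c * (b - a).
Proof.
intros H; apply (MVT_gen f a b df).
- intros x Hx; apply H; lra.
- intros x Hx; apply continuity_pt_filterlim.
  apply (@ex_derive_continuous R_AbsRing R_NormedModule); eexists; apply H; exact Hx.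
Qed.

Lemma derive_nonneg_le (f df : R -> R) (a b : R) :
  (forall x, a <= x <= b -> is_derive f x (df x)) ->
  (forall x, a <= x <= b -> 0 <= df x) -> a <= b -> f a <= f b.
Proof.
intros H H0 Hab.
destruct (mean_value f df a b) as [c [Hc E]].
- rewrite Rmin_left, Rmax_right by lra; exact H.
- rewrite Rmin_left, Rmax_right in Hc by lra.
  specialize (H0 c Hc); nra.
Qed.

Lemma derive_pos_lt (f df : R -> R) (a b : R) :
  (forall x, a <= x <= b -> is_derive f x (df x)) ->
  (forall x, a <= x <= b -> 0 < df x) -> a < b -> f a < f b.
Proof.
intros H H0 Hab.
destruct (mean_value f df a b) as [c [Hc E]].
- rewrite Rmin_left, Rmax_right by lra; exact H.
- rewrite Rmin_left, Rmax_right in Hc by lra.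
  specialize (H0 c Hc); nra.
Qed.

Lemma derive_dominated (D D' E E' : R -> R) (T : R) :
  (forall t, 0 <= t <= T -> is_derive D t (D' t)) ->
  (forall t, 0 <= t <= T -> is_derive E t (E' t)) ->
  (forall t, 0 <= t <= T -> Rabs (D' t) <= E' t) ->
  Rabs (D 0) <= E 0 ->
  forall t, 0 <= t <= T -> Rabs (D t) <= E t.
Proof.
intros HD HE Hb H0 t Ht.
assert (A1 : E 0 - D 0 <= E t - D t).
{ apply (derive_nonneg_le (fun x => E x - D x) (fun x => E' x - D' x)).
  - intros x Hx; apply @is_derive_minus; [apply HE | apply HD]; lra.
  - intros x Hx; assert (B := Hb x ltac:(lra)); apply Rabs_le_between in B; lra.
  - lra. }
assert (A2 : E 0 + D 0 <= E t + D t).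
{ apply (derive_nonneg_le (fun x => E x + D x) (fun x => E' x + D' x)).
  - intros x Hx; apply @is_derive_plus; [apply HE | apply HD]; lra.
  - intros x Hx; assert (B := Hb x ltac:(lra)); apply Rabs_le_between in B; lra.
  - lra. }
apply Rabs_le_between in H0; apply Rabs_le_between; lra.
Qed.

Lemma bounded_derive_lipschitz (f df : R -> R) (M : R) :
  (forall x, is_derive f x (df x)) -> (forall x, Rabs (df x) <= M) ->
  forall x y, Rabs (f x - f y) <= M * Rabs (x - y).
Proof.
intros H HM x y.
destruct (mean_value f df y x) as [c [_ E]]; [intros; apply H|].
rewrite E, Rabs_mult; apply Rmult_le_compat_r; [apply Rabs_pos | apply HM].
Qed.

Lemma taylor_quadratic_bound (f df ddf : R -> R) (M : R) :
  (forall x, is_derive f x (df x)) -> (forall x, is_derive df x (ddf x)) ->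
  (forall x, Rabs (ddf x) <= M) ->
  forall x y, Rabs (f y - f x - df x * (y - x)) <= M * (y - x) ^ 2.
Proof.
intros H H2 HM x y.
destruct (mean_value f df x y) as [c [Hc E]]; [intros; apply H|].
replace (f y - f x - df x * (y - x)) with ((df c - df x) * (y - x)) by (rewrite E; ring).
assert (B := bounded_derive_lipschitz df ddf M H2 HM c x).
assert (Hcx : Rabs (c - x) <= Rabs (y - x)).
{ unfold Rmin, Rmax in Hc; destruct (Rle_dec x y).
  - rewrite !Rabs_pos_eq; lra.
  - rewrite !Rabs_left1; lra. }
assert (0 <= M) by (generalize (HM x) (Rabs_pos (ddf x)); lra).
rewrite Rabs_mult, <- (pow2_abs (y - x)).
assert (P := Rabs_pos (y - x)); assert (P' := Rabs_pos (c - x)).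
apply Rle_trans with (M * Rabs (c - x) * Rabs (y - x)).
- apply Rmult_le_compat_r; assumption.
- replace (M * Rabs (y - x) ^ 2) with (M * Rabs (y - x) * Rabs (y - x)) by ring.
  apply Rmult_le_compat_r; [assumption|]; apply Rmult_le_compat_l; assumption.
Qed.

Lemma ex_RInt_cont (f : R -> R) (a b : R) :
  cont f -> ex_RInt f a b.
Proof. intros H; apply @ex_RInt_continuous; intros; apply H. Qed.

Lemma is_derive_RInt_upper (f : R -> R) (a t : R) :
  cont f -> is_derive (fun x => RInt f a x) t (f t).
Proof.
intros H; apply (is_derive_RInt f (fun x => RInt f a x) a t); [|apply H].
apply filter_forall; intros x; apply @RInt_correct, ex_RInt_cont, H.
Qed.

Lemma RInt_of_derive (f df : R -> R) (a b : R) :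
  (forall x, is_derive f x (df x)) -> cont df ->
  RInt df a b = f b - f a.
Proof.
intros H Hc; apply @is_RInt_unique.
apply (is_RInt_derive f df a b); intros; [apply H | apply Hc].
Qed.

Lemma cont_RInt (f : R -> R) (a : R) :
  cont f -> cont (fun t => RInt f a t).
Proof.
intros H; apply derive_cont with f; intros; apply is_derive_RInt_upper, H.
Qed.

Lemma cont_plus (f g : R -> R) :
  cont f -> cont g ->
  cont (fun t => f t + g t).
Proof. intros Hf Hg x; apply (@continuous_plus _ R_AbsRing R_NormedModule); [apply Hf | apply Hg]. Qed.

Lemma cont_minus (f g : R -> R) :
  cont f -> cont g ->
  cont (fun t => f t - g t).
Proof. intros Hf Hg x; apply (@continuous_minus _ R_AbsRing R_NormedModule); [apply Hf | apply Hg]. Qed.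

Lemma cont_opp (f : R -> R) :
  cont f -> cont (fun t => - f t).
Proof. intros Hf x; apply (@continuous_opp _ R_AbsRing R_NormedModule); apply Hf. Qed.

Lemma cont_mult (f g : R -> R) :
  cont f -> cont g ->
  cont (fun t => f t * g t).
Proof. intros Hf Hg x; apply (@continuous_mult _ R_AbsRing); [apply Hf | apply Hg]. Qed.

Lemma cont_const (c : R) : cont (fun _ => c).
Proof. intros x; apply continuous_const. Qed.

Lemma cont_id : cont (fun t => t).
Proof. intros x; apply continuous_id. Qed.

Lemma cont_comp (f g : R -> R) :
  cont f -> cont g ->
  cont (fun t => g (f t)).
Proof. intros Hf Hg x; apply (continuous_comp f g); [apply Hf | apply Hg]. Qed.

Lemma cont_cos : cont cos.
Proof. intros x; apply continuous_cos. Qed.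

Lemma cont_sin : cont sin.
Proof. intros x; apply continuous_sin. Qed.

Lemma cont_pow (f : R -> R) (n : nat) :
  cont f -> cont (fun t => f t ^ n).
Proof.
intros Hf; induction n; simpl; [apply cont_const|].
apply cont_mult; assumption.
Qed.

Lemma cont_sum_n (f : nat -> R -> R) (n : nat) :
  (forall k, cont (f k)) ->
  cont (fun t => sum_n (fun k => f k t) n).
Proof.
intros H x; induction n.
- apply continuous_ext with (f 0%nat); [intros; now rewrite sum_O | apply H].
- apply continuous_ext with (fun t => sum_n (fun k => f k t) n + f (S n) t).
  + intros; now rewrite sum_Sn.
  + apply (@continuous_plus _ R_AbsRing R_NormedModule); [exact IHn | apply H].
Qed.

Lemma cont_ext (f g : R -> R) :
  (forall x, f x = g x) -> cont f -> cont g.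
Proof. intros E H x; apply continuous_ext with f; [exact E | apply H]. Qed.

Lemma cont_continuity (f : R -> R) : cont f -> continuity f.
Proof. intros H x; apply continuity_pt_filterlim, H. Qed.

Lemma cont_eps (f : R -> R) (x eps : R) : cont f -> 0 < eps ->
  exists d, 0 < d /\ forall y, Rabs (y - x) < d -> Rabs (f y - f x) < eps.
Proof.
intros Hf Heps; assert (C := Hf x); apply continuity_pt_filterlim in C.
destruct (C eps Heps) as [d [Hd H]]; exists d; split; [exact Hd|]; intros y Hy.
destruct (Req_dec y x) as [-> | Hne]; [rewrite Rminus_diag, Rabs_R0; exact Heps|].
apply H; repeat split; auto.
Qed.

Lemma lipschitz_cont (f : R -> R) (C : R) :
  (forall x y, Rabs (f x - f y) <= C * Rabs (x - y)) -> cont f.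
Proof.
intros H x; apply continuity_pt_filterlim; intros eps Heps; assert (P := Rabs_pos C).
exists (eps / (Rabs C + 1)); split; [apply Rdiv_lt_0_compat; lra|].
intros y [_ Hy]; change (Rabs (y - x) < eps / (Rabs C + 1)) in Hy; change (Rabs (f y - f x) < eps).
assert (E : Rabs (y - x) * (Rabs C + 1) < eps / (Rabs C + 1) * (Rabs C + 1))
  by (apply Rmult_lt_compat_r; lra).
replace (eps / (Rabs C + 1) * (Rabs C + 1)) with eps in E by (field; lra).
generalize (H y x) (Rabs_pos (y - x)) (Rle_abs C); nra.
Qed.

Create HintDb continuity.
#[export] Hint Resolve cont_cos cont_sin
  cont_RInt : continuity.
#[export] Hint Extern 1 (cont exp) => exact continuous_exp : continuity.

Ltac solve_continuity :=
  cbv beta;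
  first
  [ assumption
  | solve [eauto 3 with continuity]
  | lazymatch goal with
    | |- cont (fun x => x) => apply cont_id
    | |- cont (fun _ => ?c) => apply cont_const
    | |- cont (fun x => @?f x + @?g x) =>
        apply (cont_plus f g); solve_continuity
    | |- cont (fun x => @?f x - @?g x) =>
        apply (cont_minus f g); solve_continuity
    | |- cont (fun x => - @?f x) =>
        apply (cont_opp f); solve_continuity
    | |- cont (fun x => @?f x * @?g x) =>
        apply (cont_mult f g); solve_continuity
    | |- cont (fun x => @?f x / ?c) =>
        apply (cont_mult f (fun _ => / c)); solve_continuity
    | |- cont (fun x => @?f x ^ ?n) =>
        apply (cont_pow f n); solve_continuity
    | |- cont (fun x => sum_n (fun j => @?f j x) ?n) =>
        apply (cont_sum_n f n); intro; solve_continuity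
    | |- cont (fun x => ?h (@?g x)) =>
        apply (cont_comp g h); solve_continuity
    end ].

Lemma periodic_shift_nat (g : R -> R) (hg : periodic_2PI g) (n : nat) (x : R) :
  g (x + 2 * PI * INR n) = g x.
Proof.
revert x; induction n; intros x.
- simpl; f_equal; ring.
- rewrite S_INR; replace (x + 2 * PI * (INR n + 1)) with ((x + 2 * PI * INR n) + 2 * PI) by ring.
  rewrite hg; apply IHn.
Qed.

Lemma periodic_shift_Z (g : R -> R) (hg : periodic_2PI g) (k : Z) (x : R) :
  g (x + 2 * PI * IZR k) = g x.
Proof.
destruct (Z_le_gt_dec 0 k) as [H | H].
- rewrite <- (Z2Nat.id k H), <- INR_IZR_INZ; apply periodic_shift_nat, hg.
- rewrite <- (periodic_shift_nat g hg (Z.to_nat (- k)) (x + 2 * PI * IZR k)).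
  f_equal; rewrite INR_IZR_INZ, Z2Nat.id, opp_IZR by lia; ring.
Qed.

Lemma periodic_representative (x : R) : exists k : Z, 0 <= x + 2 * PI * IZR k < 2 * PI.
Proof.
assert (P := PI_RGT_0).
exists (1 - up (x / (2 * PI)))%Z; rewrite minus_IZR.
destruct (archimed (x / (2 * PI))) as [A B].
assert (E : x = x / (2 * PI) * (2 * PI)) by (field; lra).
set (y := x / (2 * PI)) in *; rewrite E; split; nra.
Qed.

Lemma periodic_bounded (g : R -> R) :
  cont g -> periodic_2PI g ->
  exists M, 0 <= M /\ forall x, Rabs (g x) <= M.
Proof.
intros Hc Hp; assert (P := PI_RGT_0).
destruct (continuity_ab_maj (fun x => Rabs (g x)) 0 (2 * PI)) as [m [Hm _]]; [lra| |].
- intros c _; apply continuity_pt_filterlim.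
  apply (continuous_comp g Rabs); [apply Hc | apply continuous_Rabs].
- exists (Rabs (g m)); split; [apply Rabs_pos|].
  intros x; destruct (periodic_representative x) as [k Hk].
  rewrite <- (periodic_shift_Z g Hp k x); apply Hm; lra.
Qed.

(** * Global solutions by Picard iteration *)

Definition is_solution (v F : R -> R) (X : R -> R) : Prop :=
  forall t, is_derive X t (v (X t) + F t).

Fixpoint picard (v F : R -> R) (s : R) (n : nat) : R -> R :=
  match n with
  | O => fun t => s + RInt F 0 t
  | S m => fun t => s + RInt F 0 t + RInt (fun r => v (picard v F s m r)) 0 t
  end.

Definition solution (v F : R -> R) (s t : R) : R :=
  real (Lim_seq (fun n => picard v F s n t)).

Lemma Series_nonneg (a : nat -> R) :
  (forall n, 0 <= a n) -> ex_series a -> 0 <= Series a.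
Proof.
intros Ha H.
apply (is_lim_seq_le (fun _ => 0) (sum_n a) 0 (Series a)).
- intros n; induction n; [rewrite sum_O; apply Ha|].
  rewrite sum_Sn; generalize (Ha (S n)); unfold plus; simpl; lra.
- apply is_lim_seq_const.
- exact (Series_correct a H).
Qed.

Section Picard.

Variables (v F : R -> R) (L V : R) (s : R).
Hypothesis v_cont : cont v.
Hypothesis F_cont : cont F.
Hypothesis v_lip : forall x y, Rabs (v x - v y) <= L * Rabs (x - y).
Hypothesis v_bound : forall x, Rabs (v x) <= V.
Hypothesis L_pos : 0 <= L.

Let P := picard v F s.

Lemma picard_derive (n : nat) (t : R) :
  is_derive (P n) t (match n with O => F t | S m => F t + v (P m t) end).
Proof.
revert t; induction n; intros t; unfold P; simpl.
-
  replace (F t) with (0 + F t) by ring.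
  apply @is_derive_plus; [apply @is_derive_const | apply is_derive_RInt_upper, F_cont].
- replace (F t + v (picard v F s n t)) with (0 + F t + v (picard v F s n t)) by ring.
  apply @is_derive_plus.
  + apply @is_derive_plus; [apply @is_derive_const | apply is_derive_RInt_upper, F_cont].
  + apply (is_derive_RInt_upper (fun r => v (picard v F s n r))).
    apply (cont_comp (picard v F s n) v); [|exact v_cont].
    apply (derive_cont _ _ IHn).
Qed.

Lemma picard_0 (n : nat) : P n 0 = s.
Proof.
destruct n; unfold P; simpl; rewrite ?RInt_point; unfold zero; simpl; ring.
Qed.

Let B (n : nat) (t : R) : R := V * t * ((L * t) ^ n / INR (fact n)).

Lemma picard_step_bound_aux (sg : R) (n : nat) (t : R) :
  sg = 1 \/ sg = -1 -> 0 <= t -> Rabs (P (S n) (sg * t) - P n (sg * t)) <= B n t.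
Proof.
intros Hsg Ht.
assert (Hs1 : Rabs sg = 1) by (destruct Hsg; subst; [apply Rabs_R1 | rewrite Rabs_left; lra]).
assert (V_pos : 0 <= V) by (generalize (v_bound 0) (Rabs_pos (v 0)); lra).
assert (HD : forall m u, is_derive (fun r => P m (sg * r)) u
    (sg * (match m with O => F (sg * u) | S k => F (sg * u) + v (P k (sg * u)) end))).
{ intros m u; apply (is_derive_comp (P m) (fun r => sg * r)); [apply picard_derive|].
  auto_derive; [trivial | ring]. }
revert t Ht; induction n; intros t Ht.
- apply (derive_dominated (fun r => P 1 (sg * r) - P 0 (sg * r))
    (fun u => sg * (F (sg * u) + v (P 0%nat (sg * u))) - sg * F (sg * u))
    (B 0) (fun _ => V) t); [| | | |lra].
  + intros u _; apply @is_derive_minus; [apply (HD 1%nat) | apply (HD 0%nat)].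
  + intros u _; unfold B; simpl; auto_derive; [trivial | field].
  + intros u _. replace (_ - _) with (sg * v (P 0%nat (sg * u))) by ring.
    rewrite Rabs_mult, Hs1, Rmult_1_l; apply v_bound.
  + rewrite Rmult_0_r, !picard_0, Rminus_diag, Rabs_R0; unfold B; right; ring.
- apply (derive_dominated (fun r => P (S (S n)) (sg * r) - P (S n) (sg * r))
    (fun u => sg * (F (sg * u) + v (P (S n) (sg * u))) - sg * (F (sg * u) + v (P n (sg * u))))
    (B (S n)) (fun u => (INR n + 2) / (INR n + 1) * (L * B n u)) t); [| | | |lra].
  + intros u _; apply @is_derive_minus; [apply (HD (S (S n))) | apply (HD (S n))].
  + intros u _; unfold B.
    auto_derive; [trivial|].
    change (fact n + n * fact n)%nat with (S n * fact n)%nat.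
    change (match n with 0%nat => 1 | S _ => INR n + 1 end) with (INR (S n)).
    rewrite mult_INR, S_INR.
    assert (INR (fact n) <> 0) by apply INR_fact_neq_0.
    assert (INR n + 1 <> 0) by (generalize (pos_INR n); lra).
    field; auto.
  + intros u [Hu _].
    replace (_ - _) with (sg * (v (P (S n) (sg * u)) - v (P n (sg * u)))) by ring.
    rewrite Rabs_mult, Hs1, Rmult_1_l.
    apply Rle_trans with (L * B n u).
    * apply Rle_trans with (1 := v_lip _ _).
      apply Rmult_le_compat_l; [exact L_pos | apply IHn, Hu].
    * assert (0 <= B n u).
      { unfold B; apply Rmult_le_pos; [apply Rmult_le_pos; assumption|].
        apply Rdiv_le_0_compat; [apply pow_le, Rmult_le_pos; assumption | apply INR_fact_lt_0]. }
      assert (0 <= L * B n u) by (apply Rmult_le_pos; assumption).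
      assert (1 <= (INR n + 2) / (INR n + 1)).
      { assert (0 < INR n + 1) by (generalize (pos_INR n); lra).
        apply Rmult_le_reg_r with (INR n + 1); [assumption|].
        unfold Rdiv; rewrite Rmult_assoc, Rinv_l; lra. }
      nra.
  + rewrite Rmult_0_r, !picard_0, Rminus_diag, Rabs_R0; unfold B; right; ring.
Qed.

Lemma picard_step_bound (n : nat) (t : R) : Rabs (P (S n) t - P n t) <= B n (Rabs t).
Proof.
destruct (Rle_dec 0 t) as [H | H].
- rewrite (Rabs_pos_eq t H); replace t with (1 * t) at 1 2 by ring.
  apply picard_step_bound_aux; auto.
- rewrite (Rabs_left t) by lra; replace t with (-1 * - t) at 1 2 by ring.
  apply picard_step_bound_aux; [auto | lra].
Qed.

Lemma picard_uniform_cauchy (T : R) : 0 <= T ->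
  exists e : nat -> R, is_lim_seq e 0 /\
    forall n m t, Rabs t <= T -> (n <= m)%nat -> Rabs (P m t - P n t) <= e n.
Proof.
intros HT.
assert (V_pos : 0 <= V) by (generalize (v_bound 0) (Rabs_pos (v 0)); lra).
assert (Bpos : forall n, 0 <= B n T).
{ intros n; unfold B; apply Rmult_le_pos; [apply Rmult_le_pos; assumption|].
  apply Rdiv_le_0_compat; [apply pow_le, Rmult_le_pos; assumption | apply INR_fact_lt_0]. }
assert (HS : ex_series (fun n => B n T)).
{ exists (V * T * exp (L * T)); unfold B.
  apply (is_series_scal (V * T) (fun n => (L * T) ^ n / INR (fact n))).
  generalize (is_exp_Reals (L * T)); rewrite is_pseries_R; apply is_series_ext.
  intros n; apply Rmult_comm. }
exists (fun n => Series (fun k => B (n + k)%nat T)); split.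
- apply is_lim_seq_ext with (fun n => Series (fun k => B k T) -
    match n with O => 0 | S m => sum_n (fun k => B k T) m end).
  + intros [|n]; [rewrite Rminus_0_r; apply Series_ext; reflexivity|].
    rewrite (Series_incr_n (fun k => B k T) (S n)) by (lia || exact HS).
    simpl pred; rewrite <- sum_n_Reals; ring_simplify.
    apply Series_ext; reflexivity.
  + apply is_lim_seq_incr_1.
    replace (Finite 0) with (Finite (Series (fun k => B k T) - Series (fun k => B k T))) by (f_equal; ring).
    apply is_lim_seq_minus'; [apply is_lim_seq_const|].
    exact (Series_correct _ HS).
- intros n m t Ht Hnm.
  assert (HSn : forall k, ex_series (fun j => B (k + j)%nat T)).
  { intros k; apply (ex_series_incr_n (fun j => B j T) k), HS. }
  assert (Hstep : forall k, Series (fun j => B (k + j)%nat T) = B k T + Series (fun j => B (S k + j)%nat T)).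
  { intros k; rewrite Series_incr_1 by apply HSn; rewrite Nat.add_0_r; f_equal.
    apply Series_ext; intros j; f_equal; lia. }
  assert (Hpos : forall k, 0 <= Series (fun j => B (k + j)%nat T)).
  { intros k; apply Series_nonneg; [intros; apply Bpos | apply HSn]. }
  assert (Hd : forall d, Rabs (P (d + n) t - P n t) <=
      Series (fun k => B (n + k)%nat T) - Series (fun k => B (d + n + k)%nat T)).
  { induction d.
    - simpl plus; rewrite !Rminus_diag, Rabs_R0; lra.
    - replace (P (S d + n) t - P n t) with
        ((P (S (d + n)) t - P (d + n)%nat t) + (P (d + n)%nat t - P n t)) by (simpl; ring).
      apply Rle_trans with (1 := Rabs_triang _ _).
      assert (A := picard_step_bound (d + n) t).
      assert (A' : B (d + n) (Rabs t) <= B (d + n) T).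
      { unfold B; assert (Hp := Rabs_pos t).
        apply Rmult_le_compat.
        - apply Rmult_le_pos; assumption.
        - apply Rdiv_le_0_compat; [apply pow_le, Rmult_le_pos; assumption | apply INR_fact_lt_0].
        - apply Rmult_le_compat_l; assumption.
        - apply Rmult_le_compat_r; [left; apply Rinv_0_lt_compat, INR_fact_lt_0|].
          apply pow_incr; split; [apply Rmult_le_pos; assumption|].
          apply Rmult_le_compat_l; assumption. }
      rewrite (Hstep (d + n)%nat) in IHd; change (S d + n)%nat with (S (d + n)); lra. }
  replace m with ((m - n) + n)%nat by lia.
  apply Rle_trans with (1 := Hd (m - n)%nat).
  generalize (Hpos (m - n + n)%nat); cbv beta; lra.
Qed.

Lemma solution_is_lim (t : R) : is_lim_seq (fun n => P n t) (solution v F s t).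
Proof.
unfold solution; fold P; apply Lim_seq_correct'.
apply ex_lim_seq_cauchy_corr.
destruct (picard_uniform_cauchy (Rabs t) (Rabs_pos t)) as [e [He Hb]].
intros eps; apply is_lim_seq_spec in He; destruct (He (pos_div_2 eps)) as [N HN].
exists N; intros n m Hn Hm.
assert (A := HN N (Nat.le_refl N)); rewrite Rminus_0_r in A; simpl in A.
assert (An := Hb N n t (Rle_refl _) Hn); assert (Am := Hb N m t (Rle_refl _) Hm).
apply Rabs_def2 in A.
replace (P n t - P m t) with ((P n t - P N t) - (P m t - P N t)) by ring.
apply Rle_lt_trans with (1 := Rabs_triang _ _); rewrite Rabs_Ropp; cbv beta in *; lra.
Qed.

Lemma solution_uniform (T : R) : 0 <= T ->
  exists e : nat -> R, is_lim_seq e 0 /\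
    forall n t, Rabs t <= T -> Rabs (solution v F s t - P n t) <= e n.
Proof.
intros HT; destruct (picard_uniform_cauchy T HT) as [e [He Hb]].
exists e; split; [exact He|]; intros n t Ht.
assert (A : is_lim_seq (fun m => Rabs (P (m + n) t - P n t)) (Rabs (solution v F s t - P n t))).
{ apply (is_lim_seq_abs _ (Finite (solution v F s t - P n t))).
  apply is_lim_seq_minus'; [|apply is_lim_seq_const].
  apply (is_lim_seq_incr_n (fun m => P m t) n), solution_is_lim. }
assert (C := is_lim_seq_le _ (fun _ => e n) _ (e n) (fun m => Hb n (m + n)%nat t Ht ltac:(lia)) A (is_lim_seq_const _)).
exact C.
Qed.

Lemma solution_0 : solution v F s 0 = s.
Proof.
assert (A := solution_is_lim 0); apply is_lim_seq_unique in A.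
assert (C : is_lim_seq (fun n => P n 0) s).
{ apply is_lim_seq_ext with (fun _ => s); [intros; now rewrite picard_0 | apply is_lim_seq_const]. }
apply is_lim_seq_unique in C; rewrite C in A; now injection A.
Qed.

Lemma solution_minus_drift_lipschitz (t r : R) :
  Rabs ((solution v F s t - RInt F 0 t) - (solution v F s r - RInt F 0 r)) <= V * Rabs (t - r).
Proof.
assert (V_pos : 0 <= V) by (generalize (v_bound 0) (Rabs_pos (v 0)); lra).
set (l := (solution v F s t - RInt F 0 t) - (solution v F s r - RInt F 0 r)).
assert (A : is_lim_seq (fun n => Rabs ((P n t - RInt F 0 t) - (P n r - RInt F 0 r))) (Rabs l)).
{ apply (is_lim_seq_abs _ (Finite l)); unfold l.
  repeat apply is_lim_seq_minus'; first [apply is_lim_seq_const | apply solution_is_lim]. }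
assert (Hn : forall n, Rabs ((P n t - RInt F 0 t) - (P n r - RInt F 0 r)) <= V * Rabs (t - r)).
{ intros n.
  apply (bounded_derive_lipschitz (fun x => P n x - RInt F 0 x)
    (fun x => match n with O => F x | S m => F x + v (P m x) end - F x)).
  - intros x; apply @is_derive_minus; [apply picard_derive | apply is_derive_RInt_upper, F_cont].
  - intros x; destruct n as [|m].
    + rewrite Rminus_diag, Rabs_R0; exact V_pos.
    + replace (F x + v (P m x) - F x) with (v (P m x)) by ring; apply v_bound. }
exact (is_lim_seq_le _ (fun _ => V * Rabs (t - r)) _ (V * Rabs (t - r)) Hn A (is_lim_seq_const _)).
Qed.

Lemma solution_continuous : cont (solution v F s).
Proof.
apply cont_ext with
  (fun t => (solution v F s t - RInt F 0 t) + RInt F 0 t); [intros; ring|].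
apply (cont_plus (fun t => solution v F s t - RInt F 0 t) (fun t => RInt F 0 t));
  [|apply cont_RInt, F_cont].
apply lipschitz_cont with V; intros x t; apply solution_minus_drift_lipschitz.
Qed.

Lemma solution_integral (t : R) :
  solution v F s t = s + RInt F 0 t + RInt (fun r => v (solution v F s r)) 0 t.
Proof.
set (X := solution v F s).
assert (Hc : cont (fun r => v (X r))).
{ apply (cont_comp X v); [apply solution_continuous | exact v_cont]. }
set (Q := fun t => s + RInt F 0 t + RInt (fun r => v (X r)) 0 t).
assert (HQ : forall x, is_derive Q x (F x + v (X x))).
{ intros x; unfold Q.
  replace (F x + v (X x)) with (0 + F x + v (X x)) by ring.
  apply @is_derive_plus; [|apply (is_derive_RInt_upper (fun r => v (X r))), Hc].
  apply @is_derive_plus; [apply @is_derive_const | apply is_derive_RInt_upper, F_cont]. }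
assert (Q0 : Q 0 = s).
{ unfold Q; rewrite !RInt_point; unfold zero; simpl; ring. }
destruct (solution_uniform (Rabs t) (Rabs_pos t)) as [e [He Hb]].
assert (Hn : forall n, Rabs (P (S n) t - Q t) <= L * e n * Rabs t).
{ intros n.
  destruct (mean_value (fun x => P (S n) x - Q x)
    (fun x => (F x + v (P n x)) - (F x + v (X x))) 0 t) as [c [Hct E]].
  { intros x _; apply @is_derive_minus; [apply (picard_derive (S n)) | apply HQ]. }
  rewrite picard_0, Q0 in E.
  replace (P (S n) t - Q t) with (P (S n) t - Q t - (s - s)) by ring; rewrite E.
  rewrite Rminus_0_r, Rabs_mult; apply Rmult_le_compat_r; [apply Rabs_pos|].
  replace (F c + v (P n c) - (F c + v (X c))) with (- (v (X c) - v (P n c))) by ring.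
  rewrite Rabs_Ropp; apply Rle_trans with (1 := v_lip _ _).
  apply Rmult_le_compat_l; [exact L_pos|]; apply Hb.
  unfold Rmin, Rmax in Hct; destruct (Rle_dec 0 t).
  - rewrite !Rabs_pos_eq; lra.
  - rewrite !Rabs_left1; lra. }
change (X t = Q t).
assert (A : is_lim_seq (fun n => Rabs (P (S n) t - Q t)) (Rabs (X t - Q t))).
{ apply (is_lim_seq_abs _ (Finite (X t - Q t))).
  apply is_lim_seq_minus'; [|apply is_lim_seq_const].
  apply (is_lim_seq_incr_1 (fun m => P m t)), solution_is_lim. }
assert (C : is_lim_seq (fun n => L * e n * Rabs t) (L * 0 * Rabs t)).
{ apply is_lim_seq_mult'; [|apply is_lim_seq_const].
  apply is_lim_seq_mult'; [apply is_lim_seq_const | exact He]. }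
assert (D := is_lim_seq_le _ _ _ _ Hn A C); simpl in D.
assert (X t - Q t = 0).
{ destruct (Req_dec (X t - Q t) 0) as [H|H]; [exact H|].
  generalize (Rabs_pos_lt _ H); lra. }
lra.
Qed.

Lemma solution_is_solution : is_solution v F (solution v F s).
Proof.
intros t.
apply is_derive_ext with
  (fun t => s + RInt F 0 t + RInt (fun r => v (solution v F s r)) 0 t).
- intros x; symmetry; apply solution_integral.
- replace (v (solution v F s t) + F t) with (0 + F t + v (solution v F s t)) by ring.
  apply @is_derive_plus.
  + apply @is_derive_plus; [apply @is_derive_const | apply is_derive_RInt_upper, F_cont].
  + apply (is_derive_RInt_upper (fun r => v (solution v F s r))).
    apply (cont_comp (solution v F s) v); [apply solution_continuous | exact v_cont].
Qed.

End Picard.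

(** * Comparison of solutions *)

Lemma is_derive_of_quadratic_bound (f : R -> R) (x l C d : R) :
  0 < d -> 0 <= C ->
  (forall y, Rabs (y - x) < d -> Rabs (f y - f x - l * (y - x)) <= C * (y - x) ^ 2) ->
  is_derive f x l.
Proof.
intros Hd HC H; apply is_derive_Reals; intros eps Heps.
assert (Hp : 0 < Rmin d (eps / (C + 1))).
{ apply Rmin_pos; [exact Hd | apply Rdiv_lt_0_compat; lra]. }
exists (mkposreal _ Hp); intros h Hh0 Hh; simpl in Hh.
assert (H1 : Rabs h < d) by (apply Rlt_le_trans with (1 := Hh), Rmin_l).
assert (H2 : Rabs h < eps / (C + 1)) by (apply Rlt_le_trans with (1 := Hh), Rmin_r).
assert (A := H (x + h) ltac:(replace (x + h - x) with h by ring; exact H1)).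
replace (x + h - x) with h in A by ring.
assert (Hha : 0 < Rabs h) by now apply Rabs_pos_lt.
replace ((f (x + h) - f x) / h - l) with ((f (x + h) - f x - l * h) / h) by (field; exact Hh0).
unfold Rdiv; rewrite Rabs_mult, Rabs_inv.
apply Rmult_lt_reg_r with (Rabs h); [exact Hha|].
rewrite Rmult_assoc, Rinv_l, Rmult_1_r by lra.
apply Rle_lt_trans with (1 := A); rewrite <- pow2_abs.
assert (Rabs h * (C + 1) < eps).
{ replace eps with (eps / (C + 1) * (C + 1)) by (field; lra).
  apply Rmult_lt_compat_r; lra. }
simpl; nra.
Qed.

Lemma is_derive_sqr_negative_part (z : R) :
  is_derive (fun y => Rmin y 0 ^ 2) z (2 * Rmin z 0).
Proof.
apply is_derive_of_quadratic_bound with 1 1; try lra.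
intros y _; apply Rabs_le_between; unfold Rmin.
destruct (Rle_dec y 0) as [Hy | Hy]; destruct (Rle_dec z 0) as [Hz | Hz];
  assert (Hsq := pow2_ge_0 (y - z)); split; simpl in *;
  try assert (0 <= y * (z - y)) by nra; try assert (0 <= - z * y) by nra; nra.
Qed.

Section Comparison.

Variables (v : R -> R) (L : R).
Hypothesis v_lip : forall x y, Rabs (v x - v y) <= L * Rabs (x - y).

Lemma solutions_ordered (F G X Y : R -> R) (T : R) :
  is_solution v F X -> is_solution v G Y ->
  (forall t, 0 <= t <= T -> F t <= G t) -> X 0 <= Y 0 ->
  forall t, 0 <= t <= T -> X t <= Y t.
Proof.
intros HX HY HFG H0 t Ht.
set (N := fun r => Rmin (Y r - X r) 0 ^ 2 * exp (- (2 * L * r))).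
assert (HN : forall r, is_derive N r
   ((2 * Rmin (Y r - X r) 0 * ((v (Y r) + G r) - (v (X r) + F r))
     - 2 * L * Rmin (Y r - X r) 0 ^ 2) * exp (- (2 * L * r)))).
{ intros r; unfold N.
  replace ((2 * Rmin (Y r - X r) 0 * ((v (Y r) + G r) - (v (X r) + F r))
     - 2 * L * Rmin (Y r - X r) 0 ^ 2) * exp (- (2 * L * r))) with
   ((((v (Y r) + G r) - (v (X r) + F r)) * (2 * Rmin (Y r - X r) 0)) * exp (- (2 * L * r)) +
     Rmin (Y r - X r) 0 ^ 2 * (- (2 * L) * exp (- (2 * L * r)))) by ring.
  apply (is_derive_mult (fun r => Rmin (Y r - X r) 0 ^ 2) (fun r => exp (- (2 * L * r)))).
  - apply (is_derive_comp (fun y => Rmin y 0 ^ 2) (fun r => Y r - X r)).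
    + apply is_derive_sqr_negative_part.
    + apply @is_derive_minus; [apply HY | apply HX].
  - auto_derive; [trivial | ring].
  - intros; apply Rmult_comm. }
assert (A : - N 0 <= - N t).
{ apply (derive_nonneg_le (fun r => - N r) (fun r => - ((2 * Rmin (Y r - X r) 0 * ((v (Y r) + G r) - (v (X r) + F r))
     - 2 * L * Rmin (Y r - X r) 0 ^ 2) * exp (- (2 * L * r))))); [| |lra].
  - intros r _; apply @is_derive_opp, HN.
  - intros r Hr.
    assert (E := exp_pos (- (2 * L * r))).
    assert (B := v_lip (Y r) (X r)).
    assert (C := HFG r ltac:(lra)).
    assert (2 * Rmin (Y r - X r) 0 * (v (Y r) + G r - (v (X r) + F r)) -
       2 * L * Rmin (Y r - X r) 0 ^ 2 <= 0); [|nra].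
    unfold Rmin; destruct (Rle_dec (Y r - X r) 0).
    + rewrite (Rabs_left1 (Y r - X r)) in B by lra.
      apply Rabs_le_between in B; simpl.
      assert (0 <= v (Y r) + G r - (v (X r) + F r) - L * (Y r - X r)) by lra.
      nra.
    + simpl; lra. }
assert (N0 : N 0 = 0) by (unfold N; rewrite Rmin_right by lra; ring).
assert (Nt : Rmin (Y t - X t) 0 ^ 2 <= 0).
{ assert (E := exp_pos (- (2 * L * t))).
  assert (N t <= 0) by lra; unfold N in H.
  apply Rnot_lt_le; intros Hc; nra. }
unfold Rmin in Nt; destruct (Rle_dec (Y t - X t) 0); [|lra].
simpl in Nt; nra.
Qed.

Lemma solutions_gap_derive (F G X Y : R -> R) (t : R) :
  is_solution v F X -> is_solution v G Y ->
  is_derive (fun r => (Y r - X r) * exp (L * r)) t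
    (((v (Y t) + G t) - (v (X t) + F t) + L * (Y t - X t)) * exp (L * t)).
Proof.
intros HX HY.
replace (((v (Y t) + G t) - (v (X t) + F t) + L * (Y t - X t)) * exp (L * t)) with
  (((v (Y t) + G t) - (v (X t) + F t)) * exp (L * t) + (Y t - X t) * (L * exp (L * t))) by ring.
apply (is_derive_mult (fun r => Y r - X r) (fun r => exp (L * r))).
- apply @is_derive_minus; [apply HY | apply HX].
- auto_derive; [trivial | ring].
- intros; apply Rmult_comm.
Qed.

Lemma solutions_strictly_ordered_forcing (F G X Y : R -> R) (T : R) :
  is_solution v F X -> is_solution v G Y ->
  (forall t, 0 <= t <= T -> F t < G t) -> X 0 <= Y 0 -> 0 < T -> X T < Y T.
Proof.
intros HX HY HFG H0 HT.
assert (Hord := solutions_ordered F G X Y T HX HY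
  (fun t Ht => Rlt_le _ _ (HFG t Ht)) H0).
assert (A : (Y 0 - X 0) * exp (L * 0) < (Y T - X T) * exp (L * T)).
{ apply (derive_pos_lt (fun r => (Y r - X r) * exp (L * r)) _ 0 T
    (fun r _ => solutions_gap_derive F G X Y r HX HY)); [|exact HT].
  intros r Hr; apply Rmult_lt_0_compat; [|apply exp_pos].
  assert (B := v_lip (Y r) (X r)); assert (C := HFG r Hr); assert (D := Hord r Hr).
  rewrite (Rabs_pos_eq (Y r - X r)) in B by lra.
  apply Rabs_le_between in B; lra. }
rewrite Rmult_0_r, exp_0 in A.
generalize (exp_pos (L * T)); nra.
Qed.

Lemma solutions_strictly_ordered_start (F X Y : R -> R) (T : R) :
  is_solution v F X -> is_solution v F Y -> X 0 < Y 0 -> 0 <= T -> X T < Y T.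
Proof.
intros HX HY H0 HT.
assert (Hord := solutions_ordered F F X Y T HX HY (fun t _ => Rle_refl _) (Rlt_le _ _ H0)).
assert (A : (Y 0 - X 0) * exp (L * 0) <= (Y T - X T) * exp (L * T)).
{ apply (derive_nonneg_le (fun r => (Y r - X r) * exp (L * r)) _ 0 T
    (fun r _ => solutions_gap_derive F F X Y r HX HY)); [|exact HT].
  intros r Hr; apply Rmult_le_pos; [|left; apply exp_pos].
  assert (B := v_lip (Y r) (X r)); assert (D := Hord r Hr).
  rewrite (Rabs_pos_eq (Y r - X r)) in B by lra.
  apply Rabs_le_between in B; lra. }
rewrite Rmult_0_r, exp_0 in A.
generalize (exp_pos (L * T)); nra.
Qed.

Lemma gronwall (F G X Y : R -> R) (T eta : R) :
  is_solution v F X -> is_solution v G Y -> 0 <= eta ->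
  (forall t, 0 <= t <= T -> Rabs (F t - G t) <= eta) ->
  forall t, 0 <= t <= T ->
  Rabs (X t - Y t) <= (1 + T) * exp ((2 * L + 1) * T) * (Rabs (X 0 - Y 0) + eta).
Proof.
intros HX HY Heta HFG t Ht.
assert (L_pos : 0 <= L).
{ generalize (v_lip 1 0) (Rabs_pos (v 1 - v 0)).
  rewrite Rminus_0_r, Rabs_R1; lra. }
set (K := 2 * L + 1).
set (N := fun r => (X r - Y r) ^ 2 * exp (- (K * r)) - eta ^ 2 * r).
assert (HN : forall r, is_derive N r
   ((2 * (X r - Y r) * ((v (X r) + F r) - (v (Y r) + G r)) - K * (X r - Y r) ^ 2)
      * exp (- (K * r)) - eta ^ 2)).
{ intros r; unfold N.
  apply @is_derive_minus; [|auto_derive; [trivial | ring]].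
  replace ((2 * (X r - Y r) * ((v (X r) + F r) - (v (Y r) + G r)) - K * (X r - Y r) ^ 2)
      * exp (- (K * r))) with
   ((((v (X r) + F r) - (v (Y r) + G r)) * (2 * (X r - Y r))) * exp (- (K * r)) +
     (X r - Y r) ^ 2 * (- K * exp (- (K * r)))) by ring.
  apply (is_derive_mult (fun r => (X r - Y r) ^ 2) (fun r => exp (- (K * r)))).
  - apply (is_derive_comp (fun y => y ^ 2) (fun r => X r - Y r)).
    + auto_derive; [trivial | ring].
    + apply @is_derive_minus; [apply HX | apply HY].
  - auto_derive; [trivial | ring].
  - intros; apply Rmult_comm. }
assert (A : - N 0 <= - N t).
{ apply (derive_nonneg_le (fun r => - N r) (fun r => - ((2 * (X r - Y r) * ((v (X r) + F r) - (v (Y r) + G r)) - K * (X r - Y r) ^ 2)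
      * exp (- (K * r)) - eta ^ 2))); [| |lra].
  - intros r _; apply @is_derive_opp, HN.
  - intros r Hr.
    assert (E := exp_pos (- (K * r))).
    assert (E1 : exp (- (K * r)) <= 1).
    { rewrite <- exp_0; (destruct (Req_dec (- (K * r)) 0) as [->|];
        [lra | left; apply exp_increasing; unfold K in *; nra]). }
    assert (B := v_lip (X r) (Y r)).
    assert (C := HFG r ltac:(lra)).
    set (z := X r - Y r) in *.
    assert (Q : 2 * z * (v (X r) + F r - (v (Y r) + G r)) - K * z ^ 2 <= eta ^ 2).
    { apply Rle_trans with (2 * Rabs z * (L * Rabs z + eta) - K * Rabs z ^ 2).
      - rewrite pow2_abs; apply Rplus_le_compat_r.
        apply Rle_trans with (1 := Rle_abs _).
        rewrite !Rabs_mult, (Rabs_pos_eq 2) by lra.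
        apply Rmult_le_compat_l; [generalize (Rabs_pos z); lra|].
        replace (v (X r) + F r - (v (Y r) + G r)) with ((v (X r) - v (Y r)) + (F r - G r)) by ring.
        apply Rle_trans with (1 := Rabs_triang _ _); lra.
      - unfold K; assert (0 <= (Rabs z - eta) ^ 2) by apply pow2_ge_0; simpl in *; nra. }
    assert (0 <= eta ^ 2) by apply pow2_ge_0.
    nra. }
assert (E1 : 0 < exp (K * t)) by apply exp_pos.
assert (E2 : exp (K * t) * exp (- (K * t)) = 1) by (rewrite <- exp_plus, <- exp_0; f_equal; ring).
assert (E3 : exp (K * t) <= exp (K * T)).
{ destruct (Req_dec (K * t) (K * T)) as [->|]; [lra | left; apply exp_increasing; unfold K in *; nra]. }
assert (E4 : 1 <= exp (K * T)).
{ rewrite <- exp_0; destruct (Req_dec 0 (K * T)) as [<-|]; [lra | left; apply exp_increasing; unfold K in *; nra]. }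
unfold N in A; rewrite !Rmult_0_r, Ropp_0, exp_0 in A.
assert (D : (X t - Y t) ^ 2 <= ((X 0 - Y 0) ^ 2 + eta ^ 2 * T) * exp (K * T)).
{ replace ((X t - Y t) ^ 2) with (((X t - Y t) ^ 2 * exp (- (K * t))) * exp (K * t))
    by (rewrite Rmult_assoc, (Rmult_comm (exp (- _))), E2; ring).
  assert (0 <= eta ^ 2) by apply pow2_ge_0.
  assert (0 <= (X 0 - Y 0) ^ 2) by apply pow2_ge_0.
  apply Rle_trans with (((X 0 - Y 0) ^ 2 + eta ^ 2 * T) * exp (K * t)).
  - apply Rmult_le_compat_r; nra.
  - apply Rmult_le_compat_l; nra. }
rewrite <- pow2_abs, <- (pow2_abs (X 0 - Y 0)) in D.
set (a := Rabs (X t - Y t)) in *; set (b := Rabs (X 0 - Y 0)) in *.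
assert (Ha : 0 <= a) by apply Rabs_pos; assert (Hb : 0 <= b) by apply Rabs_pos.
set (E := exp (K * T)) in *.
assert (HT : 0 <= T) by lra.
apply Rsqr_incr_0_var; [|apply Rmult_le_pos; [apply Rmult_le_pos|]; lra].
unfold Rsqr; replace (a * a) with (a ^ 2) by ring.
apply Rle_trans with (1 := D).
replace ((1 + T) * E * (b + eta) * ((1 + T) * E * (b + eta))) with
  (((1 + T) * (b + eta)) ^ 2 * E * E) by ring.
assert (b ^ 2 + eta ^ 2 * T <= ((1 + T) * (b + eta)) ^ 2).
{ assert (0 <= b * eta) by (apply Rmult_le_pos; assumption).
  assert (b ^ 2 <= (b + eta) ^ 2) by nra.
  assert (eta ^ 2 <= (b + eta) ^ 2) by nra.
  rewrite Rpow_mult_distr.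
  assert (0 <= (b + eta) ^ 2) by apply pow2_ge_0.
  assert (eta ^ 2 * T <= (b + eta) ^ 2 * T) by (apply Rmult_le_compat_r; assumption).
  assert (0 <= T * (b + eta) ^ 2) by (apply Rmult_le_pos; assumption).
  assert (0 <= T * (T * (b + eta) ^ 2)) by (apply Rmult_le_pos; assumption).
  replace ((1 + T) ^ 2 * (b + eta) ^ 2) with ((b + eta) ^ 2 + 2 * (T * (b + eta) ^ 2) + T * (T * (b + eta) ^ 2)) by ring.
  lra. }
assert (0 <= ((1 + T) * (b + eta)) ^ 2) by apply pow2_ge_0.
apply Rle_trans with (((1 + T) * (b + eta)) ^ 2 * E).
- apply Rmult_le_compat_r; lra.
- rewrite <- (Rmult_1_r (((1 + T) * (b + eta)) ^ 2 * E)) at 1.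
  apply Rmult_le_compat_l; [apply Rmult_le_pos; lra | lra].
Qed.

Lemma solution_unique_forward (F X Y : R -> R) :
  is_solution v F X -> is_solution v F Y -> X 0 = Y 0 -> forall t, 0 <= t -> X t = Y t.
Proof.
intros HX HY H0 t Ht.
apply Rle_antisym.
- apply (solutions_ordered F F X Y t HX HY); [intros; lra | lra | lra].
- apply (solutions_ordered F F Y X t HY HX); [intros; lra | lra | lra].
Qed.

End Comparison.

Lemma is_solution_shift (v F X : R -> R) (t0 : R) :
  is_solution v F X -> is_solution v (fun t => F (t0 + t)) (fun t => X (t0 + t)).
Proof.
intros H t.
replace (v (X (t0 + t)) + F (t0 + t)) with (1 * (v (X (t0 + t)) + F (t0 + t))) by ring.
apply (is_derive_comp X (fun t => t0 + t)); [apply H | auto_derive; [trivial | ring]].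
Qed.

Lemma is_solution_translate (v F X : R -> R) (k : Z) :
  periodic_2PI v -> is_solution v F X -> is_solution v F (fun t => X t + 2 * PI * IZR k).
Proof.
intros Hv H t; rewrite (periodic_shift_Z v Hv k).
replace (v (X t) + F t) with (v (X t) + F t + 0) by ring.
apply @is_derive_plus; [apply H | apply @is_derive_const].
Qed.

Lemma is_solution_reverse (v F X : R -> R) :
  is_solution v F X -> is_solution (fun x => - v x) (fun t => - F (- t)) (fun t => X (- t)).
Proof.
intros H t.
replace (- v (X (- t)) + - F (- t)) with (-1 * (v (X (- t)) + F (- t))) by ring.
apply (is_derive_comp X (fun t => - t)); [apply H | auto_derive; [trivial | ring]].
Qed.

Lemma is_solution_unique (v F X Y : R -> R) (L t0 : R) :
  (forall x y, Rabs (v x - v y) <= L * Rabs (x - y)) ->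
  is_solution v F X -> is_solution v F Y -> X t0 = Y t0 -> forall t, X t = Y t.
Proof.
intros Hv HX HY H0 t.
assert (HX' := is_solution_shift v F X t0 HX).
assert (HY' := is_solution_shift v F Y t0 HY).
destruct (Rle_dec t0 t) as [H | H].
- replace t with (t0 + (t - t0)) by ring.
  apply (solution_unique_forward v L Hv _ _ _ HX' HY'); [|lra].
  rewrite Rplus_0_r; exact H0.
- replace t with (t0 + - (t0 - t)) by ring.
  refine (solution_unique_forward (fun x => - v x) L _ _ _ _
    (is_solution_reverse v _ _ HX') (is_solution_reverse v _ _ HY') _ (t0 - t) _); [| |lra].
  + intros x y; replace (- v x - - v y) with (- (v x - v y)) by ring.
    rewrite Rabs_Ropp; apply Hv.
  + rewrite Ropp_0, Rplus_0_r; exact H0.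
Qed.

(** * Powers of [(1 + cos t) / 2] *)

Definition bump (N : nat) (t : R) : R := ((1 + cos t) / 2) ^ N.

Lemma bump_range (N : nat) (t : R) : 0 <= bump N t <= 1.
Proof.
unfold bump; generalize (COS_bound t); intros H; split; [apply pow_le; lra|].
apply Rle_trans with (1 ^ N); [apply pow_incr; lra | rewrite pow1; lra].
Qed.

Lemma bump_0 (N : nat) : bump N 0 = 1.
Proof. unfold bump; rewrite cos_0; replace ((1 + 1) / 2) with 1 by field; apply pow1. Qed.

Lemma bump_periodic (N : nat) : periodic_2PI (bump N).
Proof. intros t; unfold bump; rewrite cos_plus, cos_2PI, sin_2PI; do 3 f_equal; ring. Qed.

Lemma bump_continuous (N : nat) (t0 : R) : cont (fun t => bump N (t - t0)).
Proof.
unfold bump; solve_continuity.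
Qed.

#[export] Hint Resolve bump_continuous : continuity.

Lemma cos_le_away (d t : R) : 0 < d -> d <= Rabs t <= 2 * PI - d -> cos t <= cos d.
Proof.
intros Hd Ht.
assert (E : cos t = cos (Rabs t)).
{ unfold Rabs; destruct (Rcase_abs t); [now rewrite cos_neg | reflexivity]. }
rewrite E; destruct (Rle_dec (Rabs t) PI).
- apply cos_decr_1; lra.
- replace (cos (Rabs t)) with (cos (2 * PI - Rabs t)).
  + apply cos_decr_1; lra.
  + rewrite cos_minus, cos_2PI, sin_2PI; ring.
Qed.

Lemma cos_ge_near (d t : R) : d <= PI -> Rabs t <= d -> cos d <= cos t.
Proof.
intros Hd Ht.
assert (E : cos t = cos (Rabs t)).
{ unfold Rabs; destruct (Rcase_abs t); [now rewrite cos_neg | reflexivity]. }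
rewrite E; generalize (Rabs_pos t); intros; apply cos_decr_1; lra.
Qed.

Lemma cos_lt_1 (d : R) : 0 < d < 2 * PI -> cos d < 1.
Proof.
intros Hd; rewrite <- cos_0; destruct (Rle_dec d PI).
- apply cos_decreasing_1; lra.
- replace (cos d) with (cos (2 * PI - d)).
  + apply cos_decreasing_1; lra.
  + rewrite cos_minus, cos_2PI, sin_2PI; ring.
Qed.

Lemma bump_le_pow (N : nat) (d t : R) : 0 < d -> d <= Rabs t <= 2 * PI - d ->
  bump N t <= ((1 + cos d) / 2) ^ N.
Proof.
intros Hd Ht; unfold bump; apply pow_incr.
generalize (COS_bound t) (cos_le_away d t Hd Ht); lra.
Qed.

Lemma bump_ge_pow (N : nat) (d t : R) : d <= PI -> Rabs t <= d ->
  ((1 + cos d) / 2) ^ N <= bump N t.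
Proof.
intros Hd Ht; unfold bump; apply pow_incr.
generalize (COS_bound d) (cos_ge_near d t Hd Ht); lra.
Qed.

Lemma RInt_ge_const (f : R -> R) (a b c : R) : a <= b -> cont f ->
  (forall t, a < t < b -> c <= f t) -> (b - a) * c <= RInt f a b.
Proof.
intros Hab Hf H.
replace ((b - a) * c) with (RInt (fun _ : R => c) a b).
- apply RInt_le; try assumption; apply ex_RInt_cont;
    [apply cont_const | exact Hf].
- apply (RInt_const (V := R_CompleteNormedModule)).
Qed.

Lemma RInt_le_const (f : R -> R) (a b c : R) : a <= b -> cont f ->
  (forall t, a < t < b -> f t <= c) -> RInt f a b <= (b - a) * c.
Proof.
intros Hab Hf H.
replace ((b - a) * c) with (RInt (fun _ : R => c) a b).
- apply RInt_le; try assumption; apply ex_RInt_cont;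
    [exact Hf | apply cont_const].
- apply (RInt_const (V := R_CompleteNormedModule)).
Qed.

Lemma RInt_split3 (f : R -> R) (a b c d : R) : cont f ->
  RInt f a d = RInt f a b + RInt f b c + RInt f c d.
Proof.
intros Hf.
assert (E := fun x y => ex_RInt_cont f x y Hf).
transitivity (plus (plus (RInt f a b) (RInt f b c)) (RInt f c d)); [|reflexivity].
rewrite !RInt_Chasles by apply E; reflexivity.
Qed.

Lemma pow_ratio_small (a b x y : R) : 0 <= a -> a < b -> 0 < x ->
  exists N : nat, y * a ^ N < x * b ^ N.
Proof.
intros Ha Hab Hx.
assert (Hq : Rabs (a / b) < 1).
{ rewrite Rabs_pos_eq by (apply Rdiv_le_0_compat; lra).
  apply Rmult_lt_reg_r with b; [lra|]; unfold Rdiv; rewrite Rmult_assoc, Rinv_l; lra. }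
destruct (pow_lt_1_zero (a / b) Hq (x / (Rabs y + 1))) as [N HN].
{ apply Rdiv_lt_0_compat; [exact Hx | generalize (Rabs_pos y); lra]. }
exists N; specialize (HN N (Nat.le_refl N)).
assert (Hb : 0 < b ^ N) by (apply pow_lt; lra).
assert (E : a ^ N = (a / b) ^ N * b ^ N) by (rewrite <- Rpow_mult_distr; f_equal; field; lra).
assert (Hy := Rabs_pos y).
assert (HN' : Rabs ((a / b) ^ N) * (Rabs y + 1) < x).
{ replace x with (x / (Rabs y + 1) * (Rabs y + 1)) by (field; lra).
  apply Rmult_lt_compat_r; lra. }
rewrite E, <- Rmult_assoc; apply Rmult_lt_compat_r; [exact Hb|].
apply Rle_lt_trans with (Rabs (y * (a / b) ^ N)); [apply Rle_abs|].
rewrite Rabs_mult; generalize (Rabs_pos ((a / b) ^ N)); nra.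
Qed.

Lemma bump_integral_sign (phi : R -> R) (t0 : R) :
  cont phi -> 0 < t0 < 2 * PI -> 0 < phi t0 ->
  exists N, 0 < RInt (fun t => bump N (t - t0) * phi t) 0 (2 * PI).
Proof.
intros Hc Ht0 Hpos; assert (P := PI_RGT_0).
set (m := phi t0 / 2).
assert (Hloc : exists d0, 0 < d0 /\ forall t, Rabs (t - t0) < d0 -> m <= phi t).
{ destruct (cont_eps phi t0 m Hc ltac:(unfold m; lra)) as [d0 [Hd0 H]].
  exists d0; split; [exact Hd0|]; intros t Ht.
  assert (A := H t Ht); apply Rabs_def2 in A; unfold m in *; lra. }
destruct Hloc as [d0 [Hd0 Hm]].
set (d := Rmin (Rmin (d0 / 2) (PI / 2)) (Rmin (t0 / 2) ((2 * PI - t0) / 2))).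
assert (Hd : 0 < d) by (repeat apply Rmin_pos; lra).
assert (d <= Rmin (d0 / 2) (PI / 2)) by apply Rmin_l.
assert (d <= Rmin (t0 / 2) ((2 * PI - t0) / 2)) by apply Rmin_r.
assert (Rmin (d0 / 2) (PI / 2) <= d0 / 2) by apply Rmin_l.
assert (Rmin (d0 / 2) (PI / 2) <= PI / 2) by apply Rmin_r.
assert (Rmin (t0 / 2) ((2 * PI - t0) / 2) <= t0 / 2) by apply Rmin_l.
assert (Rmin (t0 / 2) ((2 * PI - t0) / 2) <= (2 * PI - t0) / 2) by apply Rmin_r.
destruct (continuity_ab_maj (fun x => Rabs (phi x)) 0 (2 * PI)) as [xM [HM _]]; [lra| |].
{ intros c _; apply continuity_pt_filterlim.
  apply (continuous_comp phi Rabs); [apply Hc | apply continuous_Rabs]. }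
set (K := Rabs (phi xM)) in *.
assert (HK : 0 <= K) by apply Rabs_pos.
set (a := (1 + cos d) / 2); set (b := (1 + cos (d / 2)) / 2).
assert (Ha : 0 <= a) by (unfold a; generalize (COS_bound d); lra).
assert (Hab : a < b).
{ unfold a, b; assert (cos d < cos (d / 2)) by (apply cos_decreasing_1; lra); lra. }
destruct (pow_ratio_small a b (d * m) (2 * PI * K) Ha Hab) as [N HN].
{ apply Rmult_lt_0_compat; [exact Hd | unfold m; lra]. }
exists N.
set (g := fun t => bump N (t - t0) * phi t).
assert (Hg : cont g) by (unfold g; solve_continuity).
rewrite (RInt_split3 g 0 (t0 - d / 2) (t0 + d / 2) (2 * PI) Hg).
assert (Hout : forall t, 0 <= t <= 2 * PI -> d / 2 <= Rabs (t - t0) -> - (K * a ^ N) <= g t).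
{ intros t Ht Htd; unfold g.
  assert (Hb := bump_range N (t - t0)).
  assert (HaN : 0 <= a ^ N) by (apply pow_le, Ha).
  destruct (Rlt_dec (Rabs (t - t0)) d).
  - assert (0 <= phi t) by (apply Rle_trans with m; [unfold m; lra | apply Hm; lra]).
    assert (0 <= bump N (t - t0) * phi t) by (apply Rmult_le_pos; lra).
    assert (0 <= K * a ^ N) by (apply Rmult_le_pos; assumption); lra.
  - assert (B : bump N (t - t0) <= a ^ N).
    { apply bump_le_pow; [exact Hd|]; split; [lra|].
      unfold Rabs; destruct (Rcase_abs (t - t0)); lra. }
    assert (HKt : Rabs (phi t) <= K) by (apply HM; lra).
    assert (A : Rabs (bump N (t - t0) * phi t) <= a ^ N * K).
    { rewrite Rabs_mult, (Rabs_pos_eq (bump _ _)) by lra.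
      apply Rmult_le_compat; try assumption; [lra | apply Rabs_pos]. }
    apply Rabs_le_between in A; lra. }
assert (Hin : forall t, Rabs (t - t0) <= d / 2 -> m * b ^ N <= g t).
{ intros t Ht; unfold g; rewrite Rmult_comm.
  apply Rmult_le_compat; [| unfold m; lra | | apply Hm; lra].
  - apply pow_le; lra.
  - apply bump_ge_pow; lra. }
assert (I1 : (t0 - d / 2 - 0) * (- (K * a ^ N)) <= RInt g 0 (t0 - d / 2)).
{ apply RInt_ge_const; [lra | exact Hg|]; intros t Ht; apply Hout; [lra|].
  rewrite Rabs_left1; lra. }
assert (I2 : (t0 + d / 2 - (t0 - d / 2)) * (m * b ^ N) <= RInt g (t0 - d / 2) (t0 + d / 2)).
{ apply RInt_ge_const; [lra | exact Hg|]; intros t Ht; apply Hin.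
  apply Rabs_le_between; lra. }
assert (I3 : (2 * PI - (t0 + d / 2)) * (- (K * a ^ N)) <= RInt g (t0 + d / 2) (2 * PI)).
{ apply RInt_ge_const; [lra | exact Hg|]; intros t Ht; apply Hout; [lra|].
  rewrite Rabs_pos_eq; lra. }
assert (0 <= K * a ^ N) by (apply Rmult_le_pos; [exact HK | apply pow_le, Ha]).
nra.
Qed.

Lemma bump_orthogonal_zero (phi : R -> R) (t0 : R) :
  cont phi -> 0 < t0 < 2 * PI ->
  (forall N, RInt (fun t => bump N (t - t0) * phi t) 0 (2 * PI) = 0) -> phi t0 = 0.
Proof.
intros Hc Ht0 H.
destruct (Rtotal_order (phi t0) 0) as [Hs | [Hs | Hs]]; [|exact Hs|].
- destruct (bump_integral_sign (fun t => - phi t) t0) as [N HN]; [|exact Ht0|lra|].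
  + apply (cont_opp phi), Hc.
  + assert (E : RInt (fun t => bump N (t - t0) * - phi t) 0 (2 * PI) =
       - RInt (fun t => bump N (t - t0) * phi t) 0 (2 * PI)).
    { transitivity (RInt (fun t => opp (bump N (t - t0) * phi t)) 0 (2 * PI)).
      - apply RInt_ext; intros; unfold opp; simpl; ring.
      - apply (RInt_opp (V := R_CompleteNormedModule)), ex_RInt_cont.
        solve_continuity. }
    rewrite H in E; lra.
- destruct (bump_integral_sign phi t0 Hc Ht0 Hs) as [N HN]; rewrite H in HN; lra.
Qed.

Lemma pow_lim_0 (a : R) : 0 <= a < 1 -> is_lim_seq (fun N => a ^ N) 0.
Proof. intros H; apply is_lim_seq_geom; rewrite Rabs_pos_eq; lra. Qed.

Lemma bump_integral_vanishes (t0 : R) : 0 < t0 < 2 * PI ->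
  is_lim_seq (fun N => RInt (fun t => bump N (t - t0)) 0 (2 * PI)) 0.
Proof.
intros Ht0; assert (P := PI_RGT_0).
apply is_lim_seq_spec; intros eps.
set (d := Rmin (Rmin (eps / 8) (PI / 2)) (Rmin (t0 / 2) ((2 * PI - t0) / 2))).
assert (He := cond_pos eps).
assert (Hd : 0 < d) by (repeat apply Rmin_pos; lra).
assert (d <= Rmin (eps / 8) (PI / 2)) by apply Rmin_l.
assert (d <= Rmin (t0 / 2) ((2 * PI - t0) / 2)) by apply Rmin_r.
assert (Rmin (eps / 8) (PI / 2) <= eps / 8) by apply Rmin_l.
assert (Rmin (eps / 8) (PI / 2) <= PI / 2) by apply Rmin_r.
assert (Rmin (t0 / 2) ((2 * PI - t0) / 2) <= t0 / 2) by apply Rmin_l.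
assert (Rmin (t0 / 2) ((2 * PI - t0) / 2) <= (2 * PI - t0) / 2) by apply Rmin_r.
set (a := (1 + cos d) / 2).
assert (Ha : 0 <= a < 1).
{ unfold a; generalize (COS_bound d) (cos_lt_1 d ltac:(lra)); lra. }
assert (Hlim := pow_lim_0 a Ha); apply is_lim_seq_spec in Hlim.
assert (He' : 0 < eps / (8 * PI)) by (apply Rdiv_lt_0_compat; lra).
destruct (Hlim (mkposreal _ He')) as [N0 HN0].
exists N0; intros N HN; specialize (HN0 N HN); simpl in HN0.
assert (HaN : 0 <= a ^ N) by (apply pow_le; lra).
rewrite Rminus_0_r, Rabs_pos_eq in HN0 by exact HaN.
set (g := fun t => bump N (t - t0)).
assert (Hg : cont g) by apply bump_continuous.
rewrite Rminus_0_r, Rabs_pos_eq.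
2:{ generalize (RInt_ge_const g 0 (2 * PI) 0 ltac:(lra) Hg
      (fun t _ => proj1 (bump_range N (t - t0)))); lra. }
fold g; rewrite (RInt_split3 g 0 (t0 - d) (t0 + d) (2 * PI) Hg).
assert (I1 : RInt g 0 (t0 - d) <= (t0 - d - 0) * a ^ N).
{ apply RInt_le_const; [lra | exact Hg|]; intros t Ht; apply bump_le_pow; [exact Hd|].
  rewrite Rabs_left1; lra. }
assert (I2 : RInt g (t0 - d) (t0 + d) <= (t0 + d - (t0 - d)) * 1).
{ apply RInt_le_const; [lra | exact Hg|]; intros t Ht; apply bump_range. }
assert (I3 : RInt g (t0 + d) (2 * PI) <= (2 * PI - (t0 + d)) * a ^ N).
{ apply RInt_le_const; [lra | exact Hg|]; intros t Ht; apply bump_le_pow; [exact Hd|].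
  rewrite Rabs_pos_eq; lra. }
assert (E : 2 * PI * a ^ N < eps / 4).
{ replace (eps / 4) with (2 * PI * (eps / (8 * PI))) by (field; lra).
  apply Rmult_lt_compat_l; lra. }
nra.
Qed.

Lemma bump_vanishes (t : R) : cos t <> 1 -> is_lim_seq (fun N => bump N t) 0.
Proof.
intros H; apply pow_lim_0; generalize (COS_bound t); intros [H1 H2].
destruct H2 as [H2 | H2]; [lra | contradiction].
Qed.

Inductive cos_span : (R -> R) -> Prop :=
| cos_span_cos (j : nat) : cos_span (fun t => cos (INR j * t))
| cos_span_plus (f g : R -> R) : cos_span f -> cos_span g -> cos_span (fun t => f t + g t)
| cos_span_scal (c : R) (f : R -> R) : cos_span f -> cos_span (fun t => c * f t).

Lemma cos_span_mult_cos (f : R -> R) : cos_span f -> cos_span (fun t => cos t * f t).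
Proof.
induction 1 as [j | f g _ IHf _ IHg | c f _ IHf].
- destruct j as [|j].
  + replace (fun t => cos t * cos (INR 0 * t)) with (fun t => cos (INR 1 * t)); [apply cos_span_cos|].
    apply functional_extensionality; intros t; simpl; rewrite Rmult_0_l, Rmult_1_l, cos_0; ring.
  + replace (fun t => cos t * cos (INR (S j) * t)) with
      (fun t => / 2 * (cos (INR (S (S j)) * t) + cos (INR j * t))).
    * apply cos_span_scal with (f := fun t => cos (INR (S (S j)) * t) + cos (INR j * t)).
      apply cos_span_plus; apply cos_span_cos.
    * apply functional_extensionality; intros t; rewrite !S_INR.
      replace ((INR j + 1 + 1) * t) with ((INR j + 1) * t + t) by ring.
      replace (INR j * t) with ((INR j + 1) * t - t) by ring.
      rewrite cos_plus, cos_minus; field.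
- replace (fun t => cos t * (f t + g t)) with (fun t => cos t * f t + cos t * g t);
    [now apply cos_span_plus | apply functional_extensionality; intros; ring].
- replace (fun t => cos t * (c * f t)) with (fun t => c * (cos t * f t));
    [now apply cos_span_scal with (f := fun t => cos t * f t) | apply functional_extensionality; intros; ring].
Qed.

Lemma bump_cos_span (N : nat) : cos_span (bump N).
Proof.
induction N.
- replace (bump 0) with (fun t => cos (INR 0 * t)); [apply cos_span_cos|].
  apply functional_extensionality; intros t; unfold bump; simpl; rewrite Rmult_0_l; apply cos_0.
- replace (bump (S N)) with (fun t => / 2 * (bump N t + cos t * bump N t)).
  + apply cos_span_scal with (f := fun t => bump N t + cos t * bump N t).
    apply cos_span_plus; [exact IHN | now apply cos_span_mult_cos].
  + apply functional_extensionality; intros t; unfold bump; simpl; field.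
Qed.

(** * Real analytic functions *)

(* Coquelicot equates elements of carriers such as [R_NormedModule], which [ring] does not
   identify with [R]. *)
Ltac ring_over_R := match goal with |- @eq _ ?a ?b => change (@eq R a b) end; ring.
Ltac field_over_R := match goal with |- @eq _ ?a ?b => change (@eq R a b) end; field.

Lemma pseries_radius_pos (a : nat -> R) (x0 : R) (g : R -> R) :
  locally x0 (fun x => is_pseries a (x - x0) (g x)) -> Rbar_lt 0 (CV_radius a).
Proof.
intros [d Hd].
assert (Hp := cond_pos d).
assert (A : is_pseries a (d / 2) (g (x0 + d / 2))).
{ replace (d / 2) with (x0 + d / 2 - x0) at 1 by ring; apply Hd.
  unfold ball; simpl; unfold AbsRing_ball, abs, minus, plus, opp; simpl.
  replace (x0 + d / 2 + - x0) with (d / 2) by ring; rewrite Rabs_pos_eq; lra. }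
destruct (Rbar_lt_le_dec 0 (CV_radius a)) as [H | H]; [exact H|].
exfalso; apply (CV_disk_outside a (d / 2)).
- apply Rbar_le_lt_trans with (1 := H); simpl; rewrite Rabs_pos_eq; lra.
- apply is_pseries_R in A.
  apply (ex_series_lim_0 (fun n => a n * (d / 2) ^ n)); eexists; exact A.
Qed.

Lemma real_analytic_local (g : R -> R) (x0 : R) : real_analytic g ->
  exists a d, 0 < d /\ Rbar_lt d (CV_radius a) /\
    forall x, Rabs (x - x0) < d -> g x = PSeries a (x - x0).
Proof.
intros H; destruct (H x0) as [a Ha].
assert (Hr := pseries_radius_pos a x0 g Ha); destruct Ha as [d Hd].
assert (Hp := cond_pos d).
destruct (CV_radius a) as [r | |] eqn:E; simpl in Hr.
- exists a, (Rmin d (r / 2)); rewrite E; split; [apply Rmin_pos; lra|]; split.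
  + simpl; generalize (Rmin_r d (r / 2)); lra.
  + intros x Hx; symmetry; apply is_pseries_unique, Hd.
    generalize (Rmin_l d (r / 2)); unfold ball; simpl; unfold AbsRing_ball, abs, minus, plus, opp; simpl.
    replace (x + - x0) with (x - x0) by ring; lra.
- exists a, d; rewrite E; split; [exact Hp|]; split; [exact I|].
  intros x Hx; symmetry; apply is_pseries_unique, Hd; exact Hx.
- contradiction.
Qed.

Lemma locally_abs (x0 d : R) (P : R -> Prop) : 0 < d ->
  (forall x, Rabs (x - x0) < d -> P x) -> locally x0 P.
Proof. intros Hd H; exists (mkposreal d Hd); intros x Hx; apply H; exact Hx. Qed.

Lemma real_analytic_derive_pseries (g : R -> R) (a : nat -> R) (x0 d : R) :
  0 < d -> Rbar_lt d (CV_radius a) ->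
  (forall x, Rabs (x - x0) < d -> g x = PSeries a (x - x0)) ->
  forall x, Rabs (x - x0) < d -> is_derive g x (PSeries (PS_derive a) (x - x0)).
Proof.
intros Hd Hr Hg x Hx.
apply is_derive_ext_loc with (fun x => PSeries a (x - x0)).
- apply locally_abs with (d - Rabs (x - x0)); [lra|].
  intros y Hy; symmetry; apply Hg.
  replace (y - x0) with ((y - x) + (x - x0)) by ring.
  apply Rle_lt_trans with (1 := Rabs_triang _ _); lra.
- replace (PSeries (PS_derive a) (x - x0)) with (1 * PSeries (PS_derive a) (x - x0)) by ring.
  apply (is_derive_comp (PSeries a) (fun x => x - x0)).
  + apply is_derive_PSeries, Rbar_lt_trans with (2 := Hr); exact Hx.
  + auto_derive; [trivial | ring].
Qed.

Lemma real_analytic_is_derive (g : R -> R) : real_analytic g ->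
  forall x, is_derive g x (Derive g x).
Proof.
intros H x; destruct (real_analytic_local g x H) as [a [d [Hd [Hr Hg]]]].
apply Derive_correct; eexists.
apply (real_analytic_derive_pseries g a x d Hd Hr Hg); rewrite Rminus_diag, Rabs_R0; exact Hd.
Qed.

Lemma real_analytic_Derive (g : R -> R) : real_analytic g -> real_analytic (Derive g).
Proof.
intros H x0; destruct (real_analytic_local g x0 H) as [a [d [Hd [Hr Hg]]]].
exists (PS_derive a); apply locally_abs with d; [exact Hd|]; intros x Hx.
rewrite (is_derive_unique g x _ (real_analytic_derive_pseries g a x0 d Hd Hr Hg x Hx)).
apply PSeries_correct, ex_pseries_derive, Rbar_lt_trans with (2 := Hr); exact Hx.
Qed.

Lemma real_analytic_continuous (g : R -> R) : real_analytic g -> cont g.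
Proof. intros H; apply derive_cont with (Derive g), real_analytic_is_derive, H. Qed.

#[export] Hint Resolve real_analytic_continuous : continuity.

Lemma real_analytic_plus (f g : R -> R) :
  real_analytic f -> real_analytic g -> real_analytic (fun x => f x + g x).
Proof.
intros Hf Hg x0; destruct (Hf x0) as [a Ha]; destruct (Hg x0) as [b Hb].
exists (PS_plus a b); generalize (filter_and _ _ Ha Hb); apply filter_imp.
intros x [A B]; apply (is_pseries_plus a b); assumption.
Qed.

Lemma real_analytic_scal (c : R) (f : R -> R) :
  real_analytic f -> real_analytic (fun x => c * f x).
Proof.
intros Hf x0; destruct (Hf x0) as [a Ha].
exists (PS_scal c a); revert Ha; apply filter_imp.
intros x A; apply (is_pseries_scal c a); [apply Rmult_comm | exact A].
Qed.

Lemma real_analytic_translate (f : R -> R) (c : R) :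
  real_analytic f -> real_analytic (fun x => f (c + x)).
Proof.
intros Hf x0; destruct (Hf (c + x0)) as [a [d Ha]].
exists a; exists d; intros x Hx; replace (x - x0) with (c + x - (c + x0)) by ring.
apply Ha; unfold ball in *; simpl in *; unfold AbsRing_ball, abs, minus, plus, opp in *; simpl in *.
replace (c + x + - (c + x0)) with (x + - x0) by ring; exact Hx.
Qed.

Lemma real_analytic_zero_near (g : R -> R) (x0 : R) : real_analytic g ->
  (forall n, Derive_n g n x0 = 0) -> exists d, 0 < d /\ forall x, Rabs (x - x0) < d -> g x = 0.
Proof.
intros H H0; destruct (real_analytic_local g x0 H) as [a [d [Hd [Hr Hg]]]].
exists d; split; [exact Hd|]; intros x Hx; rewrite (Hg x Hx).
assert (Ha : forall n, a n = 0).
{ intros n.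
  assert (E : Derive_n g n x0 = Derive_n (PSeries a) n 0).
  { rewrite (Derive_n_ext_loc g (fun x => PSeries a (x + - x0)) n x0).
    - rewrite Derive_n_comp_trans; f_equal; ring.
    - apply locally_abs with d; [exact Hd|]; intros y Hy; apply (Hg y Hy). }
  rewrite H0, Derive_n_coef in E.
  - symmetry in E; apply Rmult_integral in E; destruct E as [E | E]; [exact E|].
    exfalso; apply (INR_fact_neq_0 n); exact E.
  - apply Rbar_lt_trans with (2 := Hr); exact Hd. }
rewrite (PSeries_ext a (fun _ => 0)) by exact Ha; apply PSeries_const_0.
Qed.

Lemma real_analytic_Derive_n (g : R -> R) (n : nat) : real_analytic g -> real_analytic (Derive_n g n).
Proof. intros H; induction n; [exact H | simpl; apply real_analytic_Derive, IHn]. Qed.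

Lemma continuous_zero_left (g : R -> R) (a b : R) : cont g -> a < b ->
  (forall x, a <= x < b -> g x = 0) -> g b = 0.
Proof.
intros Hc Hab H.
destruct (Req_dec (g b) 0) as [E | E]; [exact E | exfalso].
destruct (cont_eps g b (Rabs (g b)) Hc) as [d [Hd Hx]]; [now apply Rabs_pos_lt|].
set (x := Rmax a (b - d / 2)).
assert (a <= x) by apply Rmax_l; assert (b - d / 2 <= x) by apply Rmax_r.
assert (Hxb : x < b) by (unfold x; apply Rmax_lub_lt; lra).
assert (A' : Rabs (g x - g b) < Rabs (g b)) by (apply Hx; rewrite Rabs_left1; lra).
rewrite H in A' by lra; rewrite Rminus_0_l, Rabs_Ropp in A'; lra.
Qed.

Lemma real_analytic_identity (g : R -> R) : real_analytic g ->
  (forall n, Derive_n g n 0 = 0) -> forall x, 0 <= x -> g x = 0.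
Proof.
intros H H0 x Hx.
set (E := fun b => 0 <= b <= x /\ forall c, 0 <= c <= b -> forall n, Derive_n g n c = 0).
assert (E0 : E 0).
{ split; [lra|]; intros c Hc; replace c with 0 by lra; exact H0. }
destruct (completeness E) as [s [Hub Hlub]].
- exists x; intros b [Hb _]; lra.
- exists 0; exact E0.
- assert (Hs0 : 0 <= s) by (apply Hub, E0).
  assert (Hsx : s <= x) by (apply Hlub; intros b [Hb _]; lra).
  assert (Hbelow : forall c, 0 <= c < s -> forall n, Derive_n g n c = 0).
  { intros c Hc n; apply NNPP; intros Hne.
    assert (s <= c); [|lra].
    apply Hlub; intros b [Hb Hbz]; apply Rnot_lt_le; intros Hcb.
    apply Hne, Hbz; lra. }
  assert (Hat : forall n, Derive_n g n s = 0).
  { intros n; destruct (Req_dec s 0) as [-> | Hne]; [apply H0|].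
    apply continuous_zero_left with 0; [|lra|intros; now apply Hbelow].
    apply real_analytic_continuous, real_analytic_Derive_n, H. }
  destruct (real_analytic_zero_near g s H Hat) as [d [Hd Hz]].
  destruct (Req_dec s x) as [<- | Hne].
  { apply Hz; rewrite Rminus_diag, Rabs_R0; exact Hd. }
  exfalso; set (b := Rmin x (s + d / 2)).
  assert (b <= x) by apply Rmin_l; assert (b <= s + d / 2) by apply Rmin_r.
  assert (s < b) by (unfold b; apply Rmin_glb_lt; lra).
  assert (b <= s); [|lra].
  apply Hub; split; [lra|]; intros c Hc n.
  destruct (Rlt_dec c s); [apply Hbelow; lra|].
  rewrite (Derive_n_ext_loc g (fun _ => 0)).
  + destruct n; [reflexivity | apply Derive_n_const].
  + apply locally_abs with (d / 2); [lra|].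
    intros y Hy; apply Hz; apply Rabs_def2 in Hy; apply Rabs_def1; lra.
Qed.

(* The bound [C] plays the role of a norm for which summable series preserve analyticity. *)
Definition unit_analytic (h : R -> R) (C : R) : Prop :=
  forall x0, exists a : nat -> R, (forall m, Rabs (a m) <= C) /\
    forall y, Rabs y < 1 -> is_pseries a y (h (x0 + y)).

Lemma unit_analytic_real_analytic (h : R -> R) (C : R) : unit_analytic h C -> real_analytic h.
Proof.
intros H x0; destruct (H x0) as [a [_ Ha]]; exists a; apply locally_abs with 1; [lra|].
intros x Hx; replace x with (x0 + (x - x0)) at 2 by ring; apply Ha, Hx.
Qed.

Lemma unit_analytic_bound (h : R -> R) (C : R) : unit_analytic h C -> forall x, Rabs (h x) <= C.
Proof.
intros H x; destruct (H x) as [a [Hb Ha]].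
assert (A := Ha 0 ltac:(rewrite Rabs_R0; lra)); rewrite Rplus_0_r in A.
apply is_pseries_unique in A; rewrite PSeries_0 in A; rewrite <- A; apply Hb.
Qed.

Lemma unit_analytic_plus (f g : R -> R) (C D : R) :
  unit_analytic f C -> unit_analytic g D -> unit_analytic (fun x => f x + g x) (C + D).
Proof.
intros Hf Hg x0; destruct (Hf x0) as [a [Ba Ha]]; destruct (Hg x0) as [b [Bb Hb]].
exists (PS_plus a b); split.
- intros m; apply Rle_trans with (1 := Rabs_triang _ _), Rplus_le_compat; [apply Ba | apply Bb].
- intros y Hy; apply (is_pseries_plus a b); auto.
Qed.

Lemma unit_analytic_scal (c : R) (f : R -> R) (C : R) :
  unit_analytic f C -> unit_analytic (fun x => c * f x) (Rabs c * C).
Proof.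
intros Hf x0; destruct (Hf x0) as [a [Ba Ha]].
exists (PS_scal c a); split.
- intros m; unfold PS_scal, scal; simpl; unfold mult; simpl; rewrite Rabs_mult.
  apply Rmult_le_compat_l; [apply Rabs_pos | apply Ba].
- intros y Hy; apply (is_pseries_scal c a); [apply Rmult_comm | auto].
Qed.

Lemma unit_analytic_weaken (f : R -> R) (C D : R) :
  C <= D -> unit_analytic f C -> unit_analytic f D.
Proof.
intros HCD H x0; destruct (H x0) as [a [Ba Ha]]; exists a; split; [|exact Ha].
intros m; apply Rle_trans with (1 := Ba m) (2 := HCD).
Qed.

Lemma unit_analytic_zero : unit_analytic (fun _ => 0) 0.
Proof.
intros x0; exists (fun _ => 0); split; [intros; rewrite Rabs_R0; lra|].
intros y _; rewrite is_pseries_R.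
apply is_series_ext with (fun _ => 0); [intros; symmetry; apply Rmult_0_l|].
apply (filterlim_ext (fun _ => 0)); [|apply filterlim_const].
intros n; induction n; [now rewrite sum_O | rewrite sum_Sn, <- IHn; unfold plus; simpl; ring].
Qed.

Section CosineSeries.

Variable l : R.

Let coef (th : R) (m : nat) : R := l ^ m * cos (th + INR m * (PI / 2)) / INR (fact m).

Fixpoint cos_partial (M : nat) (th y : R) : R :=
  match M with
  | O => 0
  | S k => cos_partial k th y + l ^ k * cos (th + INR k * (PI / 2)) / INR (fact k) * y ^ k
  end.

Lemma cos_partial_derive (M : nat) (th y : R) :
  is_derive (cos_partial (S M) th) y (l * cos_partial M (th + PI / 2) y).
Proof.
induction M.
- simpl; auto_derive; [trivial | ring].
- change (cos_partial (S (S M)) th) with (fun y => cos_partial (S M) th y +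
     l ^ (S M) * cos (th + INR (S M) * (PI / 2)) / INR (fact (S M)) * y ^ (S M)).
  replace (l * cos_partial (S M) (th + PI / 2) y) with
    (l * cos_partial M (th + PI / 2) y +
     l ^ (S M) * cos (th + INR (S M) * (PI / 2)) / INR (fact (S M)) * (INR (S M) * 1 * y ^ M)).
  + apply @is_derive_plus; [exact IHM|].
    apply (is_derive_scal (fun y => y ^ S M)).
    apply (is_derive_pow (fun y => y) (S M) y 1), @is_derive_id.
  + simpl cos_partial; rewrite fact_simpl, mult_INR.
    replace (th + INR (S M) * (PI / 2)) with (th + PI / 2 + INR M * (PI / 2)) by (rewrite S_INR; ring).
    simpl pow; field; split; [apply INR_fact_neq_0 | apply not_0_INR; lia].
Qed.

Lemma cos_partial_remainder (M : nat) (th y : R) : 0 <= y ->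
  Rabs (cos (l * y + th) - cos_partial M th y) <= Rabs l ^ M * y ^ M / INR (fact M).
Proof.
revert th y; induction M; intros th y Hy.
- simpl; unfold Rdiv; rewrite Rminus_0_r, Rinv_1; generalize (COS_bound (l * y + th)); intros B.
  apply Rabs_le_between; lra.
- apply (derive_dominated (fun y => cos (l * y + th) - cos_partial (S M) th y)
    (fun y => l * cos (l * y + (th + PI / 2)) - l * cos_partial M (th + PI / 2) y)
    (fun y => Rabs l ^ S M * y ^ S M / INR (fact (S M)))
    (fun y => Rabs l * (Rabs l ^ M * y ^ M / INR (fact M))) y); [| | | |lra].
  + intros t _; apply @is_derive_minus; [|apply cos_partial_derive].
    replace (l * t + (th + PI / 2)) with (PI / 2 + (l * t + th)) by ring.
    replace (cos (PI / 2 + (l * t + th))) with (- sin (l * t + th))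
      by (rewrite cos_plus, cos_PI2, sin_PI2; ring).
    auto_derive; [trivial | ring].
  + intros t _.
    replace (Rabs l * (Rabs l ^ M * t ^ M / INR (fact M))) with
      (Rabs l ^ S M * / INR (fact (S M)) * (INR (S M) * 1 * t ^ M)).
    * apply is_derive_ext with (fun y => Rabs l ^ S M * / INR (fact (S M)) * y ^ S M);
        [intros x; unfold Rdiv; ring_over_R|].
      apply (is_derive_scal (fun y => y ^ S M)).
      apply (is_derive_pow (fun y => y) (S M) t 1), @is_derive_id.
    * rewrite fact_simpl, mult_INR; simpl pow; field.
      split; [apply INR_fact_neq_0 | apply not_0_INR; lia].
  + intros t Ht; rewrite <- Rmult_minus_distr_l, Rabs_mult.
    apply Rmult_le_compat_l; [apply Rabs_pos | apply IHM; lra].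
  + assert (E : forall k, cos_partial (S k) th 0 = cos th).
    { induction k; [simpl; rewrite Rmult_0_l, Rplus_0_r; field|].
      change (cos_partial (S (S k)) th 0) with (cos_partial (S k) th 0 +
        l ^ (S k) * cos (th + INR (S k) * (PI / 2)) / INR (fact (S k)) * 0 ^ (S k)).
      rewrite IHk, pow_i by lia; ring. }
    rewrite E, Rmult_0_r, Rplus_0_l, Rminus_diag, Rabs_R0, (pow_i (S M)) by lia; right; unfold Rdiv; ring.
Qed.

Lemma cos_partial_sum_n (M : nat) (th y : R) :
  cos_partial (S M) th y = sum_n (fun m => coef th m * y ^ m) M.
Proof.
induction M; [rewrite sum_O; unfold coef; simpl; ring|].
rewrite sum_Sn, <- IHM; reflexivity.
Qed.

Lemma exp_term_lim_0 (z : R) : is_lim_seq (fun M => z ^ M / INR (fact M)) 0.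
Proof.
apply (ex_series_lim_0 (fun M => z ^ M / INR (fact M))); exists (exp z).
generalize (is_exp_Reals z); rewrite is_pseries_R; apply is_series_ext.
intros n; apply Rmult_comm.
Qed.

Lemma cos_is_pseries_pos (th y : R) : 0 <= y -> is_pseries (coef th) y (cos (l * y + th)).
Proof.
intros Hy; rewrite is_pseries_R.
change (is_lim_seq (sum_n (fun m => coef th m * y ^ m)) (cos (l * y + th))).
apply is_lim_seq_ext with (fun M => cos_partial (S M) th y); [intros; apply cos_partial_sum_n|].
apply (is_lim_seq_incr_1 (fun M => cos_partial M th y)).
apply is_lim_seq_ext with (fun M => cos (l * y + th) - (cos (l * y + th) - cos_partial M th y));
  [intros; ring|].
replace (Finite (cos (l * y + th))) with (Finite (cos (l * y + th) - 0)) by (f_equal; ring).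
apply is_lim_seq_minus'; [apply is_lim_seq_const|].
apply is_lim_seq_abs_0, (is_lim_seq_le_le (fun _ => 0) _ (fun M => (Rabs l * y) ^ M / INR (fact M))).
- intros M; split; [apply Rabs_pos|]; rewrite Rpow_mult_distr; apply cos_partial_remainder, Hy.
- apply is_lim_seq_const.
- apply exp_term_lim_0.
Qed.

End CosineSeries.

Lemma exp_ge_term (m : nat) (t : R) : 0 <= t -> t ^ m / INR (fact m) <= exp t.
Proof.
revert t; induction m; intros t Ht.
- simpl; unfold Rdiv; rewrite Rinv_1; generalize (exp_ineq1_le t); lra.
- assert (A : exp 0 - 0 ^ S m / INR (fact (S m)) <= exp t - t ^ S m / INR (fact (S m))).
  { apply (derive_nonneg_le (fun t => exp t - t ^ S m / INR (fact (S m)))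
      (fun t => exp t - t ^ m / INR (fact m))); [| |exact Ht].
    - intros x _; apply @is_derive_minus; [apply is_derive_exp|].
      replace (x ^ m / INR (fact m)) with (/ INR (fact (S m)) * (INR (S m) * 1 * x ^ m)).
      + apply is_derive_ext with (fun y => / INR (fact (S m)) * y ^ S m);
          [intros y; unfold Rdiv; ring_over_R|].
        apply (is_derive_scal (fun y => y ^ S m)).
        apply (is_derive_pow (fun y => y) (S m) x 1), @is_derive_id.
      + rewrite fact_simpl, mult_INR; field.
        split; [apply INR_fact_neq_0 | apply not_0_INR; lia].
    - intros x Hx; generalize (IHm x ltac:(lra)); lra. }
  rewrite exp_0, pow_i in A by lia; unfold Rdiv in A; rewrite Rmult_0_l in A; unfold Rdiv; lra.
Qed.

Lemma unit_analytic_cos (l th : R) : unit_analytic (fun x => cos (l * x + th)) (exp (Rabs l)).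
Proof.
intros x0.
exists (fun m => l ^ m * cos (l * x0 + th + INR m * (PI / 2)) / INR (fact m)); split.
- intros m; apply Rle_trans with (2 := exp_ge_term m (Rabs l) (Rabs_pos l)).
  unfold Rdiv; rewrite !Rabs_mult, <- RPow_abs, (Rabs_pos_eq (/ _))
    by (left; apply Rinv_0_lt_compat, INR_fact_lt_0).
  apply Rmult_le_compat_r; [left; apply Rinv_0_lt_compat, INR_fact_lt_0|].
  rewrite <- (Rmult_1_r (Rabs l ^ m)) at 2; apply Rmult_le_compat_l; [apply pow_le, Rabs_pos|].
  apply Rabs_le_between, COS_bound.
- intros y _; destruct (Rle_dec 0 y) as [Hy | Hy].
  + replace (l * (x0 + y) + th) with (l * y + (l * x0 + th)) by ring.
    apply (cos_is_pseries_pos l (l * x0 + th) y Hy).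
  + replace (l * (x0 + y) + th) with (- l * - y + (l * x0 + th)) by ring.
    assert (A := cos_is_pseries_pos (- l) (l * x0 + th) (- y) ltac:(lra)).
    rewrite is_pseries_R in A |- *; revert A; apply is_series_ext; intros m.
    replace ((- l) ^ m * cos (l * x0 + th + INR m * (PI / 2)) / INR (fact m) * (- y) ^ m) with
      (((- l) ^ m * (- y) ^ m) * (cos (l * x0 + th + INR m * (PI / 2)) / INR (fact m))) by (unfold Rdiv; ring).
    rewrite <- Rpow_mult_distr; replace (- l * - y) with (l * y) by ring.
    rewrite Rpow_mult_distr; unfold Rdiv; simpl; ring.
Qed.

Lemma ex_series_dominated (a b : nat -> R) :
  (forall n, Rabs (a n) <= b n) -> ex_series b -> ex_series a.
Proof. exact (@ex_series_le R_AbsRing R_CompleteNormedModule a b). Qed.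

Lemma pseries_remainder (a : nat -> R) (C y s : R) (M : nat) :
  (forall m, Rabs (a m) <= C) -> Rabs y < 1 -> is_pseries a y s ->
  Rabs (s - sum_n (fun m => a m * y ^ m) M) <= C * (Rabs y ^ S M / (1 - Rabs y)).
Proof.
intros Ha Hy Hs; rewrite is_pseries_R in Hs.
assert (HC : 0 <= C) by (generalize (Ha 0%nat) (Rabs_pos (a 0%nat)); lra).
assert (Hg : ex_series (fun k => Rabs y ^ k)) by (apply ex_series_geom; rewrite Rabs_Rabsolu; exact Hy).
assert (Hb : ex_series (fun k => C * Rabs y ^ S M * Rabs y ^ k))
  by (apply (ex_series_scal_l (K := R_AbsRing) (C * Rabs y ^ S M) (fun k => Rabs y ^ k)), Hg).
assert (Hle : forall k, Rabs (a (S M + k)%nat * y ^ (S M + k)) <= C * Rabs y ^ S M * Rabs y ^ k).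
{ intros k; rewrite Rabs_mult, <- RPow_abs, pow_add, <- Rmult_assoc.
  apply Rmult_le_compat_r; [apply pow_le, Rabs_pos|].
  apply Rmult_le_compat_r; [apply pow_le, Rabs_pos | apply Ha]. }
assert (Hex : ex_series (fun k => Rabs (a (S M + k)%nat * y ^ (S M + k)))).
{ apply ex_series_dominated with (2 := Hb); intros k.
  rewrite Rabs_Rabsolu; apply Hle. }
assert (E : s - sum_n (fun m => a m * y ^ m) M = Series (fun k => a (S M + k)%nat * y ^ (S M + k))).
{ rewrite <- (is_series_unique _ _ Hs).
  rewrite (Series_incr_n (fun m => a m * y ^ m) (S M)) by (lia || (eexists; exact Hs)).
  simpl pred; rewrite sum_n_Reals.
  ring. }
rewrite E; apply Rle_trans with (1 := Series_Rabs _ Hex).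
apply Rle_trans with (Series (fun k => C * Rabs y ^ S M * Rabs y ^ k)).
- apply Series_le; [|exact Hb]; intros k; split; [apply Rabs_pos | apply Hle].
- rewrite Series_scal_l, Series_geom by (rewrite Rabs_Rabsolu; exact Hy).
  right; unfold Rdiv; ring.
Qed.

Lemma unit_analytic_Series (h : nat -> R -> R) (C : nat -> R) :
  (forall k, unit_analytic (h k) (C k)) -> ex_series C ->
  unit_analytic (fun x => Series (fun k => h k x)) (Series C).
Proof.
intros Hh HC x0.
assert (HC0 : forall k, 0 <= C k).
{ intros k; generalize (unit_analytic_bound _ _ (Hh k) 0) (Rabs_pos (h k 0)); lra. }
destruct (choice _ _ (fun k a => (forall m, Rabs (a m) <= C k) /\
    forall y, Rabs y < 1 -> is_pseries a y (h k (x0 + y))) (fun k => Hh k x0)) as [a Ha].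
assert (exm : forall m, ex_series (fun k => a k m)).
{ intros m; apply ex_series_dominated with (2 := HC); intros k; apply (proj1 (Ha k)). }
assert (exh : forall x, ex_series (fun k => h k x)).
{ intros x; apply ex_series_dominated with (2 := HC); intros k; apply (unit_analytic_bound _ _ (Hh k)). }
exists (fun m => Series (fun k => a k m)); split.
- intros m.
  assert (exm' : ex_series (fun k => Rabs (a k m))).
  { apply ex_series_dominated with (2 := HC); intros k.
    rewrite Rabs_Rabsolu; apply (proj1 (Ha k)). }
  apply Rle_trans with (1 := Series_Rabs _ exm').
  apply Series_le; [|exact HC]; intros k; split; [apply Rabs_pos | apply (proj1 (Ha k))].
- intros y Hy; rewrite is_pseries_R.
  set (s := Series (fun k => h k (x0 + y))).
  change (is_lim_seq (sum_n (fun m => Series (fun k => a k m) * y ^ m)) s).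
  assert (Hsum : forall M, ex_series (fun k => sum_n (fun m => a k m * y ^ m) M) /\
     sum_n (fun m => Series (fun k => a k m) * y ^ m) M = Series (fun k => sum_n (fun m => a k m * y ^ m) M)).
  { induction M.
    - split.
      + apply (ex_series_ext (fun k => a k 0%nat * y ^ 0)); [intros; now rewrite sum_O|].
        apply (ex_series_scal_r (y ^ 0)), exm.
      + rewrite sum_O, <- Series_scal_r; apply Series_ext; intros; now rewrite sum_O.
    - destruct IHM as [IH1 IH2]; split.
      + apply (ex_series_ext (fun k => plus (sum_n (fun m => a k m * y ^ m) M) (a k (S M) * y ^ S M)));
          [intros; now rewrite sum_Sn|].
        apply (ex_series_plus (fun k => sum_n (fun m => a k m * y ^ m) M)); [exact IH1|].
        apply (ex_series_scal_r (y ^ S M)), exm.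
      + rewrite sum_Sn, IH2, <- Series_scal_r.
        transitivity (Series (fun k => sum_n (fun m => a k m * y ^ m) M + a k (S M) * y ^ S M)).
        * symmetry; apply Series_plus; [exact IH1 | apply (ex_series_scal_r (y ^ S M)), exm].
        * apply Series_ext; intros; now rewrite sum_Sn. }
  apply is_lim_seq_ext with (fun M => s - (s - sum_n (fun m => Series (fun k => a k m) * y ^ m) M));
    [intros; ring|].
  replace (Finite s) with (Finite (s - 0)) by (f_equal; ring).
  apply is_lim_seq_minus'; [apply is_lim_seq_const|].
  apply is_lim_seq_abs_0,
    (is_lim_seq_le_le (fun _ => 0) _ (fun M => Series C * (Rabs y ^ S M / (1 - Rabs y)))).
  + intros M; split; [apply Rabs_pos|].
    destruct (Hsum M) as [exM ->]; unfold s.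
    rewrite <- Series_minus by (apply exh || exact exM).
    assert (HexC : ex_series (fun k => C k * (Rabs y ^ S M / (1 - Rabs y))))
      by (apply (ex_series_scal_r (Rabs y ^ S M / (1 - Rabs y))), HC).
    assert (Hle : forall k, Rabs (h k (x0 + y) - sum_n (fun m => a k m * y ^ m) M) <=
       C k * (Rabs y ^ S M / (1 - Rabs y))).
    { intros k; destruct (Ha k) as [B1 B2]; apply pseries_remainder; auto. }
    assert (Hex : ex_series (fun k => Rabs (h k (x0 + y) - sum_n (fun m => a k m * y ^ m) M))).
    { apply ex_series_dominated with (2 := HexC); intros k.
      rewrite Rabs_Rabsolu; apply Hle. }
    apply Rle_trans with (1 := Series_Rabs _ Hex).
    rewrite <- Series_scal_r; apply Series_le; [|exact HexC].
    intros k; split; [apply Rabs_pos | apply Hle].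
  + apply is_lim_seq_const.
  + replace (Finite 0) with (Finite (Series C * (0 * / (1 - Rabs y)))) by (f_equal; ring).
    apply is_lim_seq_mult'; [apply is_lim_seq_const|].
    apply is_lim_seq_mult'; [|apply is_lim_seq_const].
    apply (is_lim_seq_incr_1 (fun M => Rabs y ^ M)), pow_lim_0; split; [apply Rabs_pos | exact Hy].
Qed.

(** * Fourier coefficients *)

Lemma RInt_plus_continuous (f g : R -> R) (a b : R) :
  cont f -> cont g ->
  RInt (fun x => f x + g x) a b = RInt f a b + RInt g a b.
Proof.
intros Hf Hg; apply (RInt_plus (V := R_CompleteNormedModule) f g);
  apply ex_RInt_cont; assumption.
Qed.

Lemma RInt_scal_continuous (c : R) (f : R -> R) (a b : R) :
  cont f -> RInt (fun x => c * f x) a b = c * RInt f a b.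
Proof.
intros Hf; apply (RInt_scal (V := R_CompleteNormedModule) f a b c).
apply ex_RInt_cont; assumption.
Qed.

Lemma RInt_periodic_shift (g : R -> R) (x : R) :
  cont g -> periodic_2PI g ->
  RInt (fun b => g (x + b)) 0 (2 * PI) = RInt g 0 (2 * PI).
Proof.
intros Hc Hp.
assert (A : RInt (fun b => g (x + b)) 0 (2 * PI) = RInt g x (x + 2 * PI)).
{ transitivity (RInt (fun y => scal 1 (g (1 * y + x))) 0 (2 * PI)).
  - apply RInt_ext; intros y _; unfold scal; simpl; unfold mult; simpl.
    rewrite Rmult_1_l; f_equal; ring_over_R.
  - rewrite (RInt_comp_lin (V := R_CompleteNormedModule)).
    + f_equal; ring_over_R.
    + apply ex_RInt_cont, Hc. }
assert (B : RInt g x (x + 2 * PI) = RInt g 0 (x + 2 * PI) - RInt g 0 x).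
{ assert (C : RInt g 0 x + RInt g x (x + 2 * PI) = RInt g 0 (x + 2 * PI))
    by (apply (RInt_Chasles (V := R_CompleteNormedModule)); apply ex_RInt_cont, Hc).
  lra. }
rewrite A, B.
destruct (mean_value (fun x => RInt g 0 (x + 2 * PI) - RInt g 0 x)
   (fun x => 1 * g (x + 2 * PI) - g x) 0 x) as [c [_ E]].
- intros y _; apply @is_derive_minus; [|apply is_derive_RInt_upper, Hc].
  apply (is_derive_comp (fun z => RInt g 0 z) (fun y => y + 2 * PI)); [apply is_derive_RInt_upper, Hc|].
  auto_derive; [trivial | ring_over_R].
- cbv beta in E; rewrite Hp, RInt_point, Rplus_0_l in E; unfold zero in E; simpl in E; lra.
Qed.

Lemma continuous_cos_linear (l th : R) : cont (fun x => cos (l * x + th)).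
Proof.
solve_continuity.
Qed.

Lemma periodic_cos_linear (k : Z) (th : R) : periodic_2PI (fun x => cos (IZR k * x + th)).
Proof.
intros x; replace (IZR k * (x + 2 * PI) + th) with ((IZR k * x + th) + 2 * PI * IZR k) by ring_over_R.
apply (periodic_shift_Z cos).
intros y; rewrite cos_plus, cos_2PI, sin_2PI; ring_over_R.
Qed.

Lemma periodic_sin_linear (k : Z) (th : R) : periodic_2PI (fun x => sin (IZR k * x + th)).
Proof.
intros x; replace (IZR k * (x + 2 * PI) + th) with ((IZR k * x + th) + 2 * PI * IZR k) by ring_over_R.
apply (periodic_shift_Z sin).
intros y; rewrite sin_plus, cos_2PI, sin_2PI; ring_over_R.
Qed.

Definition cos_coef (v : R -> R) (n : Z) : R := RInt (fun z => v z * cos (IZR n * z)) 0 (2 * PI).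
Definition sin_coef (v : R -> R) (n : Z) : R := RInt (fun z => v z * sin (IZR n * z)) 0 (2 * PI).

Lemma RInt_mult_cos_linear (v : R -> R) (n : Z) (th : R) : cont v ->
  RInt (fun z => v z * cos (IZR n * z + th)) 0 (2 * PI) = cos th * cos_coef v n - sin th * sin_coef v n.
Proof.
intros Hv; unfold cos_coef, sin_coef.
assert (c1 : cont (fun z => v z * cos (IZR n * z))) by solve_continuity.
assert (c2 : cont (fun z => v z * sin (IZR n * z))) by solve_continuity.
transitivity (RInt (fun z => cos th * (v z * cos (IZR n * z)) + - sin th * (v z * sin (IZR n * z))) 0 (2 * PI)).
- apply RInt_ext; intros z _; rewrite cos_plus; ring_over_R.
- rewrite (RInt_plus_continuous (fun z => cos th * (v z * cos (IZR n * z)))).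
  + rewrite (RInt_scal_continuous (cos th) (fun z => v z * cos (IZR n * z))) by exact c1.
    rewrite (RInt_scal_continuous (- sin th) (fun z => v z * sin (IZR n * z))) by exact c2.
    ring_over_R.
  + solve_continuity.
  + solve_continuity.
Qed.

Lemma RInt_cos_linear (k : Z) (th : R) : k <> 0%Z ->
  RInt (fun x => cos (IZR k * x + th)) 0 (2 * PI) = 0.
Proof.
intros Hk; assert (Hk' : IZR k <> 0) by now apply not_0_IZR.
rewrite (RInt_of_derive (fun x => / IZR k * sin (IZR k * x + th))).
- assert (P := periodic_sin_linear k th 0); cbv beta in P; rewrite Rplus_0_l in P; rewrite P; ring_over_R.
- intros x; auto_derive; [trivial | field; exact Hk'].
- apply continuous_cos_linear.
Qed.

Lemma RInt_cos_constant (th : R) : RInt (fun x => cos (IZR 0 * x + th)) 0 (2 * PI) = 2 * PI * cos th.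
Proof.
transitivity (RInt (fun _ : R => cos th) 0 (2 * PI)).
- apply RInt_ext; intros x _; rewrite Rmult_0_l, Rplus_0_l; reflexivity.
- rewrite (RInt_const (V := R_CompleteNormedModule)); unfold scal; simpl; unfold mult; simpl; ring_over_R.
Qed.

Lemma trig_orthogonal_to_single_harmonic (v : R -> R) (n j : Z) (th : R) :
  cont v -> (0 < n)%Z -> (0 <= j)%Z ->
  ((0 < j)%Z -> j <> n -> cos_coef v j = 0 /\ sin_coef v j = 0) ->
  RInt (fun x => cos (IZR j * x + th) *
    (v x - cos_coef v 0 / (2 * PI)
       - (cos_coef v n / PI * cos (IZR n * x) + sin_coef v n / PI * sin (IZR n * x)))) 0 (2 * PI) = 0.
Proof.
intros Hv Hn Hj H; assert (P := PI_RGT_0).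
set (a0 := cos_coef v 0); set (A := cos_coef v n / PI); set (B := sin_coef v n / PI).
transitivity (RInt (fun x => (v x * cos (IZR j * x + th) + (- (a0 / (2 * PI))) * cos (IZR j * x + th))
  + ((- A / 2) * (cos (IZR (j + n) * x + th) + cos (IZR (j - n) * x + th)) +
     (- B / 2) * (cos (IZR (j + n) * x + (th - PI / 2)) + - 1 * cos (IZR (j - n) * x + (th - PI / 2))))) 0 (2 * PI)).
{ apply RInt_ext; intros x _.
  replace (IZR (j + n) * x + (th - PI / 2)) with ((IZR (j + n) * x + th) - PI / 2) by ring_over_R.
  replace (IZR (j - n) * x + (th - PI / 2)) with ((IZR (j - n) * x + th) - PI / 2) by ring_over_R.
  rewrite !cos_minus, cos_PI2, sin_PI2, plus_IZR, minus_IZR.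
  replace ((IZR j + IZR n) * x + th) with ((IZR j * x + th) + IZR n * x) by ring_over_R.
  replace ((IZR j - IZR n) * x + th) with ((IZR j * x + th) - IZR n * x) by ring_over_R.
  generalize (IZR j * x + th); intros C.
  rewrite cos_plus, cos_minus, sin_plus, sin_minus.
  field_over_R; lra. }
assert (cc := continuous_cos_linear).
assert (csc : forall c f, cont f -> cont (fun x => c * f x)) by (intros; solve_continuity).
assert (cpl := cont_plus).
assert (cv : cont (fun x => v x * cos (IZR j * x + th))) by solve_continuity.
set (f1 := fun x => v x * cos (IZR j * x + th)) in *.
set (f2 := fun x => cos (IZR j * x + th)).
set (f3 := fun x => cos (IZR (j + n) * x + th)).
set (f4 := fun x => cos (IZR (j - n) * x + th)).
set (f5 := fun x => cos (IZR (j + n) * x + (th - PI / 2))).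
set (f6 := fun x => cos (IZR (j - n) * x + (th - PI / 2))).
assert (c2 : cont f2) by apply cc. assert (c3 : cont f3) by apply cc.
assert (c4 : cont f4) by apply cc. assert (c5 : cont f5) by apply cc.
assert (c6 : cont f6) by apply cc.
transitivity (RInt f1 0 (2 * PI) + - (a0 / (2 * PI)) * RInt f2 0 (2 * PI) +
  (- A / 2 * (RInt f3 0 (2 * PI) + RInt f4 0 (2 * PI)) +
   - B / 2 * (RInt f5 0 (2 * PI) + - 1 * RInt f6 0 (2 * PI)))).
{ rewrite <- (RInt_scal_continuous (- 1) f6) by exact c6.
  rewrite <- (RInt_plus_continuous f5 (fun x => - 1 * f6 x)) by auto.
  rewrite <- (RInt_plus_continuous f3 f4) by auto.
  rewrite <- (RInt_scal_continuous (- A / 2) (fun x => f3 x + f4 x)) by (apply cpl; auto).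
  rewrite <- (RInt_scal_continuous (- B / 2) (fun x => f5 x + - 1 * f6 x)) by (apply cpl; auto).
  rewrite <- (RInt_plus_continuous (fun x => - A / 2 * (f3 x + f4 x)))
    by (apply csc, cpl; auto).
  rewrite <- (RInt_scal_continuous (- (a0 / (2 * PI))) f2) by exact c2.
  rewrite <- (RInt_plus_continuous f1 (fun x => - (a0 / (2 * PI)) * f2 x)) by auto.
  rewrite <- (RInt_plus_continuous (fun x => f1 x + - (a0 / (2 * PI)) * f2 x));
    [reflexivity | apply cpl; auto|].
  apply (cpl (fun x => - A / 2 * (f3 x + f4 x))); apply csc, cpl; auto. }
unfold f1; rewrite RInt_mult_cos_linear by exact Hv.
unfold f3, f5; rewrite !RInt_cos_linear by lia.
unfold f2, f4, f6.
destruct (Z.eq_dec j 0) as [-> | Hj0].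
- rewrite RInt_cos_constant, !RInt_cos_linear by lia.
  assert (E : sin_coef v 0 = 0).
  { unfold sin_coef; transitivity (RInt (fun _ : R => 0) 0 (2 * PI)).
    - apply RInt_ext; intros; rewrite Rmult_0_l, sin_0; ring_over_R.
    - rewrite (RInt_const (V := R_CompleteNormedModule)); unfold scal; simpl; unfold mult; simpl; ring_over_R. }
  rewrite E; unfold a0; field_over_R; lra.
- rewrite (RInt_cos_linear j th) by exact Hj0.
  destruct (Z.eq_dec j n) as [-> | Hjn].
  + rewrite Z.sub_diag; rewrite !RInt_cos_constant.
    rewrite cos_minus, cos_PI2, sin_PI2; unfold A, B; field_over_R; lra.
  + rewrite !RInt_cos_linear by lia.
    destruct (H ltac:(lia) Hjn) as [-> ->]; ring_over_R.
Qed.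

Lemma continuous_zero_of_bump_orthogonal (phi : R -> R) :
  cont phi -> periodic_2PI phi ->
  (forall j : nat, forall th, RInt (fun x => cos (INR j * x + th) * phi x) 0 (2 * PI) = 0) ->
  forall x, phi x = 0.
Proof.
intros Hc Hp H; assert (P := PI_RGT_0).
assert (Hin : forall t, 0 < t < 2 * PI -> phi t = 0).
{ intros t Ht; apply bump_orthogonal_zero; [exact Hc | exact Ht|]; intros N.
  assert (Hs : forall f, cos_span f ->
     cont (fun x => f (x - t) * phi x) /\
     RInt (fun x => f (x - t) * phi x) 0 (2 * PI) = 0).
  { induction 1 as [j | f g _ [IHf1 IHf2] _ [IHg1 IHg2] | c f _ [IH1 IH2]].
    - split.
      + solve_continuity.
      + transitivity (RInt (fun x => cos (INR j * x + - (INR j * t)) * phi x) 0 (2 * PI)); [|apply H].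
        apply RInt_ext; intros x _; replace (INR j * (x - t)) with (INR j * x + - (INR j * t)) by ring; reflexivity.
    - split.
      + apply (cont_ext (fun x => f (x - t) * phi x + g (x - t) * phi x)); [intros; ring_over_R|].
        solve_continuity.
      + transitivity (RInt (fun x => f (x - t) * phi x + g (x - t) * phi x) 0 (2 * PI)).
        * apply RInt_ext; intros; ring_over_R.
        * rewrite (RInt_plus_continuous (fun x => f (x - t) * phi x)), IHf2, IHg2 by assumption; ring_over_R.
    - split.
      + apply (cont_ext (fun x => c * (f (x - t) * phi x))); [intros; ring_over_R|].
        solve_continuity.
      + transitivity (RInt (fun x => c * (f (x - t) * phi x)) 0 (2 * PI)).
        * apply RInt_ext; intros; ring_over_R.
        * rewrite (RInt_scal_continuous c (fun x => f (x - t) * phi x)), IH2 by assumption; ring_over_R. }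
  apply (Hs (bump N) (bump_cos_span N)). }
assert (H2 : phi (2 * PI) = 0).
{ apply continuous_zero_left with PI; [exact Hc | lra | intros; apply Hin; lra]. }
intros x; destruct (periodic_representative x) as [k Hk].
rewrite <- (periodic_shift_Z phi Hp k x).
destruct (Req_dec (x + 2 * PI * IZR k) 0) as [-> | Hne]; [|apply Hin; lra].
rewrite <- Hp, Rplus_0_l; exact H2.
Qed.

Definition has_harmonic (v : R -> R) (n : Z) : Prop := cos_coef v n <> 0 \/ sin_coef v n <> 0.

Lemma two_harmonics (v : R -> R) : cont v -> periodic_2PI v ->
  ~ (exists (a b c : R) (m : Z), forall x : R, v x = a * sin (IZR m * x) + b * cos (IZR m * x) + c) ->
  exists n m : Z, (0 < n)%Z /\ (0 < m)%Z /\ n <> m /\ has_harmonic v n /\ has_harmonic v m.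
Proof.
intros Hv Hp Hnot; apply NNPP; intros Hno; apply Hnot; assert (P := PI_RGT_0).
assert (Hn : exists n, (0 < n)%Z /\ forall m, (0 < m)%Z -> m <> n -> ~ has_harmonic v m).
{ destruct (classic (exists n, (0 < n)%Z /\ has_harmonic v n)) as [[n [H1 H2]] | H].
  - exists n; split; [exact H1|]; intros m Hm Hmn Hh; apply Hno; exists n, m; intuition.
  - exists 1%Z; split; [lia|]; intros m Hm _ Hh; apply H; exists m; auto. }
destruct Hn as [n [Hn Hm]].
set (phi := fun x => v x - cos_coef v 0 / (2 * PI)
       - (cos_coef v n / PI * cos (IZR n * x) + sin_coef v n / PI * sin (IZR n * x))).
assert (Hz : forall x, phi x = 0).
{ apply continuous_zero_of_bump_orthogonal.
  - unfold phi; solve_continuity.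
  - intros x; unfold phi; rewrite Hp.
    assert (E1 := periodic_cos_linear n 0 x); assert (E2 := periodic_sin_linear n 0 x); cbv beta in *.
    rewrite !Rplus_0_r in E1, E2; rewrite E1, E2; reflexivity.
  - intros j th; rewrite INR_IZR_INZ.
    apply (trig_orthogonal_to_single_harmonic v n (Z.of_nat j) th Hv Hn); [lia|].
    intros Hj Hjn; specialize (Hm _ Hj Hjn); unfold has_harmonic in Hm.
    split; apply NNPP; intros Hc; apply Hm; auto. }
exists (sin_coef v n / PI), (cos_coef v n / PI), (cos_coef v 0 / (2 * PI)), n.
intros x; generalize (Hz x); unfold phi; lra.
Qed.

(** * The Lie algebra generated by two harmonics *)

Fixpoint point_eval (l : list (R * R)) (w : R -> R) : R :=
  match l with
  | nil => 0
  | (c, y) :: l' => c * w y + point_eval l' w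
  end.

Lemma point_eval_ext (l : list (R * R)) (w w' : R -> R) :
  (forall x, w x = w' x) -> point_eval l w = point_eval l w'.
Proof. intros H; induction l as [|[c y] l IH]; simpl; [reflexivity | now rewrite H, IH]. Qed.

Lemma point_eval_plus (l : list (R * R)) (w w' : R -> R) :
  point_eval l (fun x => w x + w' x) = point_eval l w + point_eval l w'.
Proof. induction l as [|[c y] l IH]; simpl; [ring | rewrite IH; ring]. Qed.

Lemma point_eval_scal (l : list (R * R)) (k : R) (w : R -> R) :
  point_eval l (fun x => k * w x) = k * point_eval l w.
Proof. induction l as [|[c y] l IH]; simpl; [ring | rewrite IH; ring]. Qed.

Lemma point_eval_app (l l' : list (R * R)) (w : R -> R) :
  point_eval (l ++ l') w = point_eval l w + point_eval l' w.
Proof. induction l as [|[c y] l IH]; simpl; [ring | rewrite IH; ring]. Qed.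

Lemma point_eval_translate_analytic (l : list (R * R)) (al g : R -> R) : real_analytic g ->
  real_analytic (fun b => point_eval l (fun x => al x * g (x + b))).
Proof.
intros Hg; induction l as [|[c y] l IH]; simpl.
- apply unit_analytic_real_analytic with 0, unit_analytic_zero.
- apply (real_analytic_plus (fun b => c * (al y * g (y + b)))); [|exact IH].
  apply (real_analytic_scal c (fun b => al y * g (y + b))), (real_analytic_scal (al y) (fun b => g (y + b))).
  apply real_analytic_translate, Hg.
Qed.

Lemma point_eval_translate_derive (l : list (R * R)) (al g : R -> R) (b : R) : real_analytic g ->
  is_derive (fun b => point_eval l (fun x => al x * g (x + b))) b
    (point_eval l (fun x => al x * Derive g (x + b))).
Proof.
intros Hg; induction l as [|[c y] l IH]; simpl.
- apply @is_derive_const.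
- apply @is_derive_plus; [|exact IH].
  apply (is_derive_scal (fun b => al y * g (y + b))), (is_derive_scal (fun b => g (y + b))).
  replace (Derive g (y + b)) with (1 * Derive g (y + b)) by ring.
  apply (is_derive_comp g (fun b => y + b)); [apply real_analytic_is_derive, Hg | auto_derive; [trivial | ring]].
Qed.

Lemma point_eval_translate_Derive_n (l : list (R * R)) (al g : R -> R) (n : nat) (b : R) :
  real_analytic g ->
  Derive_n (fun b => point_eval l (fun x => al x * g (x + b))) n b =
  point_eval l (fun x => al x * Derive_n g n (x + b)).
Proof.
intros Hg; revert b; induction n; intros b; [reflexivity|].
simpl; rewrite (Derive_ext _ (fun b => point_eval l (fun x => al x * Derive_n g n (x + b)))) by exact IHn.
apply is_derive_unique, point_eval_translate_derive, real_analytic_Derive_n, Hg.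
Qed.

Lemma point_eval_RInt (l : list (R * R)) (al g c : R -> R) :
  cont g -> cont c ->
  cont (fun b => c b * point_eval l (fun x => al x * g (x + b))) /\
  RInt (fun b => c b * point_eval l (fun x => al x * g (x + b))) 0 (2 * PI) =
  point_eval l (fun x => al x * RInt (fun b => g (x + b) * c b) 0 (2 * PI)).
Proof.
intros Hg Hc; induction l as [|[k y] l [IH1 IH2]]; simpl.
- split; [solve_continuity|].
  transitivity (RInt (fun _ : R => 0) 0 (2 * PI)); [apply RInt_ext; intros; ring_over_R|].
  rewrite (RInt_const (V := R_CompleteNormedModule)); unfold scal; simpl; unfold mult; simpl; ring_over_R.
- assert (H1 : cont (fun b => g (y + b) * c b)) by solve_continuity.
  assert (H2 : cont (fun b => (k * al y) * (g (y + b) * c b))) by solve_continuity.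
  split.
  + apply (cont_ext (fun b => (k * al y) * (g (y + b) * c b) +
      c b * point_eval l (fun x => al x * g (x + b)))); [intros; ring|].
    solve_continuity.
  + transitivity (RInt (fun b => (k * al y) * (g (y + b) * c b) +
      c b * point_eval l (fun x => al x * g (x + b))) 0 (2 * PI)); [apply RInt_ext; intros; ring_over_R|].
    rewrite (RInt_plus_continuous (fun b => (k * al y) * (g (y + b) * c b))), IH2 by assumption.
    rewrite (RInt_scal_continuous (k * al y) (fun b => g (y + b) * c b)) by exact H1; ring_over_R.
Qed.

Lemma is_derive_cos_linear (l th x : R) :
  is_derive (fun x => cos (l * x + th)) x (l * cos (l * x + (th + PI / 2))).
Proof.
replace (l * x + (th + PI / 2)) with (PI / 2 + (l * x + th)) by ring.
replace (cos (PI / 2 + (l * x + th))) with (- sin (l * x + th)) by (rewrite cos_plus, cos_PI2, sin_PI2; ring).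
auto_derive; [trivial | ring].
Qed.

Section LieClosure.

Variables (v : R -> R) (Ann : list (R * R) -> Prop).
Hypothesis v_analytic : analytic_on_circle v.

Definition null (w : R -> R) : Prop := forall l, Ann l -> point_eval l w = 0.

Hypothesis null_one : null (fun _ => 1).
Hypothesis null_derive : forall w w', (forall x, is_derive w x (w' x)) -> null w -> null w'.
Hypothesis null_bracket : forall w w', (forall x, is_derive w x (w' x)) -> null w ->
  null (fun x => v x * w' x - w x * Derive v x).

Lemma null_ext (w w' : R -> R) : (forall x, w x = w' x) -> null w -> null w'.
Proof. intros E H l Hl; rewrite <- (point_eval_ext l w w' E); apply H, Hl. Qed.

Lemma null_plus (w w' : R -> R) : null w -> null w' -> null (fun x => w x + w' x).
Proof. intros H H' l Hl; rewrite point_eval_plus, H, H' by exact Hl; ring. Qed.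

Lemma null_scal (k : R) (w : R -> R) : null w -> null (fun x => k * w x).
Proof. intros H l Hl; rewrite point_eval_scal, H by exact Hl; ring. Qed.

Definition null_harmonic (k : Z) : Prop := forall th, null (fun x => cos (IZR k * x + th)).

Let vn (i : nat) : R -> R := Derive_n v i.

Lemma derive_vn (i : nat) (x : R) : is_derive (vn i) x (vn (S i) x).
Proof. apply (real_analytic_is_derive (Derive_n v i)), real_analytic_Derive_n, v_analytic. Qed.

(* With [w] a harmonic, [[v^(i+1), w] = [v^(i), w]' - [v^(i), w']]. *)
Lemma null_bracket_derivatives (k : Z) : null_harmonic k -> forall i th,
  null (fun x => vn i x * (IZR k * cos (IZR k * x + (th + PI / 2))) - cos (IZR k * x + th) * vn (S i) x).
Proof.
intros Hk; induction i; intros th.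
- apply (null_bracket (fun x => cos (IZR k * x + th))
    (fun x => IZR k * cos (IZR k * x + (th + PI / 2)))); [intros; apply is_derive_cos_linear | apply Hk].
- assert (D := null_derive
    (fun x => vn i x * (IZR k * cos (IZR k * x + (th + PI / 2))) - cos (IZR k * x + th) * vn (S i) x)
    (fun x => (vn (S i) x * (IZR k * cos (IZR k * x + (th + PI / 2))) +
       vn i x * (IZR k * (IZR k * cos (IZR k * x + (th + PI / 2 + PI / 2))))) -
      (IZR k * cos (IZR k * x + (th + PI / 2)) * vn (S i) x + cos (IZR k * x + th) * vn (S (S i)) x))).
  assert (N := null_scal (- IZR k) _ (IHi (th + PI / 2))).
  match type of D with ?P -> _ => assert (Hd : P) end.
  { intros x; apply @is_derive_minus.
    + apply (is_derive_mult (vn i) (fun x => IZR k * cos (IZR k * x + (th + PI / 2)))); [apply derive_vn| |intros; apply Rmult_comm].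
      apply (is_derive_scal (fun x => cos (IZR k * x + (th + PI / 2)))), is_derive_cos_linear.
    + apply (is_derive_mult (fun x => cos (IZR k * x + th)) (vn (S i))); [apply is_derive_cos_linear | apply derive_vn|].
      intros; apply Rmult_comm. }
  apply null_ext with (2 := null_plus _ _ (D Hd (IHi th)) N); intros x; ring.
Qed.

(* The bracket with the translate [v(. + b)] is analytic in [b], with vanishing derivatives at [b = 0]. *)
Lemma null_bracket_translate (k : Z) (th b : R) : null_harmonic k -> 0 <= b ->
  null (fun x => IZR k * cos (IZR k * x + (th + PI / 2)) * v (x + b)
               + - cos (IZR k * x + th) * Derive v (x + b)).
Proof.
intros Hk Hb l Hl.
set (al := fun x => IZR k * cos (IZR k * x + (th + PI / 2))).
set (be := fun x => - cos (IZR k * x + th)).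
assert (Hv : real_analytic v) by apply v_analytic.
assert (Hv' : real_analytic (Derive v)) by (apply real_analytic_Derive, Hv).
rewrite point_eval_plus.
apply (real_analytic_identity (fun b => point_eval l (fun x => al x * v (x + b)) +
   point_eval l (fun x => be x * Derive v (x + b)))); [| |exact Hb].
- apply (real_analytic_plus (fun b => point_eval l (fun x => al x * v (x + b))));
    apply point_eval_translate_analytic; assumption.
- intros n; rewrite Derive_n_plus.
  + rewrite !point_eval_translate_Derive_n by assumption.
    rewrite <- point_eval_plus.
    etransitivity; [|exact (null_bracket_derivatives k Hk n th l Hl)].
    apply point_eval_ext; intros x; unfold al, be, vn.
    rewrite Rplus_0_r; replace (Derive_n (Derive v) n x) with (Derive_n v (S n) x); [ring|].
    change (Derive v) with (Derive_n v 1); rewrite Derive_n_comp; f_equal; lia.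
  + apply filter_forall; intros y m _; destruct m; [exact I|].
    eexists; apply real_analytic_is_derive, real_analytic_Derive_n, point_eval_translate_analytic, Hv.
  + apply filter_forall; intros y m _; destruct m; [exact I|].
    eexists; apply real_analytic_is_derive, real_analytic_Derive_n, point_eval_translate_analytic, Hv'.
Qed.

Lemma v_continuous : cont v.
Proof. apply real_analytic_continuous, v_analytic. Qed.

Lemma Derive_v_continuous : cont (Derive v).
Proof. apply real_analytic_continuous, real_analytic_Derive, v_analytic. Qed.

Lemma harmonic_convolution (n : Z) (al x : R) :
  RInt (fun b => v (x + b) * cos (IZR n * b + al)) 0 (2 * PI) =
  cos_coef v n * cos (IZR n * x - al) + sin_coef v n * sin (IZR n * x - al).
Proof.
set (g := fun z => v z * cos (IZR n * z + (al - IZR n * x))).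
transitivity (RInt (fun b => g (x + b)) 0 (2 * PI)).
- apply RInt_ext; intros b _; unfold g.
  replace (IZR n * (x + b) + (al - IZR n * x)) with (IZR n * b + al) by ring; reflexivity.
- rewrite RInt_periodic_shift.
  + unfold g; rewrite RInt_mult_cos_linear by apply v_continuous.
    replace (al - IZR n * x) with (- (IZR n * x - al)) by ring; rewrite cos_neg, sin_neg; ring_over_R.
  + assert (Hc := v_continuous); unfold g; solve_continuity.
  + intros z; unfold g; rewrite (proj1 v_analytic).
    rewrite (periodic_cos_linear n (al - IZR n * x) z); reflexivity.
Qed.

Lemma harmonic_convolution_derive (n : Z) (al x : R) :
  RInt (fun b => Derive v (x + b) * cos (IZR n * b + al)) 0 (2 * PI) =
  IZR n * (cos_coef v n * cos (IZR n * x - (al - PI / 2)) + sin_coef v n * sin (IZR n * x - (al - PI / 2))).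
Proof.
rewrite <- harmonic_convolution.
assert (Hv := v_continuous); assert (Hv' := Derive_v_continuous).
assert (c1 : cont (fun b => v (x + b) * cos (IZR n * b + (al - PI / 2)))) by solve_continuity.
assert (c2 : cont (fun b => Derive v (x + b) * cos (IZR n * b + al))) by solve_continuity.
assert (c3 : cont (fun b => - IZR n * (v (x + b) * cos (IZR n * b + (al - PI / 2)))))
  by solve_continuity.
assert (E := RInt_of_derive (fun b => v (x + b) * cos (IZR n * b + al))
  (fun b => Derive v (x + b) * cos (IZR n * b + al) +
     - IZR n * (v (x + b) * cos (IZR n * b + (al - PI / 2)))) 0 (2 * PI)).
rewrite (RInt_plus_continuous (fun b => Derive v (x + b) * cos (IZR n * b + al))) in E by assumption.
rewrite (RInt_scal_continuous (- IZR n) (fun b => v (x + b) * cos (IZR n * b + (al - PI / 2)))) in E by assumption.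
assert (P1 := proj1 v_analytic x); assert (P2 := periodic_cos_linear n al 0); cbv beta in P2.
rewrite Rplus_0_l in P2.
match type of E with ?P -> _ => assert (Hd : P) end.
{ intros b.
  replace (Derive v (x + b) * cos (IZR n * b + al) + - IZR n * (v (x + b) * cos (IZR n * b + (al - PI / 2))))
    with (Derive v (x + b) * cos (IZR n * b + al) + v (x + b) * (IZR n * cos (IZR n * b + (al + PI / 2)))).
  - apply (is_derive_mult (fun b => v (x + b)) (fun b => cos (IZR n * b + al)));
      [| apply is_derive_cos_linear | intros; apply Rmult_comm].
    replace (Derive v (x + b)) with (1 * Derive v (x + b)) by ring.
    apply (is_derive_comp v (fun b => x + b));
      [apply real_analytic_is_derive, v_analytic | auto_derive; [trivial | ring]].
  - replace (IZR n * b + (al + PI / 2)) with ((IZR n * b + al) + PI / 2) by ring.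
    replace (IZR n * b + (al - PI / 2)) with ((IZR n * b + al) - PI / 2) by ring.
    generalize (IZR n * b + al); intros Y; rewrite cos_plus, cos_minus, cos_PI2, sin_PI2; ring. }
specialize (E Hd (cont_plus (fun b => Derive v (x + b) * cos (IZR n * b + al)) _ c2 c3)).
cbv beta in E; rewrite P2, P1, Rplus_0_r, Rmult_0_r, Rplus_0_l, Rminus_diag in E; lra.
Qed.

Lemma null_bracket_convolution (k n : Z) (th al : R) : null_harmonic k ->
  null (fun x => IZR k * cos (IZR k * x + (th + PI / 2)) *
      (cos_coef v n * cos (IZR n * x - al) + sin_coef v n * sin (IZR n * x - al))
    + - cos (IZR k * x + th) *
      (IZR n * (cos_coef v n * cos (IZR n * x - (al - PI / 2)) + sin_coef v n * sin (IZR n * x - (al - PI / 2))))).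
Proof.
intros Hk l Hl; assert (P := PI_RGT_0).
set (f := fun x => IZR k * cos (IZR k * x + (th + PI / 2))).
set (g := fun x => - cos (IZR k * x + th)).
set (c := fun b => cos (IZR n * b + al)).
destruct (point_eval_RInt l f v c v_continuous (continuous_cos_linear _ _)) as [C1 I1].
destruct (point_eval_RInt l g (Derive v) c Derive_v_continuous (continuous_cos_linear _ _)) as [C2 I2].
transitivity (point_eval l (fun x => f x * RInt (fun b => v (x + b) * c b) 0 (2 * PI)) +
  point_eval l (fun x => g x * RInt (fun b => Derive v (x + b) * c b) 0 (2 * PI))).
- rewrite <- point_eval_plus; apply point_eval_ext; intros x; unfold c.
  rewrite harmonic_convolution, harmonic_convolution_derive; reflexivity.
- rewrite <- I1, <- I2, <- RInt_plus_continuous by assumption.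
  transitivity (RInt (fun _ : R => 0) 0 (2 * PI)).
  + apply RInt_ext; intros b Hb.
    rewrite Rmin_left, Rmax_right in Hb by lra.
    rewrite <- Rmult_plus_distr_l, <- point_eval_plus.
    assert (Z := null_bracket_translate k th b Hk ltac:(lra) l Hl).
    change (fun x => f x * v (x + b) + g x * Derive v (x + b)) with
     (fun x => IZR k * cos (IZR k * x + (th + PI / 2)) * v (x + b)
               + - cos (IZR k * x + th) * Derive v (x + b)).
    rewrite Z; ring_over_R.
  + rewrite (RInt_const (V := R_CompleteNormedModule)); unfold scal; simpl; unfold mult; simpl; ring_over_R.
Qed.

Lemma null_bracket_harmonics (k n : Z) (th ph : R) : null_harmonic k -> has_harmonic v n ->
  null (fun x => - IZR k * cos (IZR n * x + ph) * sin (IZR k * x + th)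
               + IZR n * sin (IZR n * x + ph) * cos (IZR k * x + th)).
Proof.
intros Hk Hn.
set (a := cos_coef v n); set (b := sin_coef v n).
assert (Hab : a ^ 2 + b ^ 2 <> 0).
{ assert (0 <= a ^ 2) by apply pow2_ge_0; assert (0 <= b ^ 2) by apply pow2_ge_0.
  destruct Hn as [H1 | H1]; fold a b in H1.
  - assert (0 < a ^ 2) by (rewrite <- Rsqr_pow2; apply Rsqr_pos_lt, H1); lra.
  - assert (0 < b ^ 2) by (rewrite <- Rsqr_pow2; apply Rsqr_pos_lt, H1); lra. }
assert (N1 := null_scal (a / (a ^ 2 + b ^ 2)) _ (null_bracket_convolution k n th (- ph) Hk)).
assert (N2 := null_scal (- b / (a ^ 2 + b ^ 2)) _ (null_bracket_convolution k n th (- ph + PI / 2) Hk)).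
apply null_ext with (2 := null_plus _ _ N1 N2); intros x; fold a b.
replace (IZR k * x + (th + PI / 2)) with ((IZR k * x + th) + PI / 2) by ring.
generalize (IZR k * x + th); intros K.
replace (IZR n * x - - ph) with (IZR n * x + ph) by ring.
replace (IZR n * x - (- ph + PI / 2)) with ((IZR n * x + ph) - PI / 2) by ring.
replace (IZR n * x - (- ph + PI / 2 - PI / 2)) with (IZR n * x + ph) by field.
replace (IZR n * x - (- ph - PI / 2)) with ((IZR n * x + ph) + PI / 2) by ring.
generalize (IZR n * x + ph); intros Y.
rewrite !cos_plus, !cos_minus, !sin_plus, !sin_minus, cos_PI2, sin_PI2; field; exact Hab.
Qed.

Lemma null_harmonic_plus (k n : Z) : null_harmonic k -> has_harmonic v n -> n <> k ->
  null_harmonic (n + k).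
Proof.
intros Hk Hn Hnk th.
assert (Hne : IZR n - IZR k <> 0) by (intros E; apply Hnk, eq_IZR; lra).
assert (N1 := null_scal (/ (IZR n - IZR k)) _ (null_bracket_harmonics k n 0 (th + PI / 2) Hk Hn)).
assert (N2 := null_scal (/ (IZR n - IZR k)) _
  (null_bracket_harmonics k n (- (PI / 2)) (th + PI / 2 + PI / 2) Hk Hn)).
apply null_ext with (2 := null_plus _ _ N1 N2); intros x.
rewrite plus_IZR.
replace ((IZR n + IZR k) * x + th) with ((IZR n * x + th) + IZR k * x) by ring.
replace (IZR n * x + (th + PI / 2 + PI / 2)) with (((IZR n * x + th) + PI / 2) + PI / 2) by ring.
replace (IZR n * x + (th + PI / 2)) with ((IZR n * x + th) + PI / 2) by ring.
replace (IZR k * x + 0) with (IZR k * x) by ring.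
generalize (IZR n * x + th) (IZR k * x); intros Y K.
replace (K + - (PI / 2)) with (K - PI / 2) by ring.
repeat first [rewrite cos_plus | rewrite sin_plus | rewrite cos_minus | rewrite sin_minus].
rewrite cos_PI2, sin_PI2.
field; exact Hne.
Qed.

Lemma null_harmonic_minus (k n : Z) : null_harmonic k -> has_harmonic v n -> (n + k <> 0)%Z ->
  null_harmonic (n - k).
Proof.
intros Hk Hn Hnk th.
assert (Hne : IZR n + IZR k <> 0) by (intros E; apply Hnk, eq_IZR; rewrite plus_IZR; exact E).
assert (N1 := null_scal (/ (IZR n + IZR k)) _ (null_bracket_harmonics k n 0 (th + PI / 2) Hk Hn)).
assert (N2 := null_scal (- / (IZR n + IZR k)) _
  (null_bracket_harmonics k n (- (PI / 2)) (th + PI / 2 + PI / 2) Hk Hn)).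
apply null_ext with (2 := null_plus _ _ N1 N2); intros x.
rewrite minus_IZR.
replace ((IZR n - IZR k) * x + th) with ((IZR n * x + th) - IZR k * x) by ring.
replace (IZR n * x + (th + PI / 2 + PI / 2)) with (((IZR n * x + th) + PI / 2) + PI / 2) by ring.
replace (IZR n * x + (th + PI / 2)) with ((IZR n * x + th) + PI / 2) by ring.
replace (IZR k * x + 0) with (IZR k * x) by ring.
generalize (IZR n * x + th) (IZR k * x); intros Y K.
replace (K + - (PI / 2)) with (K - PI / 2) by ring.
repeat first [rewrite cos_plus | rewrite sin_plus | rewrite cos_minus | rewrite sin_minus].
rewrite cos_PI2, sin_PI2.
field; exact Hne.
Qed.

Lemma null_harmonic_0 : null_harmonic 0.
Proof.
intros th; apply null_ext with (2 := null_scal (cos th) _ null_one).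
intros x; rewrite Rmult_0_l, Rplus_0_l; ring.
Qed.

Lemma null_harmonic_opp (k : Z) : null_harmonic k -> null_harmonic (- k).
Proof.
intros H th; apply null_ext with (2 := H (- th)); intros x.
rewrite opp_IZR; replace (- IZR k * x + th) with (- (IZR k * x + - th)) by ring.
rewrite cos_neg; reflexivity.
Qed.

Lemma null_harmonic_multiples (n m : Z) : (0 < n)%Z -> (0 < m)%Z -> n <> m ->
  has_harmonic v n -> has_harmonic v m -> forall j : nat, null_harmonic (n * Z.of_nat j).
Proof.
intros Hn Hm Hnm Vn Vm.
assert (N1 : null_harmonic n).
{ replace n with (n + 0)%Z by ring; apply null_harmonic_plus; [apply null_harmonic_0 | exact Vn | lia]. }
(* [2n] cannot be reached as [n + n], since the bracket of two harmonics of equal degree has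
   no such component: go through [m + n], [m + 2n] and subtract. *)
assert (N2 : null_harmonic (2 * n)).
{ assert (A : null_harmonic (m + n)) by (apply null_harmonic_plus; auto).
  assert (B : null_harmonic (n + (m + n))) by (apply null_harmonic_plus; auto; lia).
  assert (C : null_harmonic (m - (n + (m + n)))) by (apply null_harmonic_minus; auto; lia).
  replace (2 * n)%Z with (- (m - (n + (m + n))))%Z by ring; apply null_harmonic_opp, C. }
intros j; destruct j as [|[|j]].
- replace (n * Z.of_nat 0)%Z with 0%Z by lia; apply null_harmonic_0.
- replace (n * Z.of_nat 1)%Z with n by lia; exact N1.
- induction j.
  + replace (n * Z.of_nat 2)%Z with (2 * n)%Z by lia; exact N2.
  + replace (n * Z.of_nat (S (S (S j))))%Z with (n + n * Z.of_nat (S (S j)))%Z by lia.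
    apply null_harmonic_plus; [exact IHj | exact Vn | nia].
Qed.

Lemma null_bump (n m : Z) : (0 < n)%Z -> (0 < m)%Z -> n <> m ->
  has_harmonic v n -> has_harmonic v m ->
  forall N x0, null (fun x => bump N (IZR n * (x - x0))).
Proof.
intros Hn Hm Hnm Vn Vm N x0.
assert (Hs : forall f, cos_span f -> null (fun x => f (IZR n * (x - x0)))).
{ induction 1 as [j | f g _ IHf _ IHg | c f _ IH].
  - apply null_ext with (2 := null_harmonic_multiples n m Hn Hm Hnm Vn Vm j (- (INR j * IZR n * x0))).
    intros x; f_equal; rewrite mult_IZR, <- INR_IZR_INZ; ring.
  - apply (null_plus (fun x => f (IZR n * (x - x0)))); assumption.
  - apply (null_scal c (fun x => f (IZR n * (x - x0)))); assumption. }
apply Hs, bump_cos_span.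
Qed.

End LieClosure.

Lemma RInt_fold_periods (f : R -> R) (q : nat) : cont f ->
  RInt f 0 (2 * PI * INR (S q)) = RInt (fun t => sum_n (fun j => f (t + 2 * PI * INR j)) q) 0 (2 * PI).
Proof.
intros Hf.
assert (cs : forall j, cont (fun t => f (t + 2 * PI * INR j))) by (intros; solve_continuity).
assert (sh : forall j, RInt (fun t => f (t + 2 * PI * INR j)) 0 (2 * PI) =
   RInt f (2 * PI * INR j) (2 * PI * INR (S j))).
{ intros j; transitivity (RInt (fun y => scal 1 (f (1 * y + 2 * PI * INR j))) 0 (2 * PI)).
  - apply RInt_ext; intros y _; unfold scal; simpl; unfold mult; simpl.
    rewrite !Rmult_1_l; reflexivity.
  - rewrite (RInt_comp_lin (V := R_CompleteNormedModule));
      [|apply ex_RInt_cont, Hf].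
    rewrite S_INR; f_equal; ring. }
induction q.
- transitivity (RInt (fun t => f (t + 2 * PI * INR 0)) 0 (2 * PI)).
  + rewrite sh; simpl; rewrite Rmult_0_r; reflexivity.
  + apply RInt_ext; intros; rewrite sum_O; reflexivity.
- transitivity (RInt (fun t => sum_n (fun j => f (t + 2 * PI * INR j)) q + f (t + 2 * PI * INR (S q))) 0 (2 * PI)).
  + rewrite (RInt_plus_continuous (fun t => sum_n (fun j => f (t + 2 * PI * INR j)) q)), <- IHq, sh.
    * symmetry; apply (RInt_Chasles (V := R_CompleteNormedModule));
        apply ex_RInt_cont, Hf.
    * solve_continuity.
    * apply cs.
  + apply RInt_ext; intros; rewrite sum_Sn; reflexivity.
Qed.

Definition test_function (h : R -> R) : Prop := periodic_2PI h /\ exists C, unit_analytic h C.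

Lemma test_function_continuous (h : R -> R) : test_function h -> cont h.
Proof.
intros [_ [C H]]; apply real_analytic_continuous, unit_analytic_real_analytic with C, H.
Qed.

Lemma continuous_plus_const (F : R -> R) (c : R) : cont F ->
  cont (fun t => F t + c).
Proof. intros; solve_continuity. Qed.

Lemma test_function_plus (f g : R -> R) :
  test_function f -> test_function g -> test_function (fun t => f t + g t).
Proof.
intros [Pf [C Hf]] [Pg [D Hg]]; split; [intros t; now rewrite Pf, Pg|].
exists (C + D); apply unit_analytic_plus; assumption.
Qed.

Lemma test_function_scal (c : R) (f : R -> R) : test_function f -> test_function (fun t => c * f t).
Proof.
intros [Pf [C Hf]]; split; [intros t; now rewrite Pf|].
exists (Rabs c * C); apply unit_analytic_scal; assumption.
Qed.

Lemma test_function_cos (k : Z) (th : R) : test_function (fun t => cos (IZR k * t + th)).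
Proof. split; [apply periodic_cos_linear | eexists; apply unit_analytic_cos]. Qed.

Lemma cos_span_test_function (f : R -> R) (t0 : R) : cos_span f ->
  test_function (fun t => f (t - t0)) /\
  exists h, (forall t, is_derive (fun t => f (t - t0)) t (h t)) /\ test_function h.
Proof.
induction 1 as [j | f g _ [IHf1 [hf [IHf2 IHf3]]] _ [IHg1 [hg [IHg2 IHg3]]] | c f _ [IH1 [h [IH2 IH3]]]].
- assert (E : forall t, cos (IZR (Z.of_nat j) * t + - (INR j * t0)) = cos (INR j * (t - t0)))
    by (intros t; rewrite <- INR_IZR_INZ; f_equal; ring).
  split.
  { rewrite <- (functional_extensionality _ _ E); apply test_function_cos. }
  exists (fun t => IZR (Z.of_nat j) * cos (IZR (Z.of_nat j) * t + (- (INR j * t0) + PI / 2))); split.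
  + intros t; apply (is_derive_ext _ _ t _ E), is_derive_cos_linear.
  + apply (test_function_scal _ (fun t => cos (IZR (Z.of_nat j) * t + (- (INR j * t0) + PI / 2)))),
      test_function_cos.
- split; [apply (test_function_plus (fun t => f (t - t0))); assumption|].
  exists (fun t => hf t + hg t); split; [|apply test_function_plus; assumption].
  intros t; apply @is_derive_plus; [apply IHf2 | apply IHg2].
- split; [apply (test_function_scal c (fun t => f (t - t0))); assumption|].
  exists (fun t => c * h t); split; [|apply test_function_scal; assumption].
  intros t; apply (is_derive_scal (fun t => f (t - t0))), IH2.
Qed.

Lemma is_derive_locally_zero (f : R -> R) (x l d : R) : 0 < d ->
  (forall y, Rabs (y - x) < d -> f y = 0) -> is_derive f x l -> l = 0.
Proof.
intros Hd H0 H; rewrite <- (is_derive_unique f x l H).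
apply is_derive_unique, (is_derive_ext_loc (fun _ => 0)); [|apply @is_derive_const].
apply locally_abs with d; [exact Hd|]; intros y Hy; symmetry; apply H0, Hy.
Qed.

Lemma is_lim_seq_sum_n (f : nat -> nat -> R) (l : nat -> R) (q : nat) :
  (forall j, (j <= q)%nat -> is_lim_seq (fun N => f N j) (l j)) ->
  is_lim_seq (fun N => sum_n (f N) q) (sum_n l q).
Proof.
induction q; intros H.
- apply is_lim_seq_ext with (fun N => f N 0%nat); [intros; now rewrite sum_O|].
  rewrite sum_O; apply H; lia.
- apply is_lim_seq_ext with (fun N => sum_n (f N) q + f N (S q)); [intros; now rewrite sum_Sn|].
  rewrite sum_Sn; apply is_lim_seq_plus'; [apply IHq; intros; apply H; lia | apply H; lia].
Qed.

Lemma interval_avoiding_lattice (g : R -> R) (n x0 a b : R) :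
  0 < n -> cont g -> (forall x y, x < y -> g x < g y) -> a < b ->
  exists a' b', a <= a' /\ a' < b' /\ b' <= b /\
    forall x, a' < x < b' -> cos (n * (g x - x0)) <> 1.
Proof.
intros Hn Hc Hg Hab; assert (P := PI_RGT_0).
set (f := fun x => cos (n * (g x - x0))).
assert (Hf : cont f) by (unfold f; solve_continuity).
assert (Hex : exists x, a < x < b /\ f x <> 1).
{ apply NNPP; intros Hno.
  assert (H1 : forall x, a < x < b -> f x = 1).
  { intros x Hx; apply NNPP; intros E; apply Hno; exists x; auto. }
  set (x := (a + b) / 2).
  destruct (cont_eps g x (PI / n) Hc) as [d [Hd Hx]]; [apply Rdiv_lt_0_compat; lra|].
  set (y := x + Rmin (d / 2) ((b - a) / 4)).
  assert (A1 := Rmin_l (d / 2) ((b - a) / 4)); assert (A2 := Rmin_r (d / 2) ((b - a) / 4)).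
  assert (A3 : 0 < Rmin (d / 2) ((b - a) / 4)) by (apply Rmin_pos; lra).
  assert (Hxy : g x < g y) by (apply Hg; unfold y; lra).
  assert (A' : Rabs (g y - g x) < PI / n).
  { apply Hx; unfold y; replace (x + Rmin (d / 2) ((b - a) / 4) - x) with (Rmin (d / 2) ((b - a) / 4)) by ring.
    rewrite Rabs_pos_eq; lra. }
  rewrite Rabs_pos_eq in A' by lra.
  assert (B : 0 < n * (g y - g x) < 2 * PI).
  { split; [apply Rmult_lt_0_compat; lra|].
    apply Rlt_le_trans with (n * (PI / n)); [apply Rmult_lt_compat_l; lra|].
    replace (n * (PI / n)) with PI by (field; lra); lra. }
  assert (Fx : f x = 1) by (apply H1; unfold x; lra).
  assert (Fy : f y = 1) by (apply H1; unfold y, x in *; lra).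
  unfold f in Fx, Fy.
  replace (n * (g y - x0)) with (n * (g x - x0) + n * (g y - g x)) in Fy by ring.
  assert (S := sin2_cos2 (n * (g x - x0))); rewrite Fx in S; unfold Rsqr in S.
  assert (S0 : sin (n * (g x - x0)) = 0) by nra.
  rewrite cos_plus, Fx, S0 in Fy.
  generalize (cos_lt_1 _ B); lra. }
destruct Hex as [x [Hx Hfx]].
destruct (cont_eps f x (Rabs (f x - 1)) Hf) as [d [Hd Hnear]]; [apply Rabs_pos_lt; lra|].
exists (Rmax a (x - d)), (Rmin b (x + d)).
split; [apply Rmax_l|]; split.
{ apply Rmax_lub_lt; apply Rmin_glb_lt; lra. }
split; [apply Rmin_l|].
intros y [Hy1 Hy2] E.
assert (B1 := Rmax_r a (x - d)); assert (B2 := Rmin_r b (x + d)).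
assert (A' : Rabs (f y - f x) < Rabs (f x - 1)) by (apply Hnear, Rabs_def1; lra).
fold (f y) in E; rewrite E, Rabs_minus_sym in A'; lra.
Qed.

Lemma point_avoiding_lattices (g : nat -> R -> R) (n x0 : R) (q : nat) :
  0 < n -> (forall j, cont (g j)) -> (forall j x y, x < y -> g j x < g j y) ->
  exists x, forall j, (j <= q)%nat -> cos (n * (g j x - x0)) <> 1.
Proof.
intros Hn Hc Hg.
assert (H : exists a b, a < b /\ forall x, a < x < b -> forall j, (j <= q)%nat -> cos (n * (g j x - x0)) <> 1).
{ induction q.
  - destruct (interval_avoiding_lattice (g 0%nat) n x0 0 1 Hn (Hc 0%nat) (Hg 0%nat)) as [a [b [_ [Hab [_ H]]]]]; [lra|].
    exists a, b; split; [exact Hab|]; intros x Hx j Hj; replace j with 0%nat by lia; apply H, Hx.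
  - destruct IHq as [a [b [Hab H]]].
    destruct (interval_avoiding_lattice (g (S q)) n x0 a b Hn (Hc (S q)) (Hg (S q)) Hab) as [a' [b' [Ha [Hab' [Hb H']]]]].
    exists a', b'; split; [exact Hab'|]; intros x Hx j Hj.
    destruct (Nat.eq_dec j (S q)) as [-> | Hne]; [apply H', Hx | apply H; [lra | lia]]. }
destruct H as [a [b [Hab H]]]; exists ((a + b) / 2); apply H; lra.
Qed.

Lemma is_lim_seq_bounded_div_INR (d : nat -> R) (K : R) :
  (forall n, Rabs (d n) <= K) -> is_lim_seq (fun n => d n * / INR n) 0.
Proof.
intros H; apply is_lim_seq_abs_0.
assert (A : is_lim_seq (fun n => / INR n) 0).
{ apply (is_lim_seq_inv INR p_infty); [apply is_lim_seq_INR | discriminate]. }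
apply (is_lim_seq_le_le_loc (fun _ => 0) _ (fun n => K * / INR n)).
- exists 1%nat; intros n Hn; split; [apply Rabs_pos|].
  assert (0 < / INR n) by (apply Rinv_0_lt_compat, lt_0_INR; lia).
  rewrite Rabs_mult, (Rabs_pos_eq (/ _)) by lra.
  apply Rmult_le_compat_r; [lra | apply H].
- apply is_lim_seq_const.
- replace (Finite 0) with (Finite (K * 0)) by (f_equal; ring).
  apply is_lim_seq_mult'; [apply is_lim_seq_const | exact A].
Qed.

(** * First variation of the flow *)

Record tame (v v1 v2 v3 : R -> R) (M : R) : Prop := {
  tame_1 : forall x, is_derive v x (v1 x);
  tame_2 : forall x, is_derive v1 x (v2 x);
  tame_3 : forall x, is_derive v2 x (v3 x);
  tame_periodic : periodic_2PI v;
  tame_bound_0 : forall x, Rabs (v x) <= M;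
  tame_bound_1 : forall x, Rabs (v1 x) <= M;
  tame_bound_2 : forall x, Rabs (v2 x) <= M;
  tame_bound_3 : forall x, Rabs (v3 x) <= M }.

Section Flow.

Variables (v v1 v2 v3 : R -> R) (M : R).
Hypothesis hv : tame v v1 v2 v3 M.

Lemma tame_nonneg : 0 <= M.
Proof. generalize (tame_bound_0 _ _ _ _ _ hv 0) (Rabs_pos (v 0)); lra. Qed.

Lemma tame_continuous : cont v.
Proof. apply (derive_cont v v1), hv. Qed.

Lemma tame_continuous_1 : cont v1.
Proof. apply (derive_cont v1 v2), hv. Qed.

Lemma tame_continuous_2 : cont v2.
Proof. apply (derive_cont v2 v3), hv. Qed.

#[local] Hint Resolve tame_continuous tame_continuous_1 tame_continuous_2 : continuity.

Lemma tame_lipschitz (x y : R) : Rabs (v x - v y) <= M * Rabs (x - y).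
Proof. apply (bounded_derive_lipschitz v v1); apply hv. Qed.

Lemma solution_solves (F : R -> R) (s : R) :
  cont F -> is_solution v F (solution v F s).
Proof.
intros HF; apply (solution_is_solution v F M M s tame_continuous HF tame_lipschitz);
  [apply hv | apply tame_nonneg].
Qed.

Lemma solution_start (F : R -> R) (s : R) :
  cont F -> solution v F s 0 = s.
Proof.
intros HF; apply (solution_0 v F M M s tame_continuous HF tame_lipschitz);
  [apply hv | apply tame_nonneg].
Qed.

Lemma solution_cont (F : R -> R) (s : R) :
  cont F -> cont (solution v F s).
Proof. intros HF; apply (derive_cont _ _ (solution_solves F s HF)). Qed.

#[local] Hint Resolve solution_cont : continuity.

Lemma solution_increasing (F : R -> R) (s s' t : R) :
  cont F -> 0 <= t -> s < s' -> solution v F s t < solution v F s' t.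
Proof.
intros HF Ht Hs.
apply (solutions_strictly_ordered_start v M tame_lipschitz F); try apply solution_solves; try assumption.
rewrite !solution_start; assumption.
Qed.

Lemma solution_stable (T : R) : 0 <= T ->
  exists C, 0 < C /\ forall F G s s' eta,
    cont F -> cont G -> 0 <= eta ->
    (forall t, 0 <= t <= T -> Rabs (F t - G t) <= eta) ->
    forall t, 0 <= t <= T ->
    Rabs (solution v F s t - solution v G s' t) <= C * (Rabs (s - s') + eta).
Proof.
intros HT; exists ((1 + T) * exp ((2 * M + 1) * T)); split.
- apply Rmult_lt_0_compat; [lra | apply exp_pos].
- intros F G s s' eta HF HG Heta H t Ht.
  assert (A := gronwall v M tame_lipschitz F G (solution v F s) (solution v G s') T eta
    (solution_solves F s HF) (solution_solves G s' HG) Heta H t Ht).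
  rewrite !solution_start in A by assumption; exact A.
Qed.

Lemma solution_continuous_start (F : R -> R) (t : R) :
  cont F -> 0 <= t -> cont (fun s => solution v F s t).
Proof.
intros HF Ht; destruct (solution_stable t Ht) as [C [HC H]].
apply lipschitz_cont with C; intros x y; rewrite <- (Rplus_0_r (Rabs (x - y))).
apply (H F F x y 0 HF HF (Rle_refl 0)); [|lra].
intros r _; rewrite Rminus_diag, Rabs_R0; lra.
Qed.

Definition log_jacobian (F : R -> R) (s t : R) : R :=
  RInt (fun r => v1 (solution v F s r)) 0 t.

Definition variation (F k : R -> R) (s t : R) : R :=
  exp (log_jacobian F s t) * RInt (fun r => k r * exp (- log_jacobian F s r)) 0 t.

Definition log_jacobian_variation (F k : R -> R) (s t : R) : R :=
  RInt (fun r => v2 (solution v F s r) * variation F k s r) 0 t.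

Lemma v1_solution_continuous (F : R -> R) (s : R) : cont F ->
  cont (fun r => v1 (solution v F s r)).
Proof.
intros HF; solve_continuity.
Qed.

Lemma v2_solution_continuous (F : R -> R) (s : R) : cont F ->
  cont (fun r => v2 (solution v F s r)).
Proof.
intros HF; solve_continuity.
Qed.

Lemma log_jacobian_derive (F : R -> R) (s t : R) : cont F ->
  is_derive (log_jacobian F s) t (v1 (solution v F s t)).
Proof.
intros HF; apply (is_derive_RInt_upper (fun r => v1 (solution v F s r))), v1_solution_continuous, HF.
Qed.

Lemma log_jacobian_continuous (F : R -> R) (s : R) : cont F ->
  cont (log_jacobian F s).
Proof.
intros HF; apply derive_cont with (fun t => v1 (solution v F s t)).
intros t; apply log_jacobian_derive, HF.
Qed.

#[local] Hint Resolve log_jacobian_continuous : continuity.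

Lemma variation_integrand_continuous (F k : R -> R) (s : R) :
  cont F -> cont k ->
  cont (fun r => k r * exp (- log_jacobian F s r)).
Proof.
intros HF Hk; solve_continuity.
Qed.

Lemma variation_derive (F k : R -> R) (s t : R) :
  cont F -> cont k ->
  is_derive (variation F k s) t (v1 (solution v F s t) * variation F k s t + k t).
Proof.
intros HF Hk; unfold variation.
set (u := log_jacobian F s); set (I := fun t => RInt (fun r => k r * exp (- u r)) 0 t).
replace (v1 (solution v F s t) * (exp (u t) * I t) + k t) with
  (v1 (solution v F s t) * exp (u t) * I t + exp (u t) * (k t * exp (- u t))).
2:{ replace (exp (u t) * (k t * exp (- u t))) with (k t * (exp (u t) * exp (- u t))) by ring.
    rewrite <- exp_plus, Rplus_opp_r, exp_0; ring. }
apply (is_derive_mult (fun t => exp (u t)) I).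
- apply (is_derive_comp exp u); [apply is_derive_Reals, derivable_pt_lim_exp | apply log_jacobian_derive, HF].
- apply (is_derive_RInt_upper (fun r => k r * exp (- u r))).
  apply variation_integrand_continuous; assumption.
- intros; apply Rmult_comm.
Qed.

Lemma variation_continuous (F k : R -> R) (s : R) :
  cont F -> cont k -> cont (variation F k s).
Proof.
intros HF Hk.
apply derive_cont with (fun t => v1 (solution v F s t) * variation F k s t + k t).
intros t; apply variation_derive; assumption.
Qed.

#[local] Hint Resolve variation_continuous : continuity.

Lemma log_jacobian_bound (F : R -> R) (s t : R) :
  cont F -> 0 <= t -> Rabs (log_jacobian F s t) <= M * t.
Proof.
intros HF Ht; unfold log_jacobian; rewrite Rmult_comm.
replace (t * M) with ((t - 0) * M) by ring.
apply abs_RInt_le_const; [exact Ht| |intros; apply hv].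
apply ex_RInt_cont, v1_solution_continuous, HF.
Qed.

Lemma exp_le_exp (a b : R) : a <= b -> exp a <= exp b.
Proof. intros [H | ->]; [left; now apply exp_increasing | lra]. Qed.

Lemma variation_bound (F k : R -> R) (s t T K : R) :
  cont F -> cont k ->
  (forall t, 0 <= t <= T -> Rabs (k t) <= K) -> 0 <= t <= T ->
  Rabs (variation F k s t) <= exp (M * T) * (T * (K * exp (M * T))).
Proof.
intros HF Hk HK Ht.
assert (HM := tame_nonneg).
assert (HK0 : 0 <= K) by (generalize (HK t Ht) (Rabs_pos (k t)); lra).
assert (Hu : forall r, 0 <= r <= T -> Rabs (log_jacobian F s r) <= M * T).
{ intros r Hr; apply Rle_trans with (1 := log_jacobian_bound F s r HF (proj1 Hr)).
  apply Rmult_le_compat_l; lra. }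
unfold variation; rewrite Rabs_mult, (Rabs_pos_eq (exp _)) by (left; apply exp_pos).
apply Rmult_le_compat; [left; apply exp_pos | apply Rabs_pos | |].
- apply exp_le_exp; generalize (Hu t Ht) (Rle_abs (log_jacobian F s t)); lra.
- apply Rle_trans with ((t - 0) * (K * exp (M * T))).
  + apply abs_RInt_le_const; [lra | |].
    * apply ex_RInt_cont, variation_integrand_continuous; assumption.
    * intros r Hr; rewrite Rabs_mult, (Rabs_pos_eq (exp _)) by (left; apply exp_pos).
      apply Rmult_le_compat; [apply Rabs_pos | left; apply exp_pos | apply HK; lra |].
      apply exp_le_exp; generalize (Hu r ltac:(lra)) (Rle_abs (- log_jacobian F s r)).
      rewrite Rabs_Ropp; lra.
  + rewrite Rminus_0_r; apply Rmult_le_compat_r; [|lra].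
    apply Rmult_le_pos; [exact HK0 | left; apply exp_pos].
Qed.

Lemma first_variation (T K C0 : R) : 0 <= T -> 0 <= K -> 0 <= C0 ->
  exists C, 0 <= C /\ forall F G k s e,
    cont F -> cont G -> cont k ->
    Rabs e <= 1 -> (forall t, 0 <= t <= T -> Rabs (k t) <= K) ->
    (forall t, 0 <= t <= T -> Rabs (G t - F t - e * k t) <= C0 * e ^ 2) ->
    forall t, 0 <= t <= T ->
      Rabs (solution v G s t - solution v F s t - e * variation F k s t) <= C * e ^ 2 /\
      Rabs (log_jacobian G s t - log_jacobian F s t - e * log_jacobian_variation F k s t)
        <= C * e ^ 2.
Proof.
intros HT HK HC0.
assert (HM := tame_nonneg).
set (K' := exp (M * T) * (T * (K * exp (M * T)))).
assert (HK' : 0 <= K').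
{ apply Rmult_le_pos; [left; apply exp_pos|]; apply Rmult_le_pos; [exact HT|].
  apply Rmult_le_pos; [exact HK | left; apply exp_pos]. }
set (C1 := (1 + T) * exp ((2 * M + 1) * T) * (C0 + M * K' ^ 2)).
assert (HMK : 0 <= M * K' ^ 2) by (apply Rmult_le_pos; [exact HM | apply pow2_ge_0]).
assert (HC1 : 0 <= C1).
{ apply Rmult_le_pos; [|lra]; apply Rmult_le_pos; [lra | left; apply exp_pos]. }
set (C2 := M * (K' + C1) ^ 2 + M * C1).
assert (HC2 : 0 <= C2).
{ apply Rplus_le_le_0_compat; apply Rmult_le_pos; try assumption; apply pow2_ge_0. }
assert (HTC2 : 0 <= T * C2) by (apply Rmult_le_pos; assumption).
exists (C1 + T * C2); split; [lra|].
intros F G k s e HF HG Hk He Hkb HGF.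
assert (Hv := variation_bound F k s).
assert (He2 : 0 <= e ^ 2) by apply pow2_ge_0.
assert (HX : forall t, 0 <= t <= T ->
  Rabs (solution v G s t - solution v F s t - e * variation F k s t) <= C1 * e ^ 2).
{ intros t Ht.
  set (y := fun r => solution v F s r + e * variation F k s r).
  set (Fy := fun r => F r + e * k r -
     (v (y r) - v (solution v F s r) - v1 (solution v F s r) * (y r - solution v F s r))).
  assert (Hy : is_solution v Fy y).
  { intros r; unfold Fy.
    replace (v (y r) + _) with ((v (solution v F s r) + F r) +
      e * (v1 (solution v F s r) * variation F k s r + k r)) by (unfold y; ring).
    apply @is_derive_plus; [apply solution_solves, HF|].
    apply (is_derive_scal (variation F k s)), variation_derive; assumption. }
  assert (A := gronwall v M tame_lipschitz G Fy (solution v G s) y T ((C0 + M * K' ^ 2) * e ^ 2)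
    (solution_solves G s HG) Hy).
  assert (y0 : y 0 = s).
  { unfold y, variation; rewrite solution_start, RInt_point by exact HF; unfold zero; simpl; ring. }
  rewrite y0, solution_start, Rminus_diag, Rabs_R0, Rplus_0_l in A by exact HG.
  replace (solution v G s t - solution v F s t - e * variation F k s t) with
    (solution v G s t - y t) by (unfold y; ring).
  unfold C1; rewrite Rmult_assoc; apply A; [| |exact Ht].
  - apply Rmult_le_pos; lra.
  - intros r Hr; unfold Fy.
    replace (G r - _) with ((G r - F r - e * k r) +
      (v (y r) - v (solution v F s r) - v1 (solution v F s r) * (y r - solution v F s r))) by ring.
    apply Rle_trans with (1 := Rabs_triang _ _).
    assert (B1 := HGF r Hr).
    assert (B2 := taylor_quadratic_bound v v1 v2 M (tame_1 _ _ _ _ _ hv) (tame_2 _ _ _ _ _ hv)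
      (tame_bound_2 _ _ _ _ _ hv) (solution v F s r) (y r)).
    assert (B3 : (y r - solution v F s r) ^ 2 <= K' ^ 2 * e ^ 2).
    { replace (y r - solution v F s r) with (e * variation F k s r) by (unfold y; ring).
      rewrite Rpow_mult_distr, (Rmult_comm (K' ^ 2)); apply Rmult_le_compat_l; [exact He2|].
      rewrite <- pow2_abs; apply pow_incr; split; [apply Rabs_pos|].
      apply (Hv r T K HF Hk Hkb Hr). }
    assert (M * (y r - solution v F s r) ^ 2 <= M * (K' ^ 2 * e ^ 2))
      by (apply Rmult_le_compat_l; assumption).
    lra. }
intros t Ht; split.
- apply Rle_trans with (1 := HX t Ht); apply Rmult_le_compat_r; lra.
- assert (c1 := v1_solution_continuous G s HG); assert (c2 := v1_solution_continuous F s HF).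
  assert (c3 := v2_solution_continuous F s HF); assert (c4 := variation_continuous F k s HF Hk).
  assert (c5 : cont (fun r => v2 (solution v F s r) * variation F k s r)) by solve_continuity.
  assert (c6 : cont (fun r => v1 (solution v G s r) - v1 (solution v F s r))) by solve_continuity.
  assert (c7 : cont (fun r => e * (v2 (solution v F s r) * variation F k s r))) by solve_continuity.
  assert (E : log_jacobian G s t - log_jacobian F s t - e * log_jacobian_variation F k s t =
    RInt (fun r => (v1 (solution v G s r) - v1 (solution v F s r)) -
                    e * (v2 (solution v F s r) * variation F k s r)) 0 t).
  { unfold log_jacobian, log_jacobian_variation; symmetry.
    etransitivity; [apply @RInt_minus; apply ex_RInt_cont; assumption|].
    unfold minus at 1; apply (f_equal2 Rplus).
    - apply @RInt_minus; apply ex_RInt_cont; assumption.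
    - apply f_equal; apply (RInt_scal (fun r => v2 (solution v F s r) * variation F k s r) 0 t e).
      apply ex_RInt_cont; assumption. }
  rewrite E.
  apply Rle_trans with ((t - 0) * (C2 * e ^ 2)).
  + apply abs_RInt_le_const; [lra| |].
    * apply ex_RInt_cont.
      solve_continuity.
    * intros r Hr.
      set (a := solution v F s r) in *; set (b := solution v G s r) in *; set (x := variation F k s r) in *.
      replace (v1 b - v1 a - e * (v2 a * x)) with
        ((v1 b - v1 a - v2 a * (b - a)) + v2 a * (b - a - e * x)) by ring.
      apply Rle_trans with (1 := Rabs_triang _ _).
      assert (B1 : Rabs (b - a - e * x) <= C1 * e ^ 2) by (apply HX; lra).
      assert (B2 := taylor_quadratic_bound v1 v2 v3 M (tame_2 _ _ _ _ _ hv) (tame_3 _ _ _ _ _ hv)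
        (tame_bound_3 _ _ _ _ _ hv) a b).
      assert (B3 : Rabs (v2 a * (b - a - e * x)) <= M * (C1 * e ^ 2)).
      { rewrite Rabs_mult; apply Rmult_le_compat; try apply Rabs_pos; [apply hv | exact B1]. }
      assert (B4 : (b - a) ^ 2 <= (K' + C1) ^ 2 * e ^ 2).
      { rewrite <- (pow2_abs e), <- Rpow_mult_distr, <- pow2_abs.
        apply pow_incr; split; [apply Rabs_pos|].
        replace (b - a) with (e * x + (b - a - e * x)) by ring.
        apply Rle_trans with (1 := Rabs_triang _ _); rewrite Rabs_mult.
        assert (Rabs x <= K') by (apply (Hv r T K HF Hk Hkb); lra).
        rewrite <- (pow2_abs e) in B1.
        assert (P := Rabs_pos e).
        assert (Rabs e * Rabs x <= Rabs e * K') by (apply Rmult_le_compat_l; assumption).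
        assert (Rabs e ^ 2 <= Rabs e) by (simpl; nra).
        assert (C1 * Rabs e ^ 2 <= C1 * Rabs e) by (apply Rmult_le_compat_l; assumption).
        lra. }
      assert (M * (b - a) ^ 2 <= M * ((K' + C1) ^ 2 * e ^ 2)) by (apply Rmult_le_compat_l; assumption).
      unfold C2; lra.
  + assert (0 <= C2 * e ^ 2) by (apply Rmult_le_pos; assumption).
    assert (t * (C2 * e ^ 2) <= T * (C2 * e ^ 2)) by (apply Rmult_le_compat_r; lra).
    assert (0 <= C1 * e ^ 2) by (apply Rmult_le_pos; assumption).
    lra.
Qed.

(** * Robust rotation numbers *)

Variables (p : Z) (q : nat).

(* The denominator of the rotation number is [S q]. *)
Let T := 2 * PI * INR (S q).

Definition robust (F : R -> R) : Prop :=
  exists s1 s2, s1 + 2 * PI * IZR p < solution v F s1 (2 * PI * INR (S q)) /\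
                solution v F s2 (2 * PI * INR (S q)) < s2 + 2 * PI * IZR p.

Lemma period_pos : 0 < 2 * PI * INR (S q).
Proof. apply Rmult_lt_0_compat; [generalize PI_RGT_0; lra | apply lt_0_INR; lia]. Qed.

Lemma robust_stable (F : R -> R) : cont F -> robust F ->
  exists d, 0 < d /\ forall G, cont G ->
    (forall t, Rabs (G t - F t) <= d) -> robust G.
Proof.
intros HF [s1 [s2 [H1 H2]]]; assert (HT := period_pos).
destruct (solution_stable T) as [C [HC Hs]]; [unfold T; lra|].
set (g := Rmin (solution v F s1 T - (s1 + 2 * PI * IZR p)) (s2 + 2 * PI * IZR p - solution v F s2 T)).
assert (Hg : 0 < g) by (apply Rmin_pos; unfold T; lra).
exists (g / (2 * C)); split; [apply Rdiv_lt_0_compat; lra|].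
intros G HG HFG.
assert (B : forall s, Rabs (solution v F s T - solution v G s T) <= g / 2).
{ intros s; apply Rle_trans with (C * (Rabs (s - s) + g / (2 * C))).
  - apply Hs; try assumption; [left; apply Rdiv_lt_0_compat; lra| |unfold T; lra].
    intros t _; rewrite Rabs_minus_sym; apply HFG.
  - rewrite Rminus_diag, Rabs_R0; right; field; lra. }
exists s1, s2; fold T.
assert (g <= solution v F s1 T - (s1 + 2 * PI * IZR p)) by apply Rmin_l.
assert (g <= s2 + 2 * PI * IZR p - solution v F s2 T) by apply Rmin_r.
assert (B1 := B s1); assert (B2 := B s2).
apply Rabs_le_between in B1; apply Rabs_le_between in B2; lra.
Qed.

Lemma robust_periodic_point (F : R -> R) : cont F -> robust F ->
  exists s, solution v F s (2 * PI * INR (S q)) = s + 2 * PI * IZR p.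
Proof.
intros HF [s1 [s2 [H1 H2]]]; assert (HT := period_pos).
set (g := fun s => solution v F s T - s).
destruct (IVT_gen g s1 s2 (2 * PI * IZR p)) as [s [_ Hs]].
- apply cont_continuity.
  assert (Hc := solution_continuous_start F T HF ltac:(unfold T; lra)); unfold g; solve_continuity.
- unfold g, T; rewrite Rmin_right, Rmax_left by lra; lra.
- exists s; unfold g, T in Hs; lra.
Qed.

Lemma rotation_number_of_periodic_point (f : R -> R) (A B s : R) :
  cont f -> periodic_2PI f ->
  solution v (fun t => A + B * f t) s (2 * PI * INR (S q)) = s + 2 * PI * IZR p ->
  is_rotation_number (Defs.family v f A B) (IZR p / INR (S q)).
Proof.
intros Hfc Hfp Hs; assert (HT := period_pos); fold T in Hs.
set (F := fun t => A + B * f t) in *.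
assert (HF : cont F).
{ unfold F; solve_continuity. }
assert (HFr : forall r, cont (fun t => F (r + t))) by (intros; solve_continuity).
exists (fun r t x => solution v (fun t => F (r + t)) x t); split.
- intros r x; split; [apply solution_start, HFr|].
  intros t.
  assert (D := solution_solves (fun t => F (r + t)) x (HFr r) t).
  unfold Defs.family; rewrite Rplus_assoc; exact D.
- intros r x.
  set (Y := solution v F s).
  assert (HY : is_solution v F Y) by (apply solution_solves, HF).
  assert (Yper : forall t, Y (T + t) = Y t + 2 * PI * IZR p).
  { apply (is_solution_unique v F (fun t => Y (T + t)) (fun t => Y t + 2 * PI * IZR p) M 0).
    - apply tame_lipschitz.
    - intros t; generalize (is_solution_shift v F Y T HY t).
      replace (F (T + t)) with (F t); [trivial|].
      unfold F, T; rewrite (Rplus_comm _ t), periodic_shift_nat by exact Hfp; reflexivity.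
    - apply is_solution_translate; [apply hv | exact HY].
    - rewrite Rplus_0_r; unfold Y; rewrite Hs, solution_start by exact HF; reflexivity. }
  set (rho := IZR p / INR (S q)).
  assert (Hq : 0 < INR (S q)) by (apply lt_0_INR; lia).
  assert (Hpi := PI_RGT_0).
  destruct (periodic_bounded (fun x => Y (INR (S q) * x) - rho * (INR (S q) * x))) as [K [HK HKb]].
  { unfold Y; solve_continuity. }
  { intros y; replace (INR (S q) * (y + 2 * PI)) with (T + INR (S q) * y) by (unfold T; ring).
    rewrite Yper; unfold rho, T; field; lra. }
  destruct (periodic_representative (x - Y r)) as [k Hk].
  set (J := 2 * PI * (Rabs (IZR k) + 1)).
  assert (Hgap : forall t, 0 <= t -> Rabs (solution v (fun t => F (r + t)) x t - Y (r + t)) <= J).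
  { intros t Ht.
    assert (HYr := is_solution_shift v F Y r HY).
    assert (HX := solution_solves (fun t => F (r + t)) x (HFr r)).
    assert (Hk1 := is_solution_translate v _ _ (- k) (tame_periodic _ _ _ _ _ hv) HYr).
    assert (Hk2 := is_solution_translate v _ _ (1 - k) (tame_periodic _ _ _ _ _ hv) HYr).
    assert (O1 := solutions_ordered v M tame_lipschitz _ _ _ _ t Hk1 HX
      (fun _ _ => Rle_refl _)).
    assert (O2 := solutions_ordered v M tame_lipschitz _ _ _ _ t HX Hk2
      (fun _ _ => Rle_refl _)).
    cbv beta in O1, O2.
    rewrite solution_start, Rplus_0_r, ?opp_IZR in O1 by apply HFr.
    rewrite solution_start, Rplus_0_r, minus_IZR in O2 by apply HFr.
    assert (O1' := O1 ltac:(lra) t ltac:(lra)); assert (O2' := O2 ltac:(nra) t ltac:(lra)).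
    unfold J; apply Rabs_le_between.
    assert (Q1 := Rle_abs (IZR k)); assert (Q2 := Rle_abs (- IZR k)); rewrite Rabs_Ropp in Q2.
    split; nra. }
  set (d := fun n => solution v (fun t => F (r + t)) x (2 * PI * INR n) - rho * (2 * PI * INR n)).
  assert (Hd : forall n, Rabs (d n) <= J + K + Rabs (rho * r)).
  { intros n; unfold d.
    assert (Hn : 0 <= 2 * PI * INR n) by (apply Rmult_le_pos; [lra | apply pos_INR]).
    replace (solution v (fun t => F (r + t)) x (2 * PI * INR n) - rho * (2 * PI * INR n)) with
     ((solution v (fun t => F (r + t)) x (2 * PI * INR n) - Y (r + 2 * PI * INR n)) +
      (Y (r + 2 * PI * INR n) - rho * (r + 2 * PI * INR n)) + rho * r) by ring.
    assert (B1 := Hgap _ Hn).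
    assert (B2 := HKb ((r + 2 * PI * INR n) / INR (S q))).
    replace (INR (S q) * ((r + 2 * PI * INR n) / INR (S q))) with (r + 2 * PI * INR n) in B2 by (field; lra).
    apply Rle_trans with (1 := Rabs_triang _ _), Rplus_le_compat_r.
    apply Rle_trans with (1 := Rabs_triang _ _); lra. }
  apply is_lim_seq_ext_loc with (fun n => rho + / (2 * PI) * (d n * / INR n)).
  + exists 1%nat; intros n Hn; unfold d.
    assert (0 < INR n) by (apply lt_0_INR; lia).
    field; split; lra.
  + replace (Finite rho) with (Finite (rho + / (2 * PI) * 0)) by (f_equal; ring).
    apply is_lim_seq_plus'; [apply is_lim_seq_const|].
    apply is_lim_seq_mult'; [apply is_lim_seq_const|].
    apply is_lim_seq_bounded_div_INR with (1 := Hd).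
Qed.

Lemma robust_phase_lock_area (f0 : R -> R) (A : R) :
  cont f0 -> robust (fun t => A + f0 t) ->
  exists d, 0 < d /\ forall f, cont f -> periodic_2PI f ->
    (forall t, Rabs (f t - f0 t) <= d) -> has_phase_lock_area v f (IZR p / INR (S q)).
Proof.
intros Hf0 HR.
destruct (robust_stable (fun t => A + f0 t)) as [d [Hd Hst]]; [|exact HR|].
{ solve_continuity. }
exists (d / 2); split; [lra|].
intros f Hfc Hfp Hff.
destruct (periodic_bounded f Hfc Hfp) as [K [HK HKb]].
exists (A, 1).
assert (He : 0 < d / (4 * (K + 1))) by (apply Rdiv_lt_0_compat; lra).
exists (mkposreal _ He); intros [A' B'] [HA HB]; unfold ball in *; simpl in *.
unfold AbsRing_ball, abs, minus, plus, opp in *; simpl in HA, HB.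
unfold rotation_level_set; simpl.
assert (HG : cont (fun t => A' + B' * f t)) by solve_continuity.
destruct (robust_periodic_point _ HG) as [s Hs].
- apply Hst; [exact HG|]; intros t.
  replace (A' + B' * f t - (A + f0 t)) with ((A' + - A) + (B' + - (1)) * f t + (f t - f0 t)) by ring.
  assert (E : d / (4 * (K + 1)) * (K + 1) = d / 4) by (field; lra).
  set (e := d / (4 * (K + 1))) in *.
  assert (Rabs ((B' + - (1)) * f t) <= e * K).
  { rewrite Rabs_mult; apply Rmult_le_compat; try apply Rabs_pos; [lra | apply HKb]. }
  apply Rle_trans with (1 := Rabs_triang _ _).
  generalize (Hff t) (Rabs_triang (A' + - A) ((B' + - (1)) * f t)); nra.
- apply rotation_number_of_periodic_point with s; assumption.
Qed.

(** * Forcings with only periodic orbits *)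

(* Such a [U] does not exist if [v] has two harmonics: see [no_fragile_family]. *)
Variable U : (R -> R) -> Prop.
Hypothesis U_continuous : forall F, U F -> cont F.
Hypothesis U_periodic : forall F, U F -> periodic_2PI F.
Hypothesis U_const : forall F c, U F -> U (fun t => F t + c).
Hypothesis U_open : forall F h, U F -> test_function h ->
  exists d, 0 < d /\ forall e, Rabs e < d -> U (fun t => F t + e * h t).
Hypothesis U_fragile : forall F, U F -> ~ robust F.

Definition rigid (F : R -> R) : Prop := forall s, solution v F s T = s + 2 * PI * IZR p.

Lemma T_pos : 0 < T.
Proof. apply period_pos. Qed.

Lemma solution_time_T_of_const (F : R -> R) (s y : R) : U F ->
  exists c, solution v (fun t => F t + c) s T = y.
Proof.
intros HU; assert (HF := U_continuous F HU); assert (HT := T_pos).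
destruct (periodic_bounded F HF (U_periodic F HU)) as [K [HK HKb]].
set (g := fun c => solution v (fun t => F t + c) s T).
assert (Hg : cont g).
{ destruct (solution_stable T ltac:(lra)) as [C [HC Hs]].
  apply lipschitz_cont with C; intros a b.
  replace (C * Rabs (a - b)) with (C * (Rabs (s - s) + Rabs (a - b))) by (rewrite Rminus_diag, Rabs_R0; ring).
  apply Hs; try solve_continuity; [apply Rabs_pos| |lra].
  intros t _; right; f_equal; ring. }
assert (Hb : forall c, (c - M - K) * T <= g c - s <= (c + M + K) * T).
{ intros c; unfold g.
  destruct (mean_value (solution v (fun t => F t + c) s)
    (fun t => v (solution v (fun t => F t + c) s t) + (F t + c)) 0 T) as [x [_ E]].
  { intros x _; apply (solution_solves (fun t => F t + c) s), continuous_plus_const, HF. }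
  rewrite (solution_start (fun t => F t + c)) in E by solve_continuity.
  rewrite E, Rminus_0_r.
  assert (B1 := tame_bound_0 _ _ _ _ _ hv (solution v (fun t => F t + c) s x)).
  assert (B2 := HKb x); apply Rabs_le_between in B1; apply Rabs_le_between in B2.
  split; apply Rmult_le_compat_r; lra. }
set (B := (Rabs (y - s)) / T).
assert (HB : B * T = Rabs (y - s)) by (unfold B; field; lra).
assert (B1 := Rle_abs (y - s)); assert (B2 := Rle_abs (- (y - s))); rewrite Rabs_Ropp in B2.
destruct (IVT_gen g (- (M + K) - B) (M + K + B) y) as [c [_ Hc]].
- apply cont_continuity, Hg.
- assert (A1 := proj2 (Hb (- (M + K) - B))); assert (A2 := proj1 (Hb (M + K + B))).
  replace ((- (M + K) - B + M + K) * T) with (- (B * T)) in A1 by ring.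
  replace ((M + K + B - M - K) * T) with (B * T) in A2 by ring.
  rewrite Rmin_left, Rmax_right by lra; lra.
- exists c; exact Hc.
Qed.

Lemma rigid_after_const (F : R -> R) : U F -> exists c, rigid (fun t => F t + c).
Proof.
intros HU; assert (HF := U_continuous F HU); assert (HT := T_pos).
destruct (solution_time_T_of_const F 0 (2 * PI * IZR p) HU) as [c Hc].
exists c; intros s; apply NNPP; intros Hne.
destruct (solution_stable T ltac:(lra)) as [C [HC Hs]].
set (d := solution v (fun t => F t + c) s T - (s + 2 * PI * IZR p)).
assert (Hd : d <> 0) by (unfold d; lra).
set (e := Rabs d / (2 * C)).
assert (He : 0 < e) by (apply Rdiv_lt_0_compat; [now apply Rabs_pos_lt | lra]).
assert (Hst : forall a, Rabs (a - c) <= e ->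
  Rabs (solution v (fun t => F t + c) s T - solution v (fun t => F t + a) s T) <= Rabs d / 2).
{ intros a Ha.
  replace (Rabs d / 2) with (C * (Rabs (s - s) + e))
    by (unfold e; rewrite Rminus_diag, Rabs_R0; field; lra).
  apply Hs; try apply continuous_plus_const; try assumption; try lra.
  intros t _; replace (F t + c - (F t + a)) with (- (a - c)) by ring; rewrite Rabs_Ropp; exact Ha. }
assert (Hmono : forall a b, a < b ->
  solution v (fun t => F t + a) 0 T < solution v (fun t => F t + b) 0 T).
{ intros a b Hab.
  apply (solutions_strictly_ordered_forcing v M tame_lipschitz
    (fun t => F t + a) (fun t => F t + b)); try apply solution_solves;
    try apply continuous_plus_const; try assumption; [intros; lra|].
  rewrite !solution_start by solve_continuity; lra. }
destruct (Rdichotomy _ _ Hd) as [Hneg | Hpos].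
- assert (A := Hst (c + e) ltac:(replace (c + e - c) with e by ring; rewrite Rabs_pos_eq; lra)).
  rewrite (Rabs_left d Hneg) in A; apply Rabs_le_between in A.
  apply (U_fragile (fun t => F t + (c + e)) (U_const F (c + e) HU)).
  exists 0, s; fold T; split.
  + generalize (Hmono c (c + e) ltac:(lra)); lra.
  + unfold d in *; lra.
- assert (A := Hst (c - e) ltac:(replace (c - e - c) with (- e) by ring; rewrite Rabs_Ropp, Rabs_pos_eq; lra)).
  rewrite (Rabs_pos_eq d) in A by lra; apply Rabs_le_between in A.
  apply (U_fragile (fun t => F t + (c - e)) (U_const F (c - e) HU)).
  exists s, 0; fold T; split.
  + unfold d in *; lra.
  + generalize (Hmono (c - e) c ltac:(lra)); lra.
Qed.

Lemma rigid_near (F h : R -> R) (K : R) : U F -> rigid F -> test_function h ->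
  (forall t, Rabs (h t) <= K) ->
  exists d c, 0 < d /\ forall e, Rabs e < d ->
    U (fun t => F t + e * h t + c e) /\ rigid (fun t => F t + e * h t + c e) /\ Rabs (c e) <= Rabs e * K.
Proof.
intros HU Hex Hh HK; assert (HF := U_continuous F HU); assert (HT := T_pos).
destruct (U_open F h HU Hh) as [d [Hd HUd]].
assert (Hc : forall e, exists c, Rabs e < d ->
   U (fun t => F t + e * h t + c) /\ rigid (fun t => F t + e * h t + c) /\ Rabs c <= Rabs e * K).
{ intros e; destruct (Rlt_dec (Rabs e) d) as [He | He]; [|exists 0; intros; contradiction].
  destruct (rigid_after_const (fun t => F t + e * h t) (HUd e He)) as [c Hc].
  exists c; intros _; assert (HU' := U_const _ c (HUd e He)).
  split; [exact HU'|]; split; [exact Hc|].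
  assert (HF' := U_continuous _ HU').
  assert (Hb : forall t, Rabs (e * h t) <= Rabs e * K).
  { intros t; rewrite Rabs_mult; apply Rmult_le_compat_l; [apply Rabs_pos | apply HK]. }
  apply Rnot_lt_le; intros Hlt.
  set (G := fun t => F t + e * h t + c) in *.
  assert (E1 := Hex 0); assert (E2 := Hc 0).
  unfold Rabs at 2 in Hlt; destruct (Rcase_abs c) as [Hc0 | Hc0].
  - assert (solution v G 0 T < solution v F 0 T); [|lra].
    apply (solutions_strictly_ordered_forcing v M tame_lipschitz G F);
      try apply solution_solves; try assumption.
    + intros t _; generalize (Hb t); intros B; apply Rabs_le_between in B; unfold G; lra.
    + rewrite !solution_start by assumption; lra.
  - assert (solution v F 0 T < solution v G 0 T); [|lra].
    apply (solutions_strictly_ordered_forcing v M tame_lipschitz F G);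
      try apply solution_solves; try assumption.
    + intros t _; generalize (Hb t); intros B; apply Rabs_le_between in B; unfold G; lra.
    + rewrite !solution_start by assumption; lra. }
destruct (choice _ _ _ Hc) as [c Hcc].
exists d, c; split; [exact Hd | exact Hcc].
Qed.

Definition jac_inv (F : R -> R) (s t : R) : R := exp (- log_jacobian F s t).

Definition total_weight (F : R -> R) (s : R) : R := RInt (jac_inv F s) 0 T.

Lemma jac_inv_continuous (F : R -> R) (s : R) : cont F ->
  cont (jac_inv F s).
Proof.
intros HF; unfold jac_inv; solve_continuity.
Qed.

#[local] Hint Resolve jac_inv_continuous : continuity.

Lemma jac_inv_derive (F : R -> R) (s t : R) : cont F ->
  is_derive (jac_inv F s) t (- v1 (solution v F s t) * jac_inv F s t).
Proof.
intros HF; apply (is_derive_comp exp (fun t => - log_jacobian F s t)).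
- apply is_derive_Reals, derivable_pt_lim_exp.
- apply @is_derive_opp, (log_jacobian_derive), HF.
Qed.

Lemma jac_inv_bounds (F : R -> R) (s t : R) : cont F -> 0 <= t <= T ->
  exp (- (M * T)) <= jac_inv F s t <= exp (M * T).
Proof.
intros HF Ht; assert (B := log_jacobian_bound F s t HF (proj1 Ht)).
assert (HM := tame_nonneg).
assert (M * t <= M * T) by (apply Rmult_le_compat_l; lra).
apply Rabs_le_between in B; split; apply exp_le_exp; lra.
Qed.

Lemma total_weight_lower (F : R -> R) (s : R) : cont F ->
  T * exp (- (M * T)) <= total_weight F s.
Proof.
intros HF; assert (HT := T_pos).
replace (T * exp (- (M * T))) with ((T - 0) * exp (- (M * T))) by ring.
apply RInt_ge_const; [lra | apply jac_inv_continuous, HF|].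
intros t Ht; apply jac_inv_bounds; [exact HF | lra].
Qed.

Lemma total_weight_pos (F : R -> R) (s : R) : cont F -> 0 < total_weight F s.
Proof.
intros HF; apply Rlt_le_trans with (2 := total_weight_lower F s HF).
apply Rmult_lt_0_compat; [apply T_pos | apply exp_pos].
Qed.

Lemma variation_plus_const (F h : R -> R) (c s t : R) :
  cont F -> cont h ->
  variation F (fun r => h r + c) s t =
  exp (log_jacobian F s t) * (RInt (fun r => h r * jac_inv F s r) 0 t + c * RInt (jac_inv F s) 0 t).
Proof.
intros HF Hh; unfold variation; f_equal.
assert (cJ := jac_inv_continuous F s HF).
rewrite <- RInt_scal_continuous, <- RInt_plus_continuous.
- apply RInt_ext; intros r _; unfold jac_inv; ring_over_R.
- solve_continuity.
- solve_continuity.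
- exact cJ.
Qed.

Lemma rigid_family (F h : R -> R) : U F -> rigid F -> test_function h ->
  exists d C c, 0 < d /\ 0 <= C /\ forall e, Rabs e < d ->
    U (fun t => F t + e * h t + c e) /\ rigid (fun t => F t + e * h t + c e) /\
    forall s, Rabs (e * RInt (fun r => h r * jac_inv F s r) 0 T + c e * total_weight F s) <= C * e ^ 2.
Proof.
intros HU Hex Hh; assert (HF := U_continuous F HU); assert (HT := T_pos).
assert (Hhc := test_function_continuous h Hh).
destruct Hh as [Hhp [K HK]].
assert (HKb := unit_analytic_bound h K HK).
assert (HK0 : 0 <= K) by (generalize (HKb 0) (Rabs_pos (h 0)); lra).
destruct (rigid_near F h K HU Hex (conj Hhp (ex_intro _ K HK)) HKb) as [d [c [Hd Hc]]].
destruct (first_variation T (2 * K) 0 ltac:(lra) ltac:(lra) ltac:(lra)) as [C [HC Hfv]].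
exists (Rmin d 1), (C * exp (M * T)), c.
split; [apply Rmin_pos; lra|]; split; [apply Rmult_le_pos; [exact HC | left; apply exp_pos]|].
intros e He.
assert (Hed : Rabs e < d) by (apply Rlt_le_trans with (1 := He), Rmin_l).
assert (He1 : Rabs e < 1) by (apply Rlt_le_trans with (1 := He), Rmin_r).
destruct (Hc e Hed) as [HU' [Hex' Hce]].
split; [exact HU'|]; split; [exact Hex'|]; intros s.
destruct (Req_dec e 0) as [-> | He0].
{ rewrite Rabs_R0, Rmult_0_l in Hce.
  assert (c 0 = 0).
  { destruct (Req_dec (c 0) 0) as [E | E]; [exact E|]; generalize (Rabs_pos_lt _ E); lra. }
  rewrite H, !Rmult_0_l, Rplus_0_l, Rabs_R0; simpl; rewrite Rmult_0_l; lra. }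
set (k := fun t => h t + c e / e).
assert (Hk : cont k) by (apply continuous_plus_const, Hhc).
assert (HeK : Rabs (c e / e) <= K).
{ unfold Rdiv; rewrite Rabs_mult, Rabs_inv.
  apply Rmult_le_reg_r with (Rabs e); [now apply Rabs_pos_lt|].
  rewrite Rmult_assoc, Rinv_l, Rmult_1_r by now apply Rabs_no_R0.
  rewrite Rmult_comm; exact Hce. }
destruct (Hfv F (fun t => F t + e * h t + c e) k s e HF (U_continuous _ HU') Hk ltac:(lra)) with (t := T) as [A _].
- intros t _; unfold k; apply Rle_trans with (1 := Rabs_triang _ _); generalize (HKb t); lra.
- intros t _; right; unfold k.
  replace (F t + e * h t + c e - F t - e * (h t + c e / e)) with 0 by (field; exact He0).
  rewrite Rabs_R0; ring.
- lra.
- fold T in A; rewrite (Hex' s), (Hex s) in A.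
  unfold k in A; rewrite variation_plus_const in A by assumption.
  fold (total_weight F s) in A.
  set (I := RInt (fun r => h r * jac_inv F s r) 0 T) in *.
  set (W := total_weight F s) in *.
  assert (EJ := jac_inv_bounds F s T HF ltac:(lra)).
  assert (E2 : exp (log_jacobian F s T) * jac_inv F s T = 1)
    by (unfold jac_inv; rewrite <- exp_plus, Rplus_opp_r; apply exp_0).
  replace (e * I + c e * W) with
    ((e * (exp (log_jacobian F s T) * (I + c e / e * W))) * jac_inv F s T).
  2:{ replace (e * (exp (log_jacobian F s T) * (I + c e / e * W)) * jac_inv F s T) with
       ((exp (log_jacobian F s T) * jac_inv F s T) * (e * I + c e * W)) by (field; exact He0).
      rewrite E2; ring. }
  rewrite Rabs_mult, (Rabs_pos_eq (jac_inv F s T)) by (left; apply exp_pos).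
  replace (C * exp (M * T) * e ^ 2) with (C * e ^ 2 * exp (M * T)) by ring.
  apply Rmult_le_compat; [apply Rabs_pos | left; apply exp_pos | | apply EJ].
  rewrite <- Rabs_Ropp.
  replace (- (e * (exp (log_jacobian F s T) * (I + c e / e * W)))) with
   (s + 2 * PI * IZR p - (s + 2 * PI * IZR p) - e * (exp (log_jacobian F s T) * (I + c e / e * W))) by ring.
  exact A.
Qed.

Lemma weighted_integral_proportional (F h : R -> R) (s s' : R) :
  U F -> rigid F -> test_function h ->
  RInt (fun r => h r * jac_inv F s r) 0 T * total_weight F s' =
  RInt (fun r => h r * jac_inv F s' r) 0 T * total_weight F s.
Proof.
intros HU Hex Hh; assert (HF := U_continuous F HU).
destruct (rigid_family F h HU Hex Hh) as [d [C [c [Hd [HC H]]]]].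
set (I := RInt (fun r => h r * jac_inv F s r) 0 T).
set (I' := RInt (fun r => h r * jac_inv F s' r) 0 T).
assert (W := total_weight_pos F s HF); assert (W' := total_weight_pos F s' HF).
set (w := total_weight F s) in *; set (w' := total_weight F s') in *.
apply NNPP; intros Hne.
set (x := Rabs (I * w' - I' * w)).
assert (Hx : 0 < x) by (apply Rabs_pos_lt; lra).
set (B := C * (w + w')).
assert (HB : 0 <= B) by (apply Rmult_le_pos; lra).
set (e := Rmin (d / 2) (x / (2 * (B + 1)))).
assert (He : 0 < e) by (apply Rmin_pos; [lra | apply Rdiv_lt_0_compat; lra]).
assert (He1 : e <= d / 2) by apply Rmin_l.
assert (He2 : e <= x / (2 * (B + 1))) by apply Rmin_r.
destruct (H e ltac:(rewrite Rabs_pos_eq; lra)) as [_ [_ Hs]].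
assert (A1 := Hs s); assert (A2 := Hs s'); fold I w in A1; fold I' w' in A2.
assert (A : e * x <= B * e ^ 2).
{ unfold x; rewrite <- (Rabs_pos_eq e) at 1 by lra; rewrite <- Rabs_mult.
  replace (e * (I * w' - I' * w)) with ((e * I + c e * w) * w' - (e * I' + c e * w') * w) by ring.
  apply Rle_trans with (1 := Rabs_triang _ _); rewrite Rabs_Ropp, !Rabs_mult.
  rewrite (Rabs_pos_eq w), (Rabs_pos_eq w') by lra.
  assert (Rabs (e * I + c e * w) * w' <= C * e ^ 2 * w') by (apply Rmult_le_compat_r; lra).
  assert (Rabs (e * I' + c e * w') * w <= C * e ^ 2 * w) by (apply Rmult_le_compat_r; lra).
  unfold B; lra. }
assert (x <= B * e) by (apply Rmult_le_reg_l with e; [exact He|]; simpl in A; lra).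
assert ((B + 1) * e <= x / 2).
{ replace (x / 2) with ((B + 1) * (x / (2 * (B + 1)))) by (field; lra).
  apply Rmult_le_compat_l; lra. }
lra.
Qed.

(** * Weighted sums over periodic orbits *)

Notation X := (solution v).

(* The sum over the [S q] points of the orbit of [s] under the Poincare map, transported to
   time [t], of [w] weighted by the inverse Jacobian of the flow. *)
Definition orbit_sum (w F : R -> R) (s t : R) : R :=
  sum_n (fun j => w (X F s (t + 2 * PI * INR j)) * jac_inv F s (t + 2 * PI * INR j)) q.

Lemma sum_n_lin (a b : R) (f g : nat -> R) (n : nat) :
  sum_n (fun j => a * f j + b * g j) n = a * sum_n f n + b * sum_n g n.
Proof. induction n; [now rewrite !sum_O | rewrite !sum_Sn, IHn; unfold plus; simpl; ring_over_R]. Qed.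

Lemma orbit_sum_lin (a b : R) (w w' F : R -> R) (s t : R) :
  orbit_sum (fun x => a * w x + b * w' x) F s t = a * orbit_sum w F s t + b * orbit_sum w' F s t.
Proof. unfold orbit_sum; rewrite <- sum_n_lin; apply sum_n_ext; intros j; ring_over_R. Qed.

Lemma orbit_sum_ext (w w' F : R -> R) (s t : R) :
  (forall x, w x = w' x) -> orbit_sum w F s t = orbit_sum w' F s t.
Proof. intros E; apply sum_n_ext; intros j; now rewrite E. Qed.

Lemma sum_n_pos (f : nat -> R) (n : nat) : (forall j, 0 < f j) -> 0 < sum_n f n.
Proof.
intros H; induction n; [rewrite sum_O; apply H | rewrite sum_Sn; unfold plus; simpl; generalize (H (S n)); lra].
Qed.

Lemma orbit_sum_1_pos (F : R -> R) (s t : R) : 0 < orbit_sum (fun _ => 1) F s t.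
Proof. apply sum_n_pos; intros j; rewrite Rmult_1_l; apply exp_pos. Qed.

Definition balanced (w : R -> R) : Prop :=
  forall F, U F -> rigid F -> forall t, 0 < t < 2 * PI -> forall s s',
    orbit_sum w F s t * orbit_sum (fun _ => 1) F s' t =
    orbit_sum w F s' t * orbit_sum (fun _ => 1) F s t.

Lemma orbit_sum_derive (w w' F : R -> R) (s t : R) :
  cont F -> periodic_2PI F -> (forall x, is_derive w x (w' x)) ->
  is_derive (fun t => orbit_sum w F s t) t
    (orbit_sum (fun x => v x * w' x - w x * v1 x) F s t + F t * orbit_sum w' F s t).
Proof.
intros HF HFp Hw.
replace (orbit_sum (fun x => v x * w' x - w x * v1 x) F s t + F t * orbit_sum w' F s t) with
  (orbit_sum (fun x => 1 * (v x * w' x - w x * v1 x) + F t * w' x) F s t)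
  by (rewrite orbit_sum_lin; ring).
apply (is_derive_sum_n (fun j t => w (X F s (t + 2 * PI * INR j)) * jac_inv F s (t + 2 * PI * INR j))).
intros j _.
set (r := t + 2 * PI * INR j).
assert (Hr : forall (f : R -> R) (df : R), is_derive f r df -> is_derive (fun t => f (t + 2 * PI * INR j)) t df).
{ intros f df Hf; replace df with (1 * df) by ring.
  apply (is_derive_comp f (fun t => t + 2 * PI * INR j)); [exact Hf | auto_derive; [trivial | ring]]. }
apply (Hr (fun r => w (X F s r) * jac_inv F s r)).
replace ((1 * (v (X F s r) * w' (X F s r) - w (X F s r) * v1 (X F s r)) + F t * w' (X F s r)) * jac_inv F s r)
  with ((v (X F s r) + F r) * w' (X F s r) * jac_inv F s r +
        w (X F s r) * (- v1 (X F s r) * jac_inv F s r)).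
- apply (is_derive_mult (fun r => w (X F s r)) (jac_inv F s)); [| |intros; apply Rmult_comm].
  + apply (is_derive_comp w (X F s)); [apply Hw | apply solution_solves, HF].
  + apply (jac_inv_derive), HF.
- unfold r at 2; rewrite periodic_shift_nat by exact HFp; ring.
Qed.

Lemma orbit_sum_1_continuous (F : R -> R) (s : R) : cont F ->
  cont (fun t => orbit_sum (fun _ => 1) F s t).
Proof.
intros HF; unfold orbit_sum; solve_continuity.
Qed.

#[local] Hint Resolve orbit_sum_1_continuous : continuity.

Lemma RInt_bump_orbit_sum (F : R -> R) (s t0 : R) (N : nat) : cont F ->
  RInt (fun t => bump N (t - t0) * orbit_sum (fun _ => 1) F s t) 0 (2 * PI) =
  RInt (fun r => bump N (r - t0) * jac_inv F s r) 0 T.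
Proof.
intros HF; unfold T; rewrite (RInt_fold_periods (fun r => bump N (r - t0) * jac_inv F s r)).
- apply RInt_ext; intros t _; unfold orbit_sum.
  symmetry; etransitivity; [|apply (sum_n_mult_l (K := R_Ring) (bump N (t - t0)))].
  apply sum_n_ext; intros j; unfold mult; simpl; rewrite Rmult_1_l.
  replace (t + 2 * PI * INR j - t0) with (t - t0 + 2 * PI * INR j) by ring.
  rewrite periodic_shift_nat by apply bump_periodic; reflexivity.
- solve_continuity.
Qed.

Lemma orbit_sum_1_proportional (F : R -> R) (t s s' : R) : U F -> rigid F -> 0 < t < 2 * PI ->
  orbit_sum (fun _ => 1) F s t * total_weight F s' = orbit_sum (fun _ => 1) F s' t * total_weight F s.
Proof.
intros HU Hex Ht; assert (HF := U_continuous F HU).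
set (phi := fun t => total_weight F s' * orbit_sum (fun _ => 1) F s t + - total_weight F s * orbit_sum (fun _ => 1) F s' t).
assert (cK : forall a s, cont (fun t => a * orbit_sum (fun _ => 1) F s t)) by (intros; solve_continuity).
assert (cb : forall N s, cont (fun t0 => bump N (t0 - t) * orbit_sum (fun _ => 1) F s t0)) by (intros; solve_continuity).
assert (Z : phi t = 0); [|unfold phi in Z; lra].
apply bump_orthogonal_zero; [|exact Ht|intros N].
{ unfold phi; solve_continuity. }
transitivity (RInt (fun t0 => total_weight F s' * (bump N (t0 - t) * orbit_sum (fun _ => 1) F s t0) +
  - total_weight F s * (bump N (t0 - t) * orbit_sum (fun _ => 1) F s' t0)) 0 (2 * PI)).
{ apply RInt_ext; intros t0 _; unfold phi; ring_over_R. }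
rewrite (RInt_plus_continuous (fun t0 => total_weight F s' * (bump N (t0 - t) * orbit_sum (fun _ => 1) F s t0))).
2: solve_continuity.
2: solve_continuity.
rewrite (RInt_scal_continuous (total_weight F s') (fun t0 => bump N (t0 - t) * orbit_sum (fun _ => 1) F s t0)) by apply cb.
rewrite (RInt_scal_continuous (- total_weight F s) (fun t0 => bump N (t0 - t) * orbit_sum (fun _ => 1) F s' t0)) by apply cb.
rewrite !RInt_bump_orbit_sum by exact HF.
assert (A := weighted_integral_proportional
  F (fun r => bump N (r - t)) s s' HU Hex (proj1 (cos_span_test_function (bump N) t (bump_cos_span N)))).
fold T in A; cbv beta in A.
set (a := RInt _ 0 T) in A |- *; set (b := RInt _ 0 T) in A |- *.
match goal with |- @eq _ ?x ?y => change (@eq R x y) end; lra.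
Qed.

Lemma locally_in_period (t : R) : 0 < t < 2 * PI ->
  exists d, 0 < d /\ forall y, Rabs (y - t) < d -> 0 < y < 2 * PI.
Proof.
intros Ht; exists (Rmin t (2 * PI - t)); split; [apply Rmin_pos; lra|].
intros y Hy; assert (A := Rmin_l t (2 * PI - t)); assert (B := Rmin_r t (2 * PI - t)).
apply Rabs_def2 in Hy; lra.
Qed.

Lemma balanced_one : balanced (fun _ => 1).
Proof. intros F _ _ t _ s s'; apply Rmult_comm. Qed.

Lemma orbit_sum_1_derive (F : R -> R) (s t : R) : cont F -> periodic_2PI F ->
  is_derive (fun t => orbit_sum (fun _ => 1) F s t) t (- orbit_sum v1 F s t).
Proof.
intros HF HFp.
assert (D := orbit_sum_derive (fun _ => 1) (fun _ => 0) F s t HF HFp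
  (fun x => @is_derive_const R_AbsRing R_NormedModule 1 x)).
replace (- orbit_sum v1 F s t) with
  (orbit_sum (fun x => v x * 0 - 1 * v1 x) F s t + F t * orbit_sum (fun _ => 0) F s t); [exact D|].
rewrite (orbit_sum_ext (fun x => v x * 0 - 1 * v1 x) (fun x => (-1) * v1 x + 0 * v1 x)) by (intros; ring).
rewrite (orbit_sum_ext (fun _ => 0) (fun x => 0 * v1 x + 0 * v1 x)) by (intros; ring).
rewrite !orbit_sum_lin; ring.
Qed.

Lemma balanced_v1 : balanced v1.
Proof.
intros F HU Hex t Ht s s'; assert (HF := U_continuous F HU).
assert (HFp := U_periodic F HU).
destruct (locally_in_period t Ht) as [d [Hd Hloc]].
assert (D1 := fun s => orbit_sum_1_derive F s t HF HFp).
assert (Z : total_weight F s' * - orbit_sum v1 F s t - total_weight F s * - orbit_sum v1 F s' t = 0).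
{ apply (is_derive_locally_zero (fun t => total_weight F s' * orbit_sum (fun _ => 1) F s t -
    total_weight F s * orbit_sum (fun _ => 1) F s' t) t _ d Hd).
  - intros y Hy; generalize (orbit_sum_1_proportional F y s s' HU Hex (Hloc y Hy)); lra.
  - apply @is_derive_minus; apply (is_derive_scal (fun t => orbit_sum (fun _ => 1) F _ t)), D1. }
assert (A := orbit_sum_1_proportional F t s s' HU Hex Ht).
assert (W := total_weight_pos F s HF).
assert (W' := total_weight_pos F s' HF).
set (k := orbit_sum v1 F s t) in *; set (k' := orbit_sum v1 F s' t) in *.
set (a := orbit_sum (fun _ => 1) F s t) in *; set (a' := orbit_sum (fun _ => 1) F s' t) in *.
set (w := total_weight F s) in *; set (w' := total_weight F s') in *.
apply Rmult_eq_reg_r with (w * w'); [|apply Rgt_not_eq, Rmult_lt_0_compat; assumption].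
replace (k * a' * (w * w')) with ((w' * k) * (a' * w)) by ring.
replace (w' * k) with (w * k') by lra; rewrite <- A; ring.
Qed.

Lemma rigid_family_derivatives (F h : R -> R) : U F -> rigid F -> test_function h ->
  exists d c c1, 0 < d /\
    (forall e, Rabs e < d -> U (fun t => F t + e * h t + c e) /\ rigid (fun t => F t + e * h t + c e)) /\
    (fun t => F t + 0 * h t + c 0) = F /\
    (forall s, RInt (fun r => h r * jac_inv F s r) 0 T + c1 * total_weight F s = 0) /\
    forall s t, 0 <= t <= T ->
      is_derive (fun e => X (fun r => F r + e * h r + c e) s t) 0
        (variation F (fun r => h r + c1) s t) /\
      is_derive (fun e => jac_inv (fun r => F r + e * h r + c e) s t) 0
        (- log_jacobian_variation F (fun r => h r + c1) s t * jac_inv F s t).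
Proof.
intros HU Hex Hh; assert (HF := U_continuous F HU).
assert (HT : 0 < T) by apply period_pos.
assert (Hhc := test_function_continuous h Hh).
destruct (rigid_family F h HU Hex Hh)
  as [d [C [c [Hd [HC H]]]]].
assert (W := total_weight_pos F).
set (I := fun s => RInt (fun r => h r * jac_inv F s r) 0 T).
set (c1 := - I 0 / total_weight F 0).
assert (Hc1 : forall s, I s + c1 * total_weight F s = 0).
{ intros s; unfold c1.
  assert (A := weighted_integral_proportional
    F h s 0 HU Hex Hh); fold T in A; fold (I s) (I 0) in A.
  assert (W0 := W 0 HF); apply Rmult_eq_reg_r with (total_weight F 0); [|lra].
  replace ((I s + - I 0 / total_weight F 0 * total_weight F s) * total_weight F 0) with
    (I s * total_weight F 0 - I 0 * total_weight F s) by (field; lra).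
  lra. }
assert (W0 := W 0 HF).
assert (Hce : forall e, Rabs e < d -> Rabs (c e - c1 * e) <= C / total_weight F 0 * e ^ 2).
{ intros e He; destruct (H e He) as [_ [_ Hs]]; assert (A := Hs 0); fold T in A; fold (I 0) in A.
  replace (c e - c1 * e) with ((e * I 0 + c e * total_weight F 0) * / total_weight F 0) by (unfold c1; field; lra).
  rewrite Rabs_mult, (Rabs_pos_eq (/ _)) by (left; apply Rinv_0_lt_compat; lra).
  replace (C / total_weight F 0 * e ^ 2) with (C * e ^ 2 * / total_weight F 0) by (field; lra).
  apply Rmult_le_compat_r; [left; apply Rinv_0_lt_compat; lra | exact A]. }
assert (c0 : c 0 = 0).
{ assert (A := Hce 0 ltac:(rewrite Rabs_R0; lra)).
  rewrite Rmult_0_r, Rminus_0_r in A; simpl in A; rewrite Rmult_0_l, Rmult_0_r in A.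
  destruct (Req_dec (c 0) 0) as [E | E]; [exact E | generalize (Rabs_pos_lt _ E); lra]. }
assert (G0 : (fun t => F t + 0 * h t + c 0) = F).
{ apply functional_extensionality; intros t; rewrite c0; ring. }
exists d, c, c1; split; [exact Hd|]; split; [intros e He; destruct (H e He) as [A [B _]]; auto|].
split; [exact G0|]; split; [exact Hc1|].
intros s t Ht.
set (k := fun r => h r + c1).
assert (Hk : cont k) by (apply continuous_plus_const, Hhc).
destruct Hh as [Hhp _].
destruct (periodic_bounded h Hhc Hhp) as [K [HK HKb]].
assert (HCW : 0 <= C / total_weight F 0) by (apply Rdiv_le_0_compat; lra).
destruct (first_variation T (K + Rabs c1) (C / total_weight F 0) ltac:(lra)
  ltac:(generalize (Rabs_pos c1); lra) HCW) as [C' [HC' Hfv]].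
assert (Hm : 0 < Rmin d 1) by (apply Rmin_pos; lra).
assert (B : forall e, Rabs (e - 0) < Rmin d 1 ->
  Rabs (X (fun r => F r + e * h r + c e) s t - X F s t - e * variation F k s t) <= C' * e ^ 2 /\
  Rabs (log_jacobian (fun r => F r + e * h r + c e) s t - log_jacobian F s t -
     e * log_jacobian_variation F k s t) <= C' * e ^ 2).
{ intros e He; rewrite Rminus_0_r in He.
  assert (Hed : Rabs e < d) by (apply Rlt_le_trans with (1 := He), Rmin_l).
  assert (He1 : Rabs e < 1) by (apply Rlt_le_trans with (1 := He), Rmin_r).
  destruct (H e Hed) as [HU' _].
  apply Hfv; try assumption; [apply U_continuous, HU' | lra | |].
  - intros r _; apply Rle_trans with (1 := Rabs_triang _ _); generalize (HKb r); lra.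
  - intros r _; unfold k.
    replace (F r + e * h r + c e - F r - e * (h r + c1)) with (c e - c1 * e) by ring.
    apply Hce, Hed. }
split.
- apply is_derive_of_quadratic_bound with C' (Rmin d 1); [exact Hm | exact HC'|].
  intros e He; rewrite G0, Rminus_0_r, (Rmult_comm _ e); apply B, He.
- apply (is_derive_ext (fun e => exp (- log_jacobian (fun r => F r + e * h r + c e) s t)));
    [reflexivity|].
  replace (jac_inv F s t) with (exp (- log_jacobian (fun r => F r + 0 * h r + c 0) s t))
    by (rewrite G0; reflexivity).
  apply (is_derive_comp exp (fun e => - log_jacobian (fun r => F r + e * h r + c e) s t)).
  + apply is_derive_Reals, derivable_pt_lim_exp.
  + apply (is_derive_opp (fun e => log_jacobian (fun r => F r + e * h r + c e) s t)).
    apply is_derive_of_quadratic_bound with C' (Rmin d 1); [exact Hm | exact HC'|].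
    intros e He; rewrite G0, Rminus_0_r, (Rmult_comm _ e); apply B, He.
Qed.

(* Integration by parts: the variation along [H'] is [H] itself, up to terms that are small
   when [H] is small in mean. *)
Lemma variation_of_spike (F : R -> R) (s : R) : cont F ->
  exists C, 0 <= C /\ forall H h c1, (forall t, is_derive H t (h t)) -> cont h ->
    (forall t, 0 <= H t) -> H T = H 0 ->
    RInt (fun r => h r * jac_inv F s r) 0 T + c1 * total_weight F s = 0 ->
    forall t, 0 <= t <= T ->
      Rabs (variation F (fun r => h r + c1) s t - H t) <= C * (H 0 + RInt H 0 T) /\
      Rabs (log_jacobian_variation F (fun r => h r + c1) s t) <= C * (H 0 + RInt H 0 T).
Proof.
intros HF; assert (HT : 0 < T) by apply period_pos.
assert (HM := tame_nonneg).
set (E := exp (M * T)).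
assert (HE : 1 <= E).
{ unfold E; rewrite <- exp_0; apply exp_le_exp, Rmult_le_pos; lra. }
assert (W := total_weight_pos F s HF).
set (w := total_weight F s) in *.
set (A := 1 + E + M * E).
assert (HA : 0 <= A) by (unfold A; assert (0 <= M * E) by (apply Rmult_le_pos; lra); lra).
set (C1 := E * (A + A / w * (T * E))).
assert (HAw : 0 <= A / w) by (apply Rdiv_le_0_compat; lra).
assert (HAwT : 0 <= A / w * (T * E)) by (apply Rmult_le_pos; [exact HAw | apply Rmult_le_pos; lra]).
assert (HC1 : 0 <= C1) by (apply Rmult_le_pos; lra).
exists (C1 + M * (1 + T * C1)); split.
{ assert (0 <= T * C1) by (apply Rmult_le_pos; lra).
  assert (0 <= M * (1 + T * C1)) by (apply Rmult_le_pos; lra); lra. }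
intros H h c1 HH Hh Hpos Hper Hc1.
assert (cH : cont H) by (apply (derive_cont H h HH)).
assert (cJ := jac_inv_continuous F s HF).
assert (cv := v1_solution_continuous F s HF).
assert (cHvJ : cont (fun r => H r * (- v1 (X F s r) * jac_inv F s r))) by solve_continuity.
assert (chJ : cont (fun r => h r * jac_inv F s r)) by solve_continuity.
assert (J0 : jac_inv F s 0 = 1).
{ unfold jac_inv, log_jacobian; rewrite RInt_point; unfold zero; simpl; rewrite Ropp_0; apply exp_0. }
assert (Iint : forall t, RInt (fun r => h r * jac_inv F s r) 0 t =
   H t * jac_inv F s t - H 0 - RInt (fun r => H r * (- v1 (X F s r) * jac_inv F s r)) 0 t).
{ intros t.
  assert (Eq := RInt_of_derive (fun r => H r * jac_inv F s r)
    (fun r => h r * jac_inv F s r + H r * (- v1 (X F s r) * jac_inv F s r)) 0 t).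
  rewrite (RInt_plus_continuous (fun r => h r * jac_inv F s r)), J0, Rmult_1_r in Eq by assumption.
  assert (Eq' := Eq (fun x => is_derive_mult H (jac_inv F s) x (h x) _ (HH x) (jac_inv_derive F s x HF) Rmult_comm)
    (cont_plus _ _ chJ cHvJ)).
  lra. }
set (S := RInt H 0 T).
assert (HS : 0 <= S).
{ assert (B := RInt_ge_const H 0 T 0 ltac:(lra) cH (fun t _ => Hpos t)); unfold S; lra. }
assert (Hrem : forall t, 0 <= t <= T -> Rabs (RInt (fun r => H r * (- v1 (X F s r) * jac_inv F s r)) 0 t) <= M * E * S).
{ intros t Ht.
  apply Rle_trans with (RInt (fun r => M * E * H r) 0 t).
  - apply (norm_RInt_le (V := R_NormedModule) (fun r => H r * (- v1 (X F s r) * jac_inv F s r)) (fun r => M * E * H r) 0 t);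
      [lra | | apply (RInt_correct (V := R_CompleteNormedModule)), ex_RInt_cont, cHvJ
             | apply (RInt_correct (V := R_CompleteNormedModule)), ex_RInt_cont].
    + intros r Hr; change (Rabs (H r * (- v1 (X F s r) * jac_inv F s r)) <= M * E * H r).
      rewrite !Rabs_mult, Rabs_Ropp, (Rabs_pos_eq (H r)) by apply Hpos.
      rewrite (Rabs_pos_eq (jac_inv F s r)) by (left; apply exp_pos).
      rewrite (Rmult_comm (M * E)); apply Rmult_le_compat_l; [apply Hpos|].
      apply Rmult_le_compat; [apply Rabs_pos | left; apply exp_pos | apply hv|].
      apply (jac_inv_bounds F s r HF); fold T; lra.
    + solve_continuity.
  - rewrite (RInt_scal_continuous (M * E) H) by exact cH.
    apply Rmult_le_compat_l; [apply Rmult_le_pos; lra|].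
    unfold S; assert (Ch : RInt H 0 t + RInt H t T = RInt H 0 T)
      by (apply (RInt_Chasles (V := R_CompleteNormedModule)); apply ex_RInt_cont, cH).
    assert (B := RInt_ge_const H t T 0 ltac:(lra) cH (fun r _ => Hpos r)); lra. }
assert (H0 := Hpos 0).
assert (HE0 : forall t, 0 <= t <= T -> 0 < jac_inv F s t <= E).
{ intros t Ht; split; [apply exp_pos | apply (jac_inv_bounds F s t HF Ht)]. }
assert (HI : forall t, 0 <= t <= T ->
   Rabs (RInt (fun r => h r * jac_inv F s r) 0 t - H t * jac_inv F s t) <= H 0 + M * E * S).
{ intros t Ht; rewrite Iint.
  assert (R1 := Hrem t Ht); apply Rabs_le_between in R1; apply Rabs_le_between; lra. }
assert (HMES : 0 <= M * E * S) by (apply Rmult_le_pos; [apply Rmult_le_pos; lra | exact HS]).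
assert (HAS : H 0 + M * E * S + H 0 * E <= A * (H 0 + S)).
{ unfold A.
  assert (0 <= H 0 * E) by (apply Rmult_le_pos; lra); assert (0 <= S * E) by (apply Rmult_le_pos; lra).
  assert (0 <= M * E * H 0) by (apply Rmult_le_pos; [apply Rmult_le_pos|]; lra).
  replace ((1 + E + M * E) * (H 0 + S)) with
    (H 0 + S + H 0 * E + S * E + M * E * H 0 + M * E * S) by ring; lra. }
assert (HHE : 0 <= H 0 * E) by (apply Rmult_le_pos; lra).
assert (Hc : Rabs c1 <= A / w * (H 0 + S)).
{ replace c1 with (- RInt (fun r => h r * jac_inv F s r) 0 T * / w) by (apply Rmult_eq_reg_r with w; [field_simplify; lra | lra]).
  rewrite Rabs_mult, Rabs_Ropp, (Rabs_pos_eq (/ w)) by (left; apply Rinv_0_lt_compat; lra).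
  replace (A / w * (H 0 + S)) with (A * (H 0 + S) * / w) by (field; lra).
  apply Rmult_le_compat_r; [left; apply Rinv_0_lt_compat; lra|].
  assert (B := HI T ltac:(lra)); rewrite Hper in B.
  destruct (HE0 T ltac:(lra)) as [B1 B2].
  assert (0 <= H 0 * jac_inv F s T <= H 0 * E) by (split; [apply Rmult_le_pos | apply Rmult_le_compat_l]; lra).
  apply Rabs_le_between in B; apply Rabs_le_between; lra. }
assert (Hxi : forall t, 0 <= t <= T ->
   Rabs (variation F (fun r => h r + c1) s t - H t) <= C1 * (H 0 + S)).
{ intros t Ht.
  rewrite (variation_plus_const F h c1 s t HF Hh).
  destruct (HE0 t Ht) as [B1 B2].
  assert (Eu : exp (log_jacobian F s t) * jac_inv F s t = 1)
    by (unfold jac_inv; rewrite <- exp_plus, Rplus_opp_r; apply exp_0).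
  assert (Eb : exp (log_jacobian F s t) <= E).
  { apply exp_le_exp; assert (B := log_jacobian_bound F s t HF (proj1 Ht)).
    assert (M * t <= M * T) by (apply Rmult_le_compat_l; lra).
    generalize (Rle_abs (log_jacobian F s t)); lra. }
  set (eu := exp (log_jacobian F s t)) in *.
  assert (Hint : Rabs (c1 * RInt (jac_inv F s) 0 t) <= A / w * (H 0 + S) * (T * E)).
  { rewrite Rabs_mult; apply Rmult_le_compat; try apply Rabs_pos; [exact Hc|].
    apply Rle_trans with ((t - 0) * E).
    - apply abs_RInt_le_const; [lra | apply ex_RInt_cont, cJ|].
      intros r Hr; destruct (HE0 r ltac:(lra)); rewrite Rabs_pos_eq; lra.
    - apply Rmult_le_compat_r; lra. }
  assert (B := HI t Ht).
  set (I := RInt (fun r => h r * jac_inv F s r) 0 t) in *.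
  replace (eu * (I + c1 * RInt (jac_inv F s) 0 t) - H t) with
    (eu * ((I - H t * jac_inv F s t) + c1 * RInt (jac_inv F s) 0 t))
    by (rewrite <- (Rmult_1_r (H t)) at 2; rewrite <- Eu; ring).
  rewrite Rabs_mult, (Rabs_pos_eq eu) by (left; apply exp_pos).
  unfold C1; rewrite Rmult_assoc; apply Rmult_le_compat; [left; apply exp_pos | apply Rabs_pos | exact Eb|].
  apply Rle_trans with (1 := Rabs_triang _ _).
  replace ((A + A / w * (T * E)) * (H 0 + S)) with (A * (H 0 + S) + A / w * (H 0 + S) * (T * E)) by ring.
  lra. }
assert (HTC : 0 <= M * (1 + T * C1) * (H 0 + S)).
{ assert (0 <= T * C1) by (apply Rmult_le_pos; lra).
  apply Rmult_le_pos; [apply Rmult_le_pos|]; lra. }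
assert (HC1S : 0 <= C1 * (H 0 + S)) by (apply Rmult_le_pos; lra).
intros t Ht; fold S; split.
- generalize (Hxi t Ht); lra.
- unfold log_jacobian_variation.
  set (xi := variation F (fun r => h r + c1) s) in *.
  assert (cxi : cont xi).
  { apply variation_continuous; [exact HF | apply continuous_plus_const, Hh]. }
  assert (cg : cont (fun r => M * (H r + C1 * (H 0 + S)))) by solve_continuity.
  apply Rle_trans with (RInt (fun r => M * (H r + C1 * (H 0 + S))) 0 t).
  + apply (norm_RInt_le (V := R_NormedModule) (fun r => v2 (X F s r) * xi r) (fun r => M * (H r + C1 * (H 0 + S))) 0 t);
      [lra | | apply (RInt_correct (V := R_CompleteNormedModule)), ex_RInt_cont
             | apply (RInt_correct (V := R_CompleteNormedModule)), ex_RInt_cont, cg].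
    * intros r Hr; change (Rabs (v2 (X F s r) * xi r) <= M * (H r + C1 * (H 0 + S))).
      rewrite Rabs_mult; apply Rmult_le_compat; try apply Rabs_pos; [apply hv|].
      replace (xi r) with (H r + (xi r - H r)) by ring.
      apply Rle_trans with (1 := Rabs_triang _ _); rewrite (Rabs_pos_eq (H r)) by apply Hpos.
      generalize (Hxi r ltac:(lra)); lra.
    * solve_continuity.
  + rewrite (RInt_scal_continuous M (fun r => H r + C1 * (H 0 + S))) by solve_continuity.
    rewrite (RInt_plus_continuous H (fun _ => C1 * (H 0 + S))) by solve_continuity.
    rewrite (RInt_const (V := R_CompleteNormedModule)); unfold scal; simpl; unfold mult; simpl.
    assert (Ch : RInt H 0 t + RInt H t T = RInt H 0 T)
      by (apply (RInt_Chasles (V := R_CompleteNormedModule)); apply ex_RInt_cont, cH).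
    assert (B := RInt_ge_const H t T 0 ltac:(lra) cH (fun r _ => Hpos r)).
    apply Rle_trans with (M * (1 + T * C1) * (H 0 + S)); [|lra].
    rewrite Rmult_assoc; apply Rmult_le_compat_l; [exact HM|].
    assert ((t - 0) * (C1 * (H 0 + S)) <= T * (C1 * (H 0 + S))) by (apply Rmult_le_compat_r; lra).
    unfold S in *; lra.
Qed.

(** * Balanced functions *)

Lemma orbit_time_range (t : R) (j : nat) : 0 < t < 2 * PI -> (j <= q)%nat ->
  0 <= t + 2 * PI * INR j <= T.
Proof.
intros Ht Hj; assert (P := PI_RGT_0); apply le_INR in Hj; assert (Hp := pos_INR j).
unfold T; rewrite S_INR; split; [|nra].
apply Rplus_le_le_0_compat; [lra | apply Rmult_le_pos; lra].
Qed.

Lemma balanced_infinitesimal (w w' : R -> R) : (forall x, is_derive w x (w' x)) -> balanced w ->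
  forall F h t s s', U F -> rigid F -> 0 < t < 2 * PI -> test_function h ->
  exists c1, (forall s, RInt (fun r => h r * jac_inv F s r) 0 T + c1 * total_weight F s = 0) /\
    let xi s j := variation F (fun r => h r + c1) s (t + 2 * PI * INR j) in
    let up s j := log_jacobian_variation F (fun r => h r + c1) s (t + 2 * PI * INR j) in
    let x s j := X F s (t + 2 * PI * INR j) in
    let J s j := jac_inv F s (t + 2 * PI * INR j) in
    let A s := sum_n (fun j => xi s j * w' (x s j) * J s j + w (x s j) * (- up s j * J s j)) q in
    let B s := sum_n (fun j => xi s j * 0 * J s j + 1 * (- up s j * J s j)) q in
    A s * orbit_sum (fun _ => 1) F s' t + orbit_sum w F s t * B s' =
    A s' * orbit_sum (fun _ => 1) F s t + orbit_sum w F s' t * B s.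
Proof.
intros Hw Hbal F h t s s' HU Hex Ht Hh.
destruct (rigid_family_derivatives
  F h HU Hex Hh) as [d [c [c1 [Hd [HUe [G0 [Hc1 HD]]]]]]].
exists c1; split; [exact Hc1|]; cbv zeta.
set (G := fun e r => F r + e * h r + c e).
assert (G0' : G 0 = F) by exact G0.
assert (DS : forall g g', (forall x, is_derive g x (g' x)) -> forall s,
  is_derive (fun e => orbit_sum g (G e) s t) 0
   (sum_n (fun j => variation F (fun r => h r + c1) s (t + 2 * PI * INR j) *
       g' (X F s (t + 2 * PI * INR j)) * jac_inv F s (t + 2 * PI * INR j) +
      g (X F s (t + 2 * PI * INR j)) * (- log_jacobian_variation F (fun r => h r + c1) s (t + 2 * PI * INR j)
        * jac_inv F s (t + 2 * PI * INR j))) q)).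
{ intros g g' Hg s0.
  apply (is_derive_sum_n (fun j e => g (X (G e) s0 (t + 2 * PI * INR j)) * jac_inv (G e) s0 (t + 2 * PI * INR j))).
  intros j Hj; destruct (HD s0 _ (orbit_time_range t j Ht Hj)) as [D1 D2].
  set (r := t + 2 * PI * INR j) in *.
  assert (Eq := is_derive_mult (fun e => g (X (G e) s0 r)) (fun e => jac_inv (G e) s0 r) 0
    (variation F (fun r => h r + c1) s0 r * g' (X F s0 r))
    (- log_jacobian_variation F (fun r => h r + c1) s0 r * jac_inv F s0 r)).
  cbv beta in Eq; rewrite G0' in Eq; apply Eq; [|exact D2|intros; apply Rmult_comm].
  apply (is_derive_comp g (fun e => X (G e) s0 r)); [rewrite G0'; apply Hg | exact D1]. }
assert (D1 := DS w w' Hw).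
assert (D2 := DS (fun _ => 1) (fun _ => 0) (fun x => @is_derive_const R_AbsRing R_NormedModule 1 x)).
assert (E1 := is_derive_mult _ _ 0 _ _ (D1 s) (D2 s') Rmult_comm).
assert (E2 := is_derive_mult _ _ 0 _ _ (D1 s') (D2 s) Rmult_comm).
assert (E := is_derive_minus _ _ 0 _ _ E1 E2).
cbv beta in E; rewrite G0' in E.
match type of E with is_derive ?f _ ?l => assert (Z : l = 0) end.
{ refine (is_derive_locally_zero _ 0 _ d Hd _ E); intros y Hy; rewrite Rminus_0_r in Hy.
  destruct (HUe y Hy) as [HUy Hexy]; fold (G y) in HUy, Hexy.
  apply Rminus_diag_eq, (Hbal (G y) HUy Hexy t Ht). }
apply Rminus_diag_uniq, Z.
Qed.

Lemma is_lim_seq_of_bound (f : nat -> R) (l C : R) (rho : nat -> R) :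
  is_lim_seq rho 0 -> (forall N, Rabs (f N - l) <= C * rho N) -> is_lim_seq f l.
Proof.
intros Hr Hf; apply is_lim_seq_ext with (fun N => l + (f N - l)); [intros; ring|].
replace (Finite l) with (Finite (l + 0)) by (f_equal; ring).
apply is_lim_seq_plus'; [apply is_lim_seq_const|].
apply is_lim_seq_abs_0, (is_lim_seq_le_le (fun _ => 0) _ (fun N => C * rho N)).
- intros N; split; [apply Rabs_pos | apply Hf].
- apply is_lim_seq_const.
- replace (Finite 0) with (Finite (C * 0)) by (f_equal; ring).
  apply is_lim_seq_mult'; [apply is_lim_seq_const | exact Hr].
Qed.

Lemma is_lim_seq_eq (f g : nat -> R) (a b : R) : is_lim_seq f a -> is_lim_seq g b ->
  (forall N, f N = g N) -> a = b.
Proof.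
intros Hf Hg E; apply (is_lim_seq_ext _ _ _ E) in Hf.
apply is_lim_seq_unique in Hf; apply is_lim_seq_unique in Hg.
rewrite Hg in Hf; injection Hf; auto.
Qed.

Lemma bump_mass_vanishes (t0 : R) : 0 < t0 < 2 * PI ->
  is_lim_seq (fun N => bump N (0 - t0) + RInt (fun r => bump N (r - t0)) 0 T) 0.
Proof.
intros Ht.
apply is_lim_seq_ext with (fun N => bump N (0 - t0) + INR (S q) * RInt (fun r => bump N (r - t0)) 0 (2 * PI)).
- intros N; f_equal; unfold T.
  rewrite (RInt_fold_periods (fun r => bump N (r - t0))) by apply bump_continuous.
  rewrite <- (RInt_scal_continuous (INR (S q)) (fun r => bump N (r - t0))) by apply bump_continuous.
  apply RInt_ext; intros r _.
  rewrite (sum_n_ext _ (fun _ => bump N (r - t0))).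
  + rewrite sum_n_const; reflexivity.
  + intros j; replace (r + 2 * PI * INR j - t0) with (r - t0 + 2 * PI * INR j) by ring.
    apply periodic_shift_nat, bump_periodic.
- replace (Finite 0) with (Finite (0 + INR (S q) * 0)) by (f_equal; ring).
  apply is_lim_seq_plus'.
  + apply bump_vanishes; rewrite Rminus_0_l, cos_neg; apply Rlt_not_eq, cos_lt_1, Ht.
  + apply is_lim_seq_mult'; [apply is_lim_seq_const | apply bump_integral_vanishes, Ht].
Qed.

(* Vary the forcing along the derivative of a spike at time [t]: to first order this translates
   all the orbit points at time [t], while leaving the weights unchanged. *)
Lemma balanced_derive (w w' : R -> R) : (forall x, is_derive w x (w' x)) -> balanced w -> balanced w'.
Proof.
intros Hw Hbal F HU Hex t Ht s s'; assert (HF := U_continuous F HU).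
destruct (variation_of_spike F s HF) as [C [HC Hsp]].
destruct (variation_of_spike F s' HF) as [C' [HC' Hsp']].
fold T in Hsp, Hsp'.
set (rho := fun N => bump N (0 - t) + RInt (fun r => bump N (r - t)) 0 T).
assert (Hrho : is_lim_seq rho 0) by apply (bump_mass_vanishes t Ht).
set (x := fun s j => X F s (t + 2 * PI * INR j)).
set (J := fun s j => jac_inv F s (t + 2 * PI * INR j)).
assert (Hseq : forall N, exists z : (nat -> R) * (nat -> R) * ((nat -> R) * (nat -> R)),
  let xi := fst (fst z) in let up := snd (fst z) in let xi' := fst (snd z) in let up' := snd (snd z) in
  (forall j, (j <= q)%nat -> Rabs (xi j - 1) <= C * rho N /\ Rabs (up j - 0) <= C * rho N /\
                             Rabs (xi' j - 1) <= C' * rho N /\ Rabs (up' j - 0) <= C' * rho N) /\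
  sum_n (fun j => xi j * w' (x s j) * J s j + w (x s j) * (- up j * J s j)) q * orbit_sum (fun _ => 1) F s' t +
  orbit_sum w F s t * sum_n (fun j => xi' j * 0 * J s' j + 1 * (- up' j * J s' j)) q =
  sum_n (fun j => xi' j * w' (x s' j) * J s' j + w (x s' j) * (- up' j * J s' j)) q * orbit_sum (fun _ => 1) F s t +
  orbit_sum w F s' t * sum_n (fun j => xi j * 0 * J s j + 1 * (- up j * J s j)) q).
{ intros N; destruct (cos_span_test_function (bump N) t (bump_cos_span N)) as [_ [h [Hh1 Hh2]]].
  destruct (balanced_infinitesimal w w' Hw Hbal F h t s s' HU Hex Ht Hh2) as [c1 [Hc1 Hid]].
  assert (Hend : bump N (T - t) = bump N (0 - t)).
  { unfold T; replace (2 * PI * INR (S q) - t) with (0 - t + 2 * PI * INR (S q)) by ring.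
    apply periodic_shift_nat, bump_periodic. }
  assert (Hpk : forall j, bump N (t + 2 * PI * INR j - t) = 1).
  { intros j; replace (t + 2 * PI * INR j - t) with (0 + 2 * PI * INR j) by ring.
    rewrite periodic_shift_nat by apply bump_periodic; apply bump_0. }
  assert (B := Hsp (fun r => bump N (r - t)) h c1 Hh1 (test_function_continuous h Hh2)
    (fun r => proj1 (bump_range N (r - t))) Hend (Hc1 s)).
  assert (B' := Hsp' (fun r => bump N (r - t)) h c1 Hh1 (test_function_continuous h Hh2)
    (fun r => proj1 (bump_range N (r - t))) Hend (Hc1 s')).
  exists ((fun j => variation F (fun r => h r + c1) s (t + 2 * PI * INR j),
           fun j => log_jacobian_variation F (fun r => h r + c1) s (t + 2 * PI * INR j)),
          (fun j => variation F (fun r => h r + c1) s' (t + 2 * PI * INR j),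
           fun j => log_jacobian_variation F (fun r => h r + c1) s' (t + 2 * PI * INR j))).
  cbv zeta; simpl fst; simpl snd; split; [|exact Hid].
  intros j Hj; assert (R1 := orbit_time_range t j Ht Hj).
  destruct (B _ R1) as [B1 B2]; destruct (B' _ R1) as [B1' B2']; cbv beta in B1, B1'.
  rewrite Hpk in B1, B1'; rewrite !Rminus_0_r; auto. }
destruct (choice _ _ _ Hseq) as [z Hz]; clear Hseq; cbv zeta in Hz.
set (xi := fun N => fst (fst (z N))) in *; set (up := fun N => snd (fst (z N))) in *.
set (xi' := fun N => fst (snd (z N))) in *; set (up' := fun N => snd (snd (z N))) in *.
assert (L1 : forall j, (j <= q)%nat -> is_lim_seq (fun N => xi N j) 1)
  by (intros j Hj; apply (is_lim_seq_of_bound _ 1 C rho Hrho); intros N; apply (Hz N), Hj).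
assert (L2 : forall j, (j <= q)%nat -> is_lim_seq (fun N => up N j) 0)
  by (intros j Hj; apply (is_lim_seq_of_bound _ 0 C rho Hrho); intros N; apply (Hz N), Hj).
assert (L1' : forall j, (j <= q)%nat -> is_lim_seq (fun N => xi' N j) 1)
  by (intros j Hj; apply (is_lim_seq_of_bound _ 1 C' rho Hrho); intros N; apply (Hz N), Hj).
assert (L2' : forall j, (j <= q)%nat -> is_lim_seq (fun N => up' N j) 0)
  by (intros j Hj; apply (is_lim_seq_of_bound _ 0 C' rho Hrho); intros N; apply (Hz N), Hj).
assert (LS : forall (g g' : R -> R) s (a b : nat -> nat -> R),
  (forall j, (j <= q)%nat -> is_lim_seq (fun N => a N j) 1) ->
  (forall j, (j <= q)%nat -> is_lim_seq (fun N => b N j) 0) ->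
  is_lim_seq (fun N => sum_n (fun j => a N j * g' (x s j) * J s j + g (x s j) * (- b N j * J s j)) q)
    (orbit_sum g' F s t)).
{ intros g g' s0 a b Ha Hb.
  replace (orbit_sum g' F s0 t) with
    (sum_n (fun j => 1 * g' (x s0 j) * J s0 j + g (x s0 j) * (- 0 * J s0 j)) q)
    by (apply sum_n_ext; intros j; unfold x, J; ring_over_R).
  apply (is_lim_seq_sum_n (fun N j => a N j * g' (x s0 j) * J s0 j + g (x s0 j) * (- b N j * J s0 j))).
  intros j Hj; apply is_lim_seq_plus'.
  - apply is_lim_seq_mult'; [|apply is_lim_seq_const].
    apply is_lim_seq_mult'; [apply Ha, Hj | apply is_lim_seq_const].
  - apply is_lim_seq_mult'; [apply is_lim_seq_const|].
    apply is_lim_seq_mult'; [|apply is_lim_seq_const].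
    apply (is_lim_seq_opp (fun N => b N j) 0), Hb, Hj. }
set (k1 := orbit_sum (fun _ => 1) F s t); set (k1' := orbit_sum (fun _ => 1) F s' t).
assert (Z0 : forall s, orbit_sum (fun _ => 0) F s t = 0).
{ intros s0; rewrite (orbit_sum_ext (fun _ => 0) (fun x => 0 * 1 + 0 * 1)) by (intros; ring).
  rewrite (orbit_sum_lin 0 0 (fun _ => 1) (fun _ => 1)); ring. }
assert (Lleft := is_lim_seq_plus' _ _ _ _
  (is_lim_seq_mult' _ _ _ _ (LS w w' s xi up L1 L2) (is_lim_seq_const k1'))
  (is_lim_seq_mult' _ _ _ _ (is_lim_seq_const (orbit_sum w F s t)) (LS (fun _ => 1) (fun _ => 0) s' xi' up' L1' L2'))).
assert (Lright := is_lim_seq_plus' _ _ _ _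
  (is_lim_seq_mult' _ _ _ _ (LS w w' s' xi' up' L1' L2') (is_lim_seq_const k1))
  (is_lim_seq_mult' _ _ _ _ (is_lim_seq_const (orbit_sum w F s' t)) (LS (fun _ => 1) (fun _ => 0) s xi up L1 L2))).
assert (Eq := is_lim_seq_eq _ _ _ _ Lleft Lright (fun N => proj2 (Hz N))).
rewrite !Z0 in Eq; lra.
Qed.

Lemma balanced_bracket (w w' : R -> R) : (forall x, is_derive w x (w' x)) -> balanced w ->
  balanced (fun x => v x * w' x - w x * v1 x).
Proof.
intros Hw Hbal F HU Hex t Ht s s'; assert (HF := U_continuous F HU); assert (HFp := U_periodic F HU).
destruct (locally_in_period t Ht) as [d [Hd Hloc]].
assert (D := fun s => orbit_sum_derive w w' F s t HF HFp Hw).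
assert (D1 := fun s => orbit_sum_1_derive F s t HF HFp).
assert (E1 := is_derive_mult _ _ t _ _ (D s) (D1 s') Rmult_comm).
assert (E2 := is_derive_mult _ _ t _ _ (D s') (D1 s) Rmult_comm).
assert (E := is_derive_minus _ _ t _ _ E1 E2).
match type of E with is_derive ?f _ ?l => assert (Z : l = 0) end.
{ refine (is_derive_locally_zero _ t _ d Hd _ E); intros y Hy.
  apply Rminus_diag_eq, (Hbal F HU Hex y (Hloc y Hy)). }
unfold minus, plus, opp, mult in Z; simpl in Z.
assert (Bw' := balanced_derive w w' Hw Hbal F HU Hex t Ht s s').
assert (Bw := Hbal F HU Hex t Ht s s').
assert (Bv := balanced_v1 F HU Hex t Ht s s').
assert (P1 := orbit_sum_1_pos F s t); assert (P1' := orbit_sum_1_pos F s' t).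
set (k1 := orbit_sum (fun _ => 1) F s t) in *; set (k1' := orbit_sum (fun _ => 1) F s' t) in *.
set (kw := orbit_sum w F s t) in *; set (kw' := orbit_sum w F s' t) in *.
set (kv := orbit_sum v1 F s t) in *; set (kv' := orbit_sum v1 F s' t) in *.
assert (Cross : kw * kv' = kw' * kv).
{ apply Rmult_eq_reg_r with (k1 * k1'); [|apply Rgt_not_eq, Rmult_lt_0_compat; assumption].
  replace (kw * kv' * (k1 * k1')) with ((kw * k1') * (kv' * k1)) by ring.
  rewrite Bw, <- Bv; ring. }
set (b := orbit_sum (fun x => v x * w' x - w x * v1 x) F s t) in *.
set (b' := orbit_sum (fun x => v x * w' x - w x * v1 x) F s' t) in *.
set (d1 := orbit_sum w' F s t) in *; set (d1' := orbit_sum w' F s' t) in *.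
assert (F t * (d1 * k1') = F t * (d1' * k1)) by (rewrite Bw'; reflexivity).
lra.
Qed.

Lemma orbit_sum_point_eval (F : R -> R) (s t k : R) :
  exists l, forall w, point_eval l w = k * orbit_sum w F s t.
Proof.
unfold orbit_sum; generalize q; intros m; induction m.
- exists ((k * jac_inv F s (t + 2 * PI * INR 0), X F s (t + 2 * PI * INR 0)) :: nil)%list.
  intros w; rewrite sum_O; simpl; ring.
- destruct IHm as [l Hl].
  exists ((k * jac_inv F s (t + 2 * PI * INR (S m)), X F s (t + 2 * PI * INR (S m))) :: l)%list.
  intros w; rewrite sum_Sn; simpl point_eval; rewrite Hl; unfold plus; simpl; ring.
Qed.

Definition balance_functional (l : list (R * R)) : Prop :=
  exists F t s s', U F /\ rigid F /\ 0 < t < 2 * PI /\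
    forall w, point_eval l w = orbit_sum w F s t * orbit_sum (fun _ => 1) F s' t -
                               orbit_sum w F s' t * orbit_sum (fun _ => 1) F s t.

Lemma null_balanced (w : R -> R) : null balance_functional w <-> balanced w.
Proof.
split.
- intros H F HU Hex t Ht s s'.
  destruct (orbit_sum_point_eval F s t (orbit_sum (fun _ => 1) F s' t)) as [l Hl].
  destruct (orbit_sum_point_eval F s' t (- orbit_sum (fun _ => 1) F s t)) as [l' Hl'].
  assert (A : point_eval (l ++ l') w = 0).
  { apply H; exists F, t, s, s'; repeat split; try assumption; try apply Ht.
    intros w0; rewrite point_eval_app, Hl, Hl'; ring. }
  rewrite point_eval_app, Hl, Hl' in A; lra.
- intros H l [F [t [s [s' [HU [Hex [Ht Hl]]]]]]]; rewrite Hl.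
  rewrite (H F HU Hex t Ht s s'); ring.
Qed.

Hypothesis v_analytic : analytic_on_circle v.
Hypothesis v_not_trig : ~ exists (a b c : R) (m : Z),
  forall x : R, v x = a * sin (IZR m * x) + b * cos (IZR m * x) + c.

Lemma no_fragile_family : ~ exists F, U F.
Proof.
intros [F0 HU0].
assert (Ev1 : forall x, Derive v x = v1 x) by (intros x; apply is_derive_unique, hv).
destruct (two_harmonics v (tame_continuous) (proj1 v_analytic) v_not_trig)
  as [n [m [Hn [Hm [Hnm [Vn Vm]]]]]].
assert (Hnull : forall N x0, balanced (fun x => bump N (IZR n * (x - x0)))).
{ intros N x0; apply null_balanced.
  apply (null_bump v balance_functional v_analytic) with m; try assumption.
  - apply null_balanced, balanced_one.
  - intros w w' Hw Hnw; apply null_balanced, balanced_derive with w; [exact Hw | apply null_balanced, Hnw].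
  - intros w w' Hw Hnw.
    apply null_ext with (fun x => v x * w' x - w x * v1 x); [intros; now rewrite Ev1|].
    apply null_balanced, balanced_bracket; [exact Hw | apply null_balanced, Hnw]. }
destruct (rigid_after_const F0 HU0) as [c Hex].
assert (HU := U_const F0 c HU0); set (F := fun t => F0 t + c) in *.
assert (HF := U_continuous F HU); assert (P := PI_RGT_0).
assert (Hn' : 0 < IZR n) by (apply IZR_lt; exact Hn).
set (x0 := X F 0 PI).
assert (Hpos : forall j, 0 <= PI + 2 * PI * INR j).
{ intros j; apply Rplus_le_le_0_compat; [lra | apply Rmult_le_pos; [lra | apply pos_INR]]. }
destruct (point_avoiding_lattices (fun j s => X F s (PI + 2 * PI * INR j)) (IZR n) x0 q Hn') as [s1 Hs1].
- intros j; apply (solution_continuous_start F _ HF), Hpos.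
- intros j x y Hxy; apply (solution_increasing F); [exact HF | apply Hpos | exact Hxy].
- set (w := fun N x => bump N (IZR n * (x - x0))).
  assert (Hb := fun N => Hnull N x0 F HU Hex PI ltac:(lra) 0 s1); fold (w 0%nat) in Hb.
  assert (L : is_lim_seq (fun N => orbit_sum (w N) F s1 PI) 0).
  { replace (Finite 0) with (Finite (sum_n (fun j => 0 * jac_inv F s1 (PI + 2 * PI * INR j)) q)).
    - apply (is_lim_seq_sum_n (fun N j => w N (X F s1 (PI + 2 * PI * INR j)) * jac_inv F s1 (PI + 2 * PI * INR j))).
      intros j Hj; apply is_lim_seq_mult'; [|apply is_lim_seq_const].
      apply bump_vanishes, Hs1, Hj.
    - f_equal; rewrite (sum_n_ext _ (fun _ => 0)) by (intros; apply Rmult_0_l).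
      rewrite sum_n_const; apply Rmult_0_r. }
  assert (Hlow : forall N, jac_inv F 0 PI <= orbit_sum (w N) F 0 PI).
  { intros N; unfold orbit_sum; clear -P hv HF; induction q.
    - rewrite sum_O; simpl; rewrite Rmult_0_r, Rplus_0_r.
      unfold w, x0; rewrite Rminus_diag, Rmult_0_r, bump_0; lra.
    - rewrite sum_Sn; unfold plus; simpl; apply Rle_trans with (1 := IHn0).
      assert (0 <= w N (X F 0 (PI + 2 * PI * INR (S n0))) * jac_inv F 0 (PI + 2 * PI * INR (S n0)));
        [|simpl in *; lra].
      apply Rmult_le_pos; [apply bump_range | left; apply exp_pos]. }
  set (k := orbit_sum (fun _ => 1) F s1 PI) in *; set (k0 := orbit_sum (fun _ => 1) F 0 PI) in *.
  assert (Hk : 0 < k) by apply orbit_sum_1_pos.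
  assert (HJ : 0 < jac_inv F 0 PI) by apply exp_pos.
  assert (Le : forall N, jac_inv F 0 PI * k <= orbit_sum (w N) F s1 PI * k0).
  { intros N; unfold w at 1; rewrite <- (Hb N); apply Rmult_le_compat_r; [lra | apply Hlow]. }
  assert (Lim := is_lim_seq_le _ _ _ _ Le (is_lim_seq_const _)
    (is_lim_seq_mult' _ _ _ _ L (is_lim_seq_const k0))).
  simpl in Lim; rewrite Rmult_0_l in Lim.
  assert (0 < jac_inv F 0 PI * k) by (apply Rmult_lt_0_compat; assumption); lra.
Qed.

End Flow.

(** * Genericity and conclusion *)

Lemma Derive_n_periodic (v : R -> R) (n : nat) : periodic_2PI v -> periodic_2PI (Derive_n v n).
Proof.
intros Hv x; rewrite <- Derive_n_comp_trans; apply Derive_n_ext; intros y; apply Hv.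
Qed.

Lemma analytic_on_circle_tame (v : R -> R) : analytic_on_circle v ->
  exists M, tame v (Derive v) (Derive_n v 2) (Derive_n v 3) M.
Proof.
intros [Hp Ha].
assert (B : forall n, exists M, 0 <= M /\ forall x, Rabs (Derive_n v n x) <= M).
{ intros n; apply periodic_bounded; [|apply Derive_n_periodic, Hp].
  apply real_analytic_continuous, real_analytic_Derive_n, Ha. }
destruct (B 0%nat) as [M0 [P0 B0]]; destruct (B 1%nat) as [M1 [P1 B1]].
destruct (B 2%nat) as [M2 [P2 B2]]; destruct (B 3%nat) as [M3 [P3 B3]].
assert (D : forall n x, is_derive (Derive_n v n) x (Derive_n v (S n) x)).
{ intros n x; apply (real_analytic_is_derive (Derive_n v n)), real_analytic_Derive_n, Ha. }
exists (M0 + M1 + M2 + M3); split; try exact Hp.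
- exact (D 0%nat).
- exact (D 1%nat).
- exact (D 2%nat).
- intros x; apply Rle_trans with (1 := B0 x); lra.
- intros x; apply Rle_trans with (1 := B1 x); lra.
- intros x; apply Rle_trans with (1 := B2 x); lra.
- intros x; apply Rle_trans with (1 := B3 x); lra.
Qed.

Section Genericity.

Variable v : R -> R.
Hypothesis v_analytic : analytic_on_circle v.
Hypothesis v_not_trig : ~ exists (a b c : R) (m : Z),
  forall x : R, v x = a * sin (IZR m * x) + b * cos (IZR m * x) + c.

Lemma robust_dense (p : Z) (q : nat) (f0 : R -> R) (eta : R) : test_function f0 -> 0 < eta ->
  exists h A, periodic_2PI h /\ unit_analytic h eta /\ robust v p q (fun t => A + (f0 t + h t)).
Proof.
intros Hf0 Heta; apply NNPP; intros Hno.
destruct (analytic_on_circle_tame v v_analytic) as [M hv].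
assert (Hc : forall h C, unit_analytic h C -> cont h)
  by (intros h C H; apply real_analytic_continuous, unit_analytic_real_analytic with C, H).
set (U := fun F => exists h A eta', eta' < eta /\ periodic_2PI h /\ unit_analytic h eta' /\
  F = (fun t => A + (f0 t + h t))).
apply (no_fragile_family v (Derive v) (Derive_n v 2) (Derive_n v 3) M hv p q U); try assumption.
- intros F [h [A [eta' [He [Hp [Hh ->]]]]]].
  assert (C1 := test_function_continuous f0 Hf0); assert (C2 := Hc h eta' Hh); solve_continuity.
- intros F [h [A [eta' [He [Hp [Hh ->]]]]]] t; rewrite Hp, (proj1 Hf0 t); reflexivity.
- intros F c [h [A [eta' [He [Hp [Hh ->]]]]]].
  exists h, (A + c), eta'; repeat split; try assumption.
  apply functional_extensionality; intros t; ring.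
- intros F g [h [A [eta' [He [Hp [Hh ->]]]]]] [Hgp [C Hg]].
  assert (HC : 0 <= C) by (generalize (unit_analytic_bound g C Hg 0) (Rabs_pos (g 0)); lra).
  exists ((eta - eta') / (C + 1)); split; [apply Rdiv_lt_0_compat; lra|].
  intros e Hae; exists (fun t => h t + e * g t), A, (eta' + Rabs e * C).
  split; [|split; [|split]].
  + assert (Rabs e * (C + 1) < eta - eta').
    { replace (eta - eta') with ((eta - eta') / (C + 1) * (C + 1)) by (field; lra).
      apply Rmult_lt_compat_r; lra. }
    generalize (Rabs_pos e); nra.
  + intros t; rewrite Hp, Hgp; reflexivity.
  + apply unit_analytic_plus; [exact Hh | apply unit_analytic_scal, Hg].
  + apply functional_extensionality; intros t; ring.
- intros F [h [A [eta' [He [Hp [Hh ->]]]]]] Hr.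
  apply Hno; exists h, A; split; [exact Hp|]; split; [|exact Hr].
  apply unit_analytic_weaken with eta'; [lra | exact Hh].
- exists (fun t => 0 + (f0 t + 0)), (fun _ => 0), 0, 0; repeat split; try assumption.
  apply unit_analytic_zero.
Qed.

Definition stably_locked (p : Z) (q : nat) (g : R -> R) (d : R) : Prop :=
  forall f, cont f -> periodic_2PI f -> (forall t, Rabs (f t - g t) <= d) ->
  has_phase_lock_area v f (IZR p / INR (S q)).

Lemma stably_locked_dense (p : Z) (q : nat) (f0 : R -> R) (eta : R) : test_function f0 -> 0 < eta ->
  exists g d, test_function g /\ unit_analytic (fun t => g t - f0 t) eta /\
    0 < d <= eta /\ stably_locked p q g d.
Proof.
intros Hf0 Heta.
destruct (analytic_on_circle_tame v v_analytic) as [M hv].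
destruct (robust_dense p q f0 eta Hf0 Heta) as [h [A [Hp [Hh HR]]]].
assert (Hg : test_function (fun t => f0 t + h t))
  by (apply test_function_plus; [exact Hf0 | split; [exact Hp | exists eta; exact Hh]]).
destruct (robust_phase_lock_area v _ _ _ M hv p q (fun t => f0 t + h t) A (test_function_continuous _ Hg) HR)
  as [d [Hd Hlock]].
exists (fun t => f0 t + h t), (Rmin d eta); split; [exact Hg|]; split; [|split].
- replace (fun t => f0 t + h t - f0 t) with h; [exact Hh|].
  apply functional_extensionality; intros t; ring.
- split; [apply Rmin_pos; assumption | apply Rmin_r].
- intros f Hfc Hfp Hf; apply Hlock; try assumption.
  intros t; apply Rle_trans with (1 := Hf t), Rmin_l.
Qed.

Definition stage : Type := {gd : (R -> R) * R | test_function (fst gd) /\ 0 < snd gd}.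

Lemma generic_sequence (r : nat -> Z * nat) :
  exists (g : nat -> R -> R) (d : nat -> R), g 0%nat = (fun _ => 0) /\ d 0%nat = 1 /\
    forall k, test_function (g k) /\ 0 < d k /\
      unit_analytic (fun t => g (S k) t - g k t) (d k / 2) /\ d (S k) <= d k / 2 /\
      stably_locked (fst (r k)) (snd (r k)) (g (S k)) (d (S k)).
Proof.
set (next := fun (k : nat) (s s' : stage) =>
  unit_analytic (fun t => fst (proj1_sig s') t - fst (proj1_sig s) t) (snd (proj1_sig s) / 2) /\
  snd (proj1_sig s') <= snd (proj1_sig s) / 2 /\
  stably_locked (fst (r k)) (snd (r k)) (fst (proj1_sig s')) (snd (proj1_sig s'))).
assert (Hnext : forall ks : nat * stage, exists s', next (fst ks) (snd ks) s').
{ intros [k [[f0 d0] [Hf0 Hd0]]]; simpl in *.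
  destruct (stably_locked_dense (fst (r k)) (snd (r k)) f0 (d0 / 2) Hf0 ltac:(lra)) as [g [d [Hg [Hu [Hd Hl]]]]].
  exists (exist _ (g, d) (conj Hg (proj1 Hd))); unfold next; simpl; tauto. }
destruct (choice _ _ _ Hnext) as [step Hstep].
assert (H0 : test_function (fst ((fun _ : R => 0), 1)) /\ 0 < snd ((fun _ : R => 0), 1)).
{ simpl; split; [split; [intros t; reflexivity | exists 0; apply unit_analytic_zero] | lra]. }
set (st := nat_rect (fun _ => stage) (exist _ ((fun _ => 0), 1) H0) (fun k s => step (k, s))).
exists (fun k => fst (proj1_sig (st k))), (fun k => snd (proj1_sig (st k))).
split; [reflexivity|]; split; [reflexivity|]; intros k.
destruct (proj2_sig (st k)) as [H1 H2]; split; [exact H1|]; split; [exact H2|].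
exact (Hstep (k, st k)).
Qed.

Lemma locked_for_countably_many (r : nat -> Z * nat) :
  exists f, analytic_on_circle f /\
    forall k, has_phase_lock_area v f (IZR (fst (r k)) / INR (S (snd (r k)))).
Proof.
destruct (generic_sequence r) as [g [d [Hg0 [Hd0 H]]]].
assert (Hdpos : forall k, 0 < d k) by apply H.
assert (Hdk : forall k, d k <= (/ 2) ^ k).
{ induction k; [rewrite Hd0; simpl; lra|].
  destruct (H k) as [_ [_ [_ [A _]]]]; simpl; lra. }
set (f := fun t => Series (fun k => g (S k) t - g k t)).
assert (HsC : ex_series (fun k => d k / 2)).
{ apply ex_series_dominated with (fun k => (/ 2) ^ k).
  - intros k; rewrite Rabs_pos_eq; generalize (Hdpos k) (Hdk k); lra.
  - apply ex_series_geom; rewrite Rabs_pos_eq; lra. }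
assert (Hf : unit_analytic f (Series (fun k => d k / 2))).
{ apply (unit_analytic_Series (fun k t => g (S k) t - g k t)); [intros k; apply H | exact HsC]. }
assert (Hfp : periodic_2PI f).
{ intros t; unfold f; apply Series_ext; intros k.
  destruct (H k) as [[A _] _]; destruct (H (S k)) as [[B _] _]; rewrite A, B; reflexivity. }
assert (Hfa : real_analytic f) by (apply unit_analytic_real_analytic with (1 := Hf)).
assert (Hlim : forall t, is_lim_seq (fun n => g n t) (f t)).
{ intros t; apply is_lim_seq_incr_1.
  assert (Hex : ex_series (fun k => g (S k) t - g k t)).
  { apply ex_series_dominated with (2 := HsC); intros k.
    apply (unit_analytic_bound (fun t => g (S k) t - g k t)), H. }
  apply is_lim_seq_ext with (sum_n (fun k => g (S k) t - g k t)); [|exact (Series_correct _ Hex)].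
  intros n; induction n.
  - rewrite sum_O, Hg0; ring.
  - rewrite sum_Sn, IHn; unfold plus; simpl; ring. }
exists f; split; [split; assumption|].
intros k; destruct (H k) as [_ [_ [_ [_ Hl]]]].
apply Hl; [apply real_analytic_continuous, Hfa | exact Hfp|]; intros t.
assert (Hcl : forall i, Rabs (g (i + S k)%nat t - g (S k) t) <= d (S k) - d (i + S k)%nat).
{ induction i; [simpl; rewrite !Rminus_diag, Rabs_R0; lra|].
  destruct (H (i + S k)%nat) as [_ [_ [A [B _]]]].
  assert (C := unit_analytic_bound _ _ A t); cbv beta in C; change (S i + S k)%nat with (S (i + S k)).
  replace (g (S (i + S k)) t - g (S k) t) with
    ((g (S (i + S k)) t - g (i + S k)%nat t) + (g (i + S k)%nat t - g (S k) t)) by ring.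
  apply Rle_trans with (1 := Rabs_triang _ _); lra. }
assert (L : is_lim_seq (fun i => Rabs (g (i + S k)%nat t - g (S k) t)) (Rabs (f t - g (S k) t))).
{ apply (is_lim_seq_abs _ (Finite (f t - g (S k) t))).
  apply is_lim_seq_minus'; [|apply is_lim_seq_const].
  apply (is_lim_seq_incr_n (fun n => g n t) (S k)), Hlim. }
refine (is_lim_seq_le _ (fun _ => d (S k)) _ (d (S k)) _ L (is_lim_seq_const _)).
intros i; generalize (Hcl i) (Hdpos (i + S k)%nat); lra.
Qed.

End Genericity.

Definition rational_enumeration (k : nat) : Z * nat :=
  let (a, b) := Cantor.of_nat k in let (c, d) := Cantor.of_nat a in ((Z.of_nat c - Z.of_nat d)%Z, b).

Lemma rational_enumeration_surjective (p : Z) (q : nat) : exists k, rational_enumeration k = (p, q).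
Proof.
exists (Cantor.to_nat (Cantor.to_nat (Z.to_nat p, Z.to_nat (- p)), q)).
unfold rational_enumeration; rewrite !Cantor.cancel_of_to; f_equal; lia.
Qed.

Theorem theorem1p3 (v : R -> R)
  (hv : analytic_on_circle v)
  (hv_not_trig : ~ exists (a b c : R) (m : Z),
      forall x : R, v x = a * sin (IZR m * x) + b * cos (IZR m * x) + c) :
  exists f : R -> R,
    analytic_on_circle f /\
    forall r : Q, has_phase_lock_area v f (Q2R r).
Proof.
destruct (locked_for_countably_many v hv hv_not_trig rational_enumeration) as [f [Hf H]].
exists f; split; [exact Hf|]; intros [p q].
destruct (rational_enumeration_surjective p (pred (Pos.to_nat q))) as [k Hk].
assert (A := H k); rewrite Hk in A; simpl fst in A; simpl snd in A.
rewrite Nat.succ_pred_pos, INR_IZR_INZ, positive_nat_Z in A by apply Pos2Nat.is_pos.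
exact A.
Qed.
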